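(* Let $M_3^{(2)}(\lambda,\widetilde\eta,\psi)=(\ell_2,C_2,r_2)$ be the two-dimensional hard-disc map of the context, with $\widetilde\eta=\pi\eta^2/2$. On $B_2=[1,5]\times[5,15]\times[0,\tfrac3{20}]$ in the coordinates $(\lambda,\widetilde\eta,\psi)$, equivalently $\eta\in[\sqrt{10/\pi},\sqrt{30/\pi}\,]\approx[1.784,3.090]$ tangent units, with mean degrees $\ell_2$ spanning about $2$–$17$, the map $M_3^{(2)}$ is injective ($\psi=0$ included) and satisfies $\sigma_{\min}(DM_3^{(2)})\ge1/100$ uniformly.
   Context: Let $a(u)=\sqrt3(2u-1)$, $a_i=a(u_i)$, $H_{ij}=1-e^{-\lambda u_iu_j}$, and for $q\in\{2,3,4\}$ let $\omega_q=1+\psi\sum_{1\le i<j\le q}a_ia_j+\mathbf 1\{q=4\}\frac32\psi^2a_1a_2a_3a_4$. Define functions of $(\lambda,\psi)$ (integrals with respect to Lebesgue measure in the $u_i$): $E=\int_{[0,1]^2}H_{12}\omega_2$, $S=\int_{[0,1]^3}H_{12}H_{13}\omega_3$, $T=\int_{[0,1]^3}H_{12}H_{13}H_{23}\omega_3$, $P=\int_{[0,1]^4}H_{12}H_{13}H_{24}\omega_4$, $Q=\int_{[0,1]^4}H_{12}H_{13}H_{14}\omega_4$. With $c_2=1-\frac{3\sqrt3}{4\pi}$, the planar hard-disc map is $$\ell_2=\pi\eta^2E,\qquad C_2=c_2\frac TS,\qquad r_2=\frac{\pi\eta^2(PE-S^2)+c_2TE}{\pi\eta^2(QE-S^2)+SE},$$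 regarded as a function of $(\lambda,\widetilde\eta,\psi)$ through $\pi\eta^2=2\widetilde\eta$. (These are the limiting mean degree, transitivity, and edge endpoint-degree correlation of the homogeneous sparse two-dimensional random-connection model with hard-disc range $\eta$ in tangent units, i.e. displacements rescaled by the connection-range scale, and one-harmonic popularity–position dependence of strength $\psi$.) $DM_3^{(2)}$ is the Jacobian in $(\lambda,\widetilde\eta,\psi)$ and $\sigma_{\min}$ its smallest singular value; derivatives at $\psi=0$ are those of the polynomial expressions in $\psi$. *)

(* Defs.v *)
From mathcomp Require Import all_boot all_order all_algebra.
From mathcomp Require Import all_classical all_reals all_analysis.

Set Implicit Arguments.
Unset Strict Implicit.
Unset Printing Implicit Defensive.

Import Order.TTheory GRing.Theory Num.Theory.
Import numFieldNormedType.Exports.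

Local Open Scope classical_set_scope.
Local Open Scope ring_scope.

Section Motifs.
Context {R : realType}.
Implicit Types (lambda psi u v : R).

(* The function a(u): the first nonconstant L^2([0,1])-normalized Legendre
   polynomial. *)
Definition harm1 u : R := Num.sqrt 3 * (2 * u - 1).

Definition Hconn lambda u v : R := 1 - expR (- (lambda * u * v)).

(* The number q of labels is the length of the tuple. *)
Definition omega q psi (u : q.-tuple R) : R :=
  1 + psi * (\sum_(i < q) \sum_(j < q | (i < j)%N)
               harm1 (tnth u i) * harm1 (tnth u j))
    + (if q == 4 then 3 / 2 * psi ^+ 2 * \prod_(i < q) harm1 (tnth u i)
       else 0).

Local Notation mu := (@lebesgue_measure R).
Local Notation mu2 := (mu \x mu)%E.
Local Notation mu3 := (mu2 \x mu)%E.
Local Notation mu4 := (mu3 \x mu)%E.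
Local Notation I := `[0%R, 1%R]%classic.

Definition motifE lambda psi : R :=
  \int[mu2]_(u in I `*` I)
    let: (u1, u2) := u in
    (Hconn lambda u1 u2 * omega psi [tuple u1; u2]).

Definition motifS lambda psi : R :=
  \int[mu3]_(u in I `*` I `*` I)
    let: (u1, u2, u3) := u in
    (Hconn lambda u1 u2 * Hconn lambda u1 u3 * omega psi [tuple u1; u2; u3]).

Definition motifT lambda psi : R :=
  \int[mu3]_(u in I `*` I `*` I)
    let: (u1, u2, u3) := u in
    (Hconn lambda u1 u2 * Hconn lambda u1 u3 * Hconn lambda u2 u3
       * omega psi [tuple u1; u2; u3]).

Definition motifP lambda psi : R :=
  \int[mu4]_(u in I `*` I `*` I `*` I)
    let: (u1, u2, u3, u4) := u in
    (Hconn lambda u1 u2 * Hconn lambda u1 u3 * Hconn lambda u2 u4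
       * omega psi [tuple u1; u2; u3; u4]).

Definition motifQ lambda psi : R :=
  \int[mu4]_(u in I `*` I `*` I `*` I)
    let: (u1, u2, u3, u4) := u in
    (Hconn lambda u1 u2 * Hconn lambda u1 u3 * Hconn lambda u1 u4
       * omega psi [tuple u1; u2; u3; u4]).

End Motifs.

Section HardDisc.
Context {R : realType}.
Implicit Types (lambda eta psi : R) (x : 'rV[R]_3).

Definition c2 : R := 1 - 3 * Num.sqrt 3 / (4 * pi).

Definition ell2 lambda eta psi : R := pi * eta ^+ 2 * motifE lambda psi.

Definition C2 lambda psi : R := c2 * (motifT lambda psi / motifS lambda psi).

Definition r2 lambda eta psi : R :=
  let E := motifE lambda psi in let S := motifS lambda psi in
  let T := motifT lambda psi in let P := motifP lambda psi in
  let Q := motifQ lambda psi in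
  (pi * eta ^+ 2 * (P * E - S ^+ 2) + c2 * T * E) /
  (pi * eta ^+ 2 * (Q * E - S ^+ 2) + S * E).

(* The positive solution of pi * eta ^ 2 = 2 * etat, for etat > 0. *)
Definition eta_of (etat : R) : R := Num.sqrt (2 * etat / pi).

(* Coordinates are ordered (lambda, etat, psi).  The formulas make sense for
   psi of either sign, so derivatives at psi = 0 are two-sided. *)
Definition M3 x : 'rV[R]_3 :=
  let lambda := x 0 0 in let eta := eta_of (x 0 1) in let psi := x 0 ord_max in
  \row_j tnth [tuple ell2 lambda eta psi; C2 lambda psi; r2 lambda eta psi] j.

Definition B2 : set 'rV[R]_3 :=
  [set x | [/\ x 0 0 \in `[1, 5], x 0 1 \in `[5, 15]
             & x 0 ord_max \in `[0, 3 / 20]]].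

(* The library's jacobian acts on row vectors by right multiplication: it is
   the transpose of the matrix whose (i, j) entry is the derivative of the
   i-th component in the j-th coordinate. *)
Definition DM3 x : 'M[R]_3 := ('J M3 x)^T.

Definition singular_values n (A : 'M[R]_n) : set R :=
  [set Num.sqrt a | a in [set a | eigenvalue (A^T *m A) a]].

(* For n > 0 the set of singular values is finite and nonempty, so the
   infimum is a minimum. *)
Definition sigma_min n (A : 'M[R]_n) : R := inf (singular_values A).

End HardDisc.

(* Main.v *)
(* In the variables lambda and psi, the motif integrals E, S, T, P, Q are
   polynomials in psi whose twelve coefficients are integrals of products of
   values of h(x) = 1 - exp (- x) and of 2 u_i - 1.  Replacing h on [0, 5] by a
   polynomial p of degree 14 makes these coefficients polynomials in lambda; p is
   chosen such that y = p'(5 z) satisfies y' + 5 y = 0 up to a multiple of a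
   Chebyshev polynomial, and p' is accurate to 2^-30.  Fixed-point Taylor models on 39 cells
   covering [1, 5] x [0, 3/20] then certify finitely many polynomial
   inequalities; the dependence on x = 2 etat is quadratic and is handled by
   Bernstein coefficients on [10, 30].

   These inequalities bound the inverse Jacobian.  At constant mean degree x is
   a function of (lambda, psi), and what remains is a 2 x 2 system for (C, r).
   Its second row (f, k) satisfies k >= 1/2 and |f| <= rho k, where rho is a
   constant of the cell, so that the determinant is at least k times
   d - rho e > 0, (d, e) being the gradient of C.  The Frobenius norm of the
   inverse is at most 100, hence |v| <= 100 |J v|.

   If two points had the same image, the fibre of C through them would be a
   graph psi = phi(lambda) along which E increases; with x = ell / E the curve
   stays in the box, ell and C are constant on it, and Rolle's theorem applied
   to r gives a point where J v = 0 with v = (1, x'/2, phi') <> 0. *)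

(* A nowhere singular Jacobian does not make a map injective on a box. This is why the certificate
   also fixes signs: those of the two partial derivatives of [T / S] and of a 2 x 2 minor of [E] and
   [T / S]. They make the common fibre of [ell2] and [C2] an explicit curve, monotone in each
   coordinate, which therefore stays in the box between its two end points. The bound
   [|v| <= 100 |J v|] then serves a second time, to exclude a critical point of [r2] on this curve.
   Only values and first derivatives in [lambda] of twelve integrals are needed, so [h] has to be
   approximated in the C^1 sense. The error is controlled through the derivative: a small residual
   in the linear equation of [exp (- 5 z)] bounds the distance from it. The programs are written
   over a record of operations. Run on integers, they yield the certificate; run on reals, they
   yield the motif polynomials and the inequalities to be proved. A relation preserved by each
   operation links the two runs. *)
Require Import Defs.
From HB Require Import structures.
From Stdlib Require Import ZArith Lia.
From mathcomp Require Import all_boot all_order all_algebra.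
From mathcomp Require Import all_classical all_reals all_analysis.
From mathcomp Require Import measurable_realfun ssrZ ring lra.
Import Order.TTheory GRing.Theory Num.Theory.
Import numFieldNormedType.Exports.
Set Implicit Arguments.
Unset Strict Implicit.
Unset Printing Implicit Defensive.
Local Open Scope classical_set_scope.
Local Open Scope ring_scope.

(** * Bounded measurable functions *)

Section BoundedMeasurable.
Context {d} {T : measurableType d} {R : realType}.
Variables (mu : {measure set T -> \bar R}) (D : set T).
Hypothesis mD : measurable D.
Hypothesis muD : mu D = 1%E.

(** Measurability is required on the whole space, so that it passes to sections and to compositions
    with projections; boundedness only on [D], since the labels are bounded only on the cube. *)
Definition bm (f : T -> R) :=
  measurable_fun setT f /\ exists M, forall x, D x -> `|f x| <= M.

Lemma bm_cst (c : R) : bm (fun _ => c).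
Proof. by split; [exact: measurable_cst | exists `|c|]. Qed.

Lemma bmD f g : bm f -> bm g -> bm (fun x => f x + g x).
Proof.
move=> [mf [M fM]] [mg [N gN]]; split; first exact: measurable_funD.
exists (M + N) => x Dx; apply: le_trans (ler_normD _ _) _.
by apply: lerD; [exact: fM | exact: gN].
Qed.

Lemma bmM f g : bm f -> bm g -> bm (fun x => f x * g x).
Proof.
move=> [mf [M fM]] [mg [N gN]]; split; first exact: measurable_funM.
exists (M * N) => x Dx; rewrite normrM.
by apply: ler_pM => //; [exact: fM | exact: gN].
Qed.

Lemma bmN f : bm f -> bm (fun x => - f x).
Proof.
move=> bf; rewrite (_ : (fun x => - f x) = (fun x => (-1) * f x)).
  exact: (bmM (bm_cst _) bf).
by apply/funext => x; rewrite mulN1r.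
Qed.

Lemma bmB f g : bm f -> bm g -> bm (fun x => f x - g x).
Proof. by move=> bf bg; apply: bmD bf (bmN bg). Qed.

Lemma bm_integrable f : bm f -> mu.-integrable D (EFin \o f).
Proof.
move=> [mf [M fM]]; apply: measurable_bounded_integrable => //.
- by rewrite muD ltry.
- exact: measurable_funTS.
- exists M; split; first exact: num_real.
  by move=> N MN x Dx; apply: le_trans (fM x Dx) (ltW MN).
Qed.

Lemma bm_intD f g : bm f -> bm g ->
  \int[mu]_(x in D) (f x + g x) =
  \int[mu]_(x in D) f x + \int[mu]_(x in D) g x.
Proof. by move=> bf bg; rewrite RintegralD//; exact: bm_integrable. Qed.

Lemma bm_intB f g : bm f -> bm g ->
  \int[mu]_(x in D) (f x - g x) =
  \int[mu]_(x in D) f x - \int[mu]_(x in D) g x.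
Proof. by move=> bf bg; rewrite RintegralB//; exact: bm_integrable. Qed.

Lemma bm_intZl c f : bm f ->
  \int[mu]_(x in D) (c * f x) = c * \int[mu]_(x in D) f x.
Proof. by move=> bf; rewrite RintegralZl//; exact: bm_integrable. Qed.

Lemma bm_int_norm f M : bm f -> (forall x, D x -> `|f x| <= M) ->
  `|\int[mu]_(x in D) f x| <= M.
Proof.
move=> bf fM; apply: le_trans (le_normr_Rintegral mD (bm_integrable bf)) _.
have bN : bm (fun x => `|f x|).
  case: bf => mf [N fN]; split; first exact: measurableT_comp.
  by exists N => x Dx; rewrite normr_id fN.
apply: (@le_trans _ _ (\int[mu]_(x in D) M)).
  by apply: le_Rintegral => //; apply: bm_integrable => //; exact: bm_cst.
by rewrite Rintegral_cst// muD/= mulr1.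
Qed.

End BoundedMeasurable.

(** Fubini is applied to the extension of [f] by zero outside the rectangle. A section through a
    point of [A] is bounded on [B], so its extended-real integral is finite and [fine] can be
    removed; at the other points both sides vanish. *)
Lemma bm_Fubini {d1 d2} {T1 : measurableType d1} {T2 : measurableType d2}
    {R : realType} (m1 : {sigma_finite_measure set T1 -> \bar R})
    (m2 : {sigma_finite_measure set T2 -> \bar R}) (A : set T1) (B : set T2)
    (f : T1 * T2 -> R) :
  measurable A -> measurable B -> m1 A = 1%E -> m2 B = 1%E ->
  bm (A `*` B) f ->
  \int[(m1 \x m2)%E]_(z in A `*` B) f z =
  \int[m1]_(x in A) \int[m2]_(y in B) f (x, y).
Proof.
move=> mA mB m1A m2B [mf [M fM]].
have mAB : measurable (A `*` B) by exact: measurableX.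
have mAB1 : (m1 \x m2)%E (A `*` B) = 1%E.
  rewrite product_measure1E//; transitivity ((m1 A) * (m2 B))%E => //.
  by rewrite m1A m2B mule1.
have intf : (m1 \x m2)%E.-integrable setT (EFin \o (f \_ (A `*` B))).
  have := @bm_integrable _ _ _ (m1 \x m2)%E (A `*` B) mAB mAB1 f
    (conj mf (ex_intro _ M fM)).
  by move/(integrable_mkcond _ mAB); rewrite restrict_EFin.
have sec x : bm B (fun y => f (x, y)) \/ ~ A x.
  have [Ax|] := pselect (A x); last by right.
  left; split; first exact: (measurableT_comp mf (pair1_measurable x)).
  by exists M => y By; apply: fM.
rewrite Rintegral_mkcond /Rintegral -(integral12_prod_meas1 intf).
congr fine; rewrite [RHS]integral_mkcond; apply: eq_integral => x _.
rewrite /fubini_F /= /patch.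
case: ifPn => [xA|xA]; last first.
  by apply: integral0_eq => y _; rewrite in_setX (negbTE xA).
rewrite fineK; last first.
  case: (sec x) => [bf|]; last by move: xA; rewrite inE.
  exact: integrable_fin_num (bm_integrable mB m2B bf).
rewrite [RHS]integral_mkcond; apply: eq_integral => y _ /=.
rewrite /patch in_setX xA /=.
by case: ifP.
Qed.

(** * Integrals of products of edge functions *)

Lemma Forall_consE {A} (P : A -> Prop) x l :
  List.Forall P (x :: l) -> P x /\ List.Forall P l.
Proof. by move=> h; inversion h. Qed.

Section EdgeProducts.
Context {T : Type} {R : realType}.
Implicit Types (s : T -> R) (l : seq (T -> R)) (f df g dg : R -> R).

(** The entries of [l] are the products [u_i u_j] over the edges of a motif, as functions of the
    label vector; for [f = expc] this is the product of the [Hconn] factors. *)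
Fixpoint eprod f l (lam : R) (x : T) : R :=
  if l is s :: l' then f (lam * s x) * eprod f l' lam x else 1.

Fixpoint deprod f df l (lam : R) (x : T) : R :=
  if l is s :: l' then
    s x * df (lam * s x) * eprod f l' lam x
    + f (lam * s x) * deprod f df l' lam x
  else 0.

Lemma is_derive_eprod f df l (lam : R) (x : T) :
  (forall y : R, is_derive y 1 f (df y)) ->
  is_derive lam 1 (fun t => eprod f l t x) (deprod f df l lam x).
Proof.
move=> fdf; elim: l => [|s l IH] /=; first exact: is_derive_cst.
have h : is_derive lam 1 (fun t => f (t * s x)) (s x * df (lam * s x)).
  have h1 : is_derive lam 1 (fun t : R => t * s x) (s x).
    have := @is_deriveM _ _ id (cst (s x)) lam 1 _ _ (is_derive_id _ _)
      (is_derive_cst _ _ _).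
    by rewrite scaler0 add0r /GRing.scale /= mulr1.
  have h2 := fdf (lam * s x).
  have := @is_derive1_comp _ f (fun t => t * s x) lam _ _ h2 h1.
  by rewrite mulrC.
have := @is_deriveM _ _ _ _ lam 1 _ _ h IH.
by rewrite /GRing.scale /= addrC [_ * (s x * _)]mulrC.
Qed.

Definition unit_edges (D : set T) l :=
  forall x, D x -> List.Forall (fun s => 0 <= s x <= 1) l.

Lemma eprod_bound f l (c M : R) lam x :
  (forall y, 0 <= y <= c -> `|f y| <= M) -> 0 <= M -> 0 <= lam <= c ->
  List.Forall (fun s => 0 <= s x <= 1) l ->
  `|eprod f l lam x| <= M ^+ size l.
Proof.
move=> fM M0 /andP[l0 lc]; elim: l => [|s l IH] /=; first by rewrite normr1 expr0.
move=> hF; have [/andP[s0 s1] hl] := Forall_consE hF.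
rewrite normrM exprS; apply: ler_pM => //; last exact: IH.
apply: fM; rewrite mulr_ge0//= (le_trans _ lc)//.
by rewrite ler_piMr.
Qed.

Lemma deprod_bound f df l (c M : R) lam x :
  (forall y, 0 <= y <= c -> `|f y| <= M) ->
  (forall y, 0 <= y <= c -> `|df y| <= M) -> 0 <= M -> 0 <= lam <= c ->
  List.Forall (fun s => 0 <= s x <= 1) l ->
  `|deprod f df l lam x| <= (size l)%:R * M ^+ size l.
Proof.
move=> fM dfM M0 hl; have /andP[l0 lc] := hl.
elim: l => [|s l IH] /=; first by rewrite normr0 mul0r.
move=> hF; have [/andP[s0 s1] hl'] := Forall_consE hF.
have hy : 0 <= lam * s x <= c.
  by rewrite mulr_ge0//= (le_trans _ lc)// ler_piMr.
apply: le_trans (ler_normD _ _) _.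
rewrite -natr1 [leRHS]mulrDl mul1r [leRHS]addrC; apply: lerD.
  rewrite normrM exprS ler_pM//; last exact: (eprod_bound fM).
  rewrite normrM ger0_norm// -[leRHS]mul1r ler_pM//; exact: dfM.
rewrite normrM exprS mulrCA ler_pM//; [exact: fM|exact: IH].
Qed.

Lemma eprod_dist f g l (c e : R) lam x :
  (forall y, 0 <= y <= c -> `|f y| <= 1) ->
  (forall y, 0 <= y <= c -> `|g y| <= 1) ->
  (forall y, 0 <= y <= c -> `|f y - g y| <= e) -> 0 <= lam <= c ->
  List.Forall (fun s => 0 <= s x <= 1) l ->
  `|eprod f l lam x - eprod g l lam x| <= (size l)%:R * e.
Proof.
move=> f1 g1 fg hl; have /andP[l0 lc] := hl.
elim: l => [|s l IH] /=; first by rewrite subrr normr0 mul0r.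
move=> hF; have [/andP[s0 s1] hl'] := Forall_consE hF.
have hy : 0 <= lam * s x <= c.
  by rewrite mulr_ge0//= (le_trans _ lc)// ler_piMr.
set a := f _; set b := g _; set p := eprod _ _ _ _; set q := eprod _ _ _ _.
have -> : a * p - b * q = (a - b) * p + b * (p - q) by ring.
apply: le_trans (ler_normD _ _) _.
rewrite -natr1 [leRHS]mulrDl mul1r [leRHS]addrC.
have p1 : `|p| <= 1.
  by have := eprod_bound f1 ler01 hl hl'; rewrite expr1n.
apply: lerD.
  by rewrite normrM -[leRHS]mulr1 ler_pM// fg.
by rewrite normrM -[leRHS]mul1r ler_pM// ?g1// IH.
Qed.

(** Telescoping. When the differentiated factor comes first, at most two others remain: their
    products differ by at most [2 * e] and are multiplied by a slope of size at most 2, whence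
    [e' + 4 * e]. When another factor comes first, its replacement costs [e * 2]. The constant 8
    leaves a margin. *)
Lemma deprod_dist f df g dg l (c e e' : R) lam x :
  (forall y, 0 <= y <= c -> `|f y| <= 1) ->
  (forall y, 0 <= y <= c -> `|g y| <= 1) ->
  (forall y, 0 <= y <= c -> `|df y| <= 1) ->
  (forall y, 0 <= y <= c -> `|dg y| <= 2) ->
  (forall y, 0 <= y <= c -> `|f y - g y| <= e) ->
  (forall y, 0 <= y <= c -> `|df y - dg y| <= e') ->
  0 <= lam <= c -> (size l <= 3)%N ->
  List.Forall (fun s => 0 <= s x <= 1) l ->
  `|deprod f df l lam x - deprod g dg l lam x| <= (size l)%:R * (e' + 8 * e).
Proof.
move=> f1 g1 df1 dg2 fg dfg hl; have /andP[l0 lc] := hl.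
have e0 : 0 <= e by apply: le_trans (fg lam hl).
elim: l => [|s l IH] /=; first by rewrite subrr normr0 mul0r.
move=> sz hF; have [/andP[s0 s1] hl'] := Forall_consE hF.
have hy : 0 <= lam * s x <= c.
  by rewrite mulr_ge0//= (le_trans _ lc)// ler_piMr.
have sz2 : (size l)%:R <= 2 :> R by rewrite ler_nat -ltnS.
have p1 : `|eprod f l lam x| <= 1.
  by have := eprod_bound f1 ler01 hl hl'; rewrite expr1n.
have dp : `|deprod f df l lam x| <= 2.
  by have := deprod_bound f1 df1 ler01 hl hl'; rewrite expr1n mulr1 => /le_trans; apply.
have pq : `|eprod f l lam x - eprod g l lam x| <= 2 * e.
  by apply: le_trans (eprod_dist f1 g1 fg hl hl') _; rewrite ler_wpM2r.
have {}IH := IH (ltnW sz) hl'.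
have := fg _ hy; have := dfg _ hy; have := g1 _ hy; have := dg2 _ hy.
move: p1 dp pq IH.
set F := f _; set G := g _; set F' := df _; set G' := dg _.
set p := eprod _ _ _ _; set q := eprod _ _ _ _.
set p' := deprod _ _ _ _ _; set q' := deprod _ _ _ _ _.
move=> p1 dp pq IH G'2 G1 F'e Fe.
have -> : s x * F' * p + F * p' - (s x * G' * q + G * q') =
  s x * ((F' - G') * p + G' * (p - q)) + (F - G) * p' + G * (p' - q') by ring.
have h1 : `|s x * ((F' - G') * p + G' * (p - q))| <= e' + 2 * (2 * e).
  rewrite normrM ger0_norm// -[leRHS]mul1r ler_pM//.
  apply: le_trans (ler_normD _ _) _; apply: lerD.
    by rewrite normrM -[leRHS]mulr1 ler_pM.
  by rewrite normrM ler_pM.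
have h2 : `|(F - G) * p'| <= e * 2 by rewrite normrM ler_pM.
have h3 : `|G * (p' - q')| <= (size l)%:R * (e' + 8 * e).
  by rewrite normrM -[leRHS]mul1r ler_pM.
apply: le_trans (ler_normD _ _) _.
rewrite -natr1 [leRHS]mulrDl mul1r [leRHS]addrC; apply: lerD => //.
apply: le_trans (ler_normD _ _) _; lra.
Qed.

End EdgeProducts.

Lemma measurable_eprod {d} {T : measurableType d} {R : realType}
    (l : seq (T -> R)) f lam :
  continuous f -> List.Forall (fun s => measurable_fun setT s) l ->
  measurable_fun setT (eprod f l lam).
Proof.
move=> cf; elim: l => [|s l' IH]; first by move=> _; exact: measurable_cst.
move=> hF; have [ms ml'] := Forall_consE hF; rewrite /=.
apply: measurable_funM; last exact: IH.
apply: measurableT_comp; first exact: continuous_measurable_fun.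
by apply: measurable_funM => //; exact: measurable_cst.
Qed.

Lemma measurable_deprod {d} {T : measurableType d} {R : realType}
    (l : seq (T -> R)) f df lam :
  continuous f -> continuous df ->
  List.Forall (fun s => measurable_fun setT s) l ->
  measurable_fun setT (deprod f df l lam).
Proof.
move=> cf cdf; elim: l => [|s l' IH]; first by move=> _; exact: measurable_cst.
move=> hF; have [ms ml'] := Forall_consE hF; rewrite /=.
have mc (g : R -> R) : continuous g -> measurable_fun setT (fun x => g (lam * s x)).
  move=> cg; apply: measurableT_comp; first exact: continuous_measurable_fun.
  by apply: measurable_funM => //; exact: measurable_cst.
apply: measurable_funD; apply: measurable_funM.
- by apply: measurable_funM => //; exact: mc.
- exact: measurable_eprod.
- exact: mc.
- exact: IH.
Qed.

Section EdgeIntegral.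
Context {d} {T : measurableType d} {R : realType}.
Variables (mu : {measure set T -> \bar R}) (D : set T).
Hypothesis mD : measurable D.
Hypothesis muD : mu D = 1%E.
Variables (l : seq (T -> R)) (w : T -> R).
Hypothesis ml : List.Forall (fun s => measurable_fun setT s) l.
Hypothesis lD : unit_edges D l.
Hypothesis mw : measurable_fun setT w.
Hypothesis w1 : forall x, D x -> `|w x| <= 1.

Definition eint f lam := \int[mu]_(x in D) (eprod f l lam x * w x).
Definition deint f df lam := \int[mu]_(x in D) (deprod f df l lam x * w x).

Variables (f df : R -> R) (c M : R).
Hypothesis fdf : forall y : R, is_derive y 1 f (df y).
Hypothesis cdf : continuous df.
Hypothesis fM : forall y, 0 <= y <= c -> `|f y| <= M.
Hypothesis dfM : forall y, 0 <= y <= c -> `|df y| <= M.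

Let cf : continuous f.
Proof.
move=> y; apply: differentiable_continuous; apply/derivable1_diffP.
by have [] := fdf y.
Qed.

Lemma bm_eprod lam : 0 <= lam <= c -> bm D (fun x => eprod f l lam x * w x).
Proof.
move=> hl; have M0 : 0 <= M by apply: le_trans (fM hl).
split; first by apply: measurable_funM => //; exact: measurable_eprod.
exists (M ^+ size l * 1) => x Dx; rewrite normrM ler_pM ?w1//.
exact: (eprod_bound fM M0 hl (lD Dx)).
Qed.

Lemma bm_deprod lam : 0 <= lam <= c -> bm D (fun x => deprod f df l lam x * w x).
Proof.
move=> hl; have M0 : 0 <= M by apply: le_trans (fM hl).
split; first by apply: measurable_funM => //; exact: measurable_deprod.
exists ((size l)%:R * M ^+ size l * 1) => x Dx; rewrite normrM ler_pM ?w1//.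
exact: (deprod_bound fM dfM M0 hl (lD Dx)).
Qed.

(** The bound of [deprod_bound] does not depend on the parameter in the interval from 0 to [c], so a
    constant dominates the differentiated integrand. *)
Lemma is_derive_eint lam : 0 < lam < c -> is_derive lam 1 (eint f) (deint f df lam).
Proof.
move=> hl.
have M0 : 0 <= M.
  have [l0 lc] := andP hl.
  by apply: le_trans (fM (y := lam) _); rewrite // (ltW l0) (ltW lc).
have Ilam : `]0, c[%classic lam by rewrite /= in_itv.
pose F t x := eprod f l t x * w x.
have dF (t : R) x : is_derive t 1 (F^~ x) (deprod f df l t x * w x).
  have h := is_derive_eprod l t x fdf.
  have := @is_deriveM _ _ _ (cst (w x)) t 1 _ _ h (is_derive_cst _ _ _).
  by rewrite /= scaler0 add0r /GRing.scale /= [w x * _]mulrC.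
have dFE (t : R) x : partial1of2 F t x = deprod f df l t x * w x.
  by rewrite partial1of2E; exact: derive_val.
pose G (x : T) : R := (size l)%:R * M ^+ size l * 1.
have intF (t : R) : `]0, c[%classic t -> mu.-integrable D (EFin \o F t).
  rewrite /= in_itv /= => /andP[t0 tc]; apply: (bm_integrable mD muD).
  by apply: bm_eprod; rewrite (ltW t0) (ltW tc).
have derF (t : R) x : `]0, c[%classic t -> D x -> derivable (F^~ x) t 1.
  by move=> _ _; have [] := dF t x.
have G0 x : 0 <= G x by rewrite /G mulr1 mulr_ge0// exprn_ge0.
have intG : mu.-integrable D (EFin \o G).
  by apply: (bm_integrable mD muD); exact: bm_cst.
have GF (t : R) x : `]0, c[%classic t -> D x -> `|partial1of2 F t x| <= G x.
  rewrite /= in_itv /= => /andP[t0 tc] Dx; rewrite dFE /G normrM ler_pM ?w1//.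
  by apply: (deprod_bound fM dfM M0 _ (lD Dx)); rewrite (ltW t0) (ltW tc).
split.
  exact: (derivable_under_integral mD Ilam intF derF G0 intG GF).
rewrite -derive1E (differentiation_under_integral mD Ilam intF derF G0 intG GF).
by apply: eq_Rintegral => x _; exact: dFE.
Qed.

End EdgeIntegral.

Section EdgeIntegralDist.
Context {d} {T : measurableType d} {R : realType}.
Variables (mu : {measure set T -> \bar R}) (D : set T).
Hypothesis mD : measurable D.
Hypothesis muD : mu D = 1%E.
Variables (l : seq (T -> R)) (w : T -> R).
Hypothesis ml : List.Forall (fun s => measurable_fun setT s) l.
Hypothesis lD : unit_edges D l.
Hypothesis mw : measurable_fun setT w.
Hypothesis w1 : forall x, D x -> `|w x| <= 1.
Hypothesis sl : (size l <= 3)%N.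
Variables (f df g dg : R -> R) (c e e' : R).
Hypothesis fdf : forall y : R, is_derive y 1 f (df y).
Hypothesis gdg : forall y : R, is_derive y 1 g (dg y).
Hypothesis cdf : continuous df.
Hypothesis cdg : continuous dg.
Hypothesis f1 : forall y, 0 <= y <= c -> `|f y| <= 1.
Hypothesis g1 : forall y, 0 <= y <= c -> `|g y| <= 1.
Hypothesis df1 : forall y, 0 <= y <= c -> `|df y| <= 1.
Hypothesis dg2 : forall y, 0 <= y <= c -> `|dg y| <= 2.
Hypothesis fg : forall y, 0 <= y <= c -> `|f y - g y| <= e.
Hypothesis dfg : forall y, 0 <= y <= c -> `|df y - dg y| <= e'.

Let le2 (h : R -> R) (y : R) : `|h y| <= 1 -> `|h y| <= 2.
Proof. by move=> /le_trans; apply; rewrite ler1n. Qed.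

Lemma eint_dist lam : 0 <= lam <= c ->
  `|eint mu D l w f lam - eint mu D l w g lam| <= (size l)%:R * e.
Proof.
move=> hl.
have bf := bm_eprod ml lD mw w1 fdf f1 hl.
have bg := bm_eprod ml lD mw w1 gdg g1 hl.
rewrite /eint -(bm_intB mD muD bf bg).
apply: (bm_int_norm mD muD (bmB bf bg)) => x Dx.
rewrite -mulrBl normrM -[leRHS]mulr1 ler_pM ?w1//.
exact: (eprod_dist f1 g1 fg hl (lD Dx)).
Qed.

Lemma deint_dist lam : 0 <= lam <= c ->
  `|deint mu D l w f df lam - deint mu D l w g dg lam|
    <= (size l)%:R * (e' + 8 * e).
Proof.
move=> hl.
have bf := bm_deprod ml lD mw w1 fdf cdf f1 df1 hl.
have bg := bm_deprod ml lD mw w1 gdg cdg (fun y h => le2 (g1 h)) dg2 hl.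
rewrite /deint -(bm_intB mD muD bf bg).
apply: (bm_int_norm mD muD (bmB bf bg)) => x Dx.
rewrite -mulrBl normrM -[leRHS]mulr1 ler_pM ?w1//.
exact: (deprod_dist f1 g1 df1 dg2 fg dfg hl sl (lD Dx)).
Qed.

End EdgeIntegralDist.

Lemma bm_sum {d} {T : measurableType d} {R : realType} (D : set T)
    (I : Type) (r : seq I) (F : I -> T -> R) :
  (forall i, bm D (F i)) -> bm D (fun x => \sum_(i <- r) F i x).
Proof.
move=> bF; elim: r => [|i r IH].
  under eq_fun do rewrite big_nil; exact: bm_cst.
under eq_fun do rewrite big_cons; exact: bmD.
Qed.

Lemma bm_horner {d} {T : measurableType d} {R : realType} (D : set T)
    (c : {poly R}) (f : T -> R) : bm D f -> bm D (fun x => c.[f x]).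
Proof.
move=> bf; elim/poly_ind: c => [|p c IH].
  under eq_fun do rewrite horner0; exact: bm_cst.
under eq_fun do rewrite hornerMXaddC.
by apply: bmD; [exact: bmM | exact: bm_cst].
Qed.

Lemma bmX {d} {T : measurableType d} {R : realType} (D : set T)
    (f : T -> R) n : bm D f -> bm D (fun x => f x ^+ n).
Proof. by move=> bf; have := bm_horner 'X^n bf; under eq_fun do rewrite hornerXn. Qed.

Lemma bm_fst {d1 d2} {T1 : measurableType d1} {T2 : measurableType d2}
    {R : realType} (A : set T1) (B : set T2) (f : T1 -> R) :
  bm A f -> bm (A `*` B) (fun x => f x.1).
Proof.
move=> [mf [M fM]]; split; first exact: (measurableT_comp mf measurable_fst).
by exists M => x [Ax Bx]; exact: fM.
Qed.

Lemma bm_snd {d1 d2} {T1 : measurableType d1} {T2 : measurableType d2}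
    {R : realType} (A : set T1) (B : set T2) (f : T2 -> R) :
  bm B f -> bm (A `*` B) (fun x => f x.2).
Proof.
move=> [mf [M fM]]; split; first exact: (measurableT_comp mf measurable_snd).
by exists M => x [Ax Bx]; exact: fM.
Qed.

(** * Polynomial integrals over the unit interval *)

Section UnitInterval.
Context {R : realType}.
Local Notation mu := (@lebesgue_measure R).
Local Notation I := (`[0%R, 1%R]%classic : set R).
Implicit Types (c p : {poly R}) (x u : R) (g : bool).

Lemma unit_itv_measure : mu I = 1%E.
Proof. by rewrite lebesgue_measure_itv/= lte_fin ltr01 oppr0 adde0. Qed.

Lemma measurable_unit_itv : measurable I.
Proof. exact: measurable_itv. Qed.

Lemma bm_id : bm I (fun u => u).
Proof.
split; first exact: measurable_id.
by exists 1 => u; rewrite /= in_itv/= => /andP[u0 u1]; rewrite ger0_norm.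
Qed.

Lemma int_horner_derive c : \int[mu]_(u in I) c^`().[u] = c.[1] - c.[0].
Proof.
rewrite /Rintegral (@continuous_FTC2 _ (horner c^`()) (horner c)) ?ltr01//.
- by apply: continuous_subspaceT; exact: continuous_horner.
- split.
  + by move=> x _; exact: derivable_horner.
  + by apply: cvg_at_right_filter; exact: continuous_horner.
  + by apply: cvg_at_left_filter; exact: continuous_horner.
- by move=> x _; rewrite derivE.
Qed.

Lemma Iint_D (f h : R -> R) : bm I f -> bm I h ->
  \int[mu]_(u in I) (f u + h u) = \int[mu]_(u in I) f u + \int[mu]_(u in I) h u.
Proof. exact: (bm_intD (mu := mu) measurable_unit_itv unit_itv_measure). Qed.

Lemma Iint_B (f h : R -> R) : bm I f -> bm I h ->
  \int[mu]_(u in I) (f u - h u) = \int[mu]_(u in I) f u - \int[mu]_(u in I) h u.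
Proof. exact: (bm_intB (mu := mu) measurable_unit_itv unit_itv_measure). Qed.

Lemma Iint_Zl a (f : R -> R) : bm I f ->
  \int[mu]_(u in I) (a * f u) = a * \int[mu]_(u in I) f u.
Proof. exact: (bm_intZl (mu := mu) measurable_unit_itv unit_itv_measure). Qed.

Lemma int_exprn n : \int[mu]_(u in I) u ^+ n = n.+1%:R^-1.
Proof.
have := int_horner_derive (n.+1%:R^-1 *: 'X^(n.+1)).
rewrite !hornerE expr1n expr0n/= mulr1 mulr0 subr0 => <-.
apply: eq_Rintegral => u _.
rewrite derivZ derivXn hornerZ hornerMn hornerXn /=.
by rewrite -[(_ ^+ _) *+ _]mulr_natl mulrA mulVf ?mul1r// pnatr_eq0.
Qed.

(** [harm1] is [sqrt 3] times [yv true]. The flag tells whether a label carries this factor in a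
    monomial of [omega]; [wt g n] is the moment of order [n] of [yv g]. *)
Definition yv g u : R := if g then 2 * u - 1 else 1.
Definition wt g (n : nat) : R :=
  if g then n%:R / (n.+1%:R * n.+2%:R) else n.+1%:R^-1.

Lemma bm_yv g : bm I (yv g).
Proof.
case: g; last exact: bm_cst.
by apply: bmB; [apply: bmM; [exact: bm_cst|exact: bm_id]|exact: bm_cst].
Qed.

Lemma int_yv_exprn g n : \int[mu]_(u in I) (yv g u * u ^+ n) = wt g n.
Proof.
case: g => /=; last by under eq_Rintegral do rewrite mul1r; exact: int_exprn.
have bX m : bm I (fun u : R => u ^+ m) by apply: bmX; exact: bm_id.
transitivity (\int[mu]_(u in I) (2 * u ^+ n.+1 - u ^+ n)).
  by apply: eq_Rintegral => u _; rewrite exprS; ring.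
rewrite (Iint_B _ (bX n)); last first.
  by apply: bmM => //; exact: bm_cst.
rewrite Iint_Zl ?int_exprn//.
rewrite -!natr1; have n0 := ler0n R n; field.
by apply/andP; split; apply: lt0r_neq0; lra.
Qed.

Lemma bm_int_sum (J : Type) (r : seq J) (F : J -> R -> R) :
  (forall i, bm I (F i)) ->
  \int[mu]_(u in I) (\sum_(i <- r) F i u) = \sum_(i <- r) \int[mu]_(u in I) F i u.
Proof.
move=> bF; elim: r => [|i r IH].
  under eq_Rintegral do rewrite big_nil.
  by rewrite Rintegral_cst ?mul0r ?big_nil.
under eq_Rintegral do rewrite big_cons.
rewrite Iint_D ?IH ?big_cons//.
exact: bm_sum.
Qed.

(** The operator that integrates out one label [u]: the polynomial in [x] equal to the integral of
    [yv g u * u ^+ i * c.[x * u]]. Its iteration removes the labels of a motif one by one. *)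
Definition wpoly g (i : nat) c : {poly R} :=
  \poly_(k < size c) (c`_k * wt g (i + k)).

Lemma int_wpoly g i c x :
  \int[mu]_(u in I) (yv g u * u ^+ i * c.[x * u]) = (wpoly g i c).[x].
Proof.
rewrite /wpoly horner_poly.
have bX n : bm I (fun u : R => u ^+ n) by apply: bmX; exact: bm_id.
transitivity (\int[mu]_(u in I) (\sum_(k < size c)
    (c`_k * x ^+ k) * (yv g u * u ^+ (i + k)))).
  apply: eq_Rintegral => u _; rewrite horner_coef mulr_sumr.
  by apply: eq_bigr => k _; rewrite exprMn exprD; ring.
rewrite bm_int_sum; last first.
  by move=> k; apply: bmM; [exact: bm_cst | apply: bmM => //; exact: bm_yv].
apply: eq_bigr => k _.
rewrite Iint_Zl.
  by rewrite int_yv_exprn mulrAC.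
by apply: bmM => //; exact: bm_yv.
Qed.

Lemma int_wpoly0 g c x :
  \int[mu]_(u in I) (yv g u * c.[x * u]) = (wpoly g 0 c).[x].
Proof. by rewrite -int_wpoly; apply: eq_Rintegral => u _; rewrite expr0 mulr1. Qed.

End UnitInterval.

Lemma bm_yvf {d} {T : measurableType d} {R : realType} (D : set T) g (f : T -> R) :
  bm D f -> bm D (fun x => yv g (f x)).
Proof.
move=> bf; case: g; last exact: bm_cst.
by apply: bmB; [apply: bmM => //; exact: bm_cst|exact: bm_cst].
Qed.

(** * Iterated product measures *)

Section ProductSigmaFinite.
Context {d1 d2} {T1 : measurableType d1} {T2 : measurableType d2} {R : realType}.
Variables (m1 : {sigma_finite_measure set T1 -> \bar R})
  (m2 : {sigma_finite_measure set T2 -> \bar R}).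

Lemma product_sigma_finite : sigma_finite setT (m1 \x m2)%E.
Proof.
have /sigma_finiteP[F [TF ndF Foo]] := sigma_finiteT m1.
have /sigma_finiteP[G [TG ndG Goo]] := sigma_finiteT m2.
exists (fun n => F n `*` G n).
  rewrite -setXTT TF TG predeqE => -[x y]; split.
    move=> [/= [n _ Fnx] [k _ Gky]]; exists (maxn n k) => //; split.
      by move: x Fnx; exact/subsetPset/ndF/leq_maxl.
    by move: y Gky; exact/subsetPset/ndG/leq_maxr.
  by move=> [n _ []/= ? ?]; split; exists n.
move=> k; have [? ?] := Foo k; have [? ?] := Goo k.
split; first exact: measurableX.
by rewrite product_measure1E// lte_mul_pinfty// ge0_fin_numE.
Qed.

(** Convertible with [m1 \x m2] as a measure, so that Fubini applies with an iterated product as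
    first factor and the integrals keep their original form. *)
Definition product_sfm : {sigma_finite_measure set (T1 * T2)%type -> \bar R} :=
  HB.pack (m1 \x m2)%E
    (Measure_isSigmaFinite.Build _ _ _ (m1 \x m2)%E product_sigma_finite).

End ProductSigmaFinite.

Section IteratedProduct.
Context {d1 d2 d3 d4} {T1 : measurableType d1} {T2 : measurableType d2}
  {T3 : measurableType d3} {T4 : measurableType d4} {R : realType}.
Variables (m1 : {sigma_finite_measure set T1 -> \bar R})
  (m2 : {sigma_finite_measure set T2 -> \bar R})
  (m3 : {sigma_finite_measure set T3 -> \bar R})
  (m4 : {sigma_finite_measure set T4 -> \bar R}).
Variables (A1 : set T1) (A2 : set T2) (A3 : set T3) (A4 : set T4).
Hypotheses (mA1 : measurable A1) (mA2 : measurable A2) (mA3 : measurable A3)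
  (mA4 : measurable A4).
Hypotheses (m1A1 : m1 A1 = 1%E) (m2A2 : m2 A2 = 1%E) (m3A3 : m3 A3 = 1%E)
  (m4A4 : m4 A4 = 1%E).

Lemma product2_measure : (m1 \x m2)%E (A1 `*` A2) = 1%E.
Proof.
rewrite product_measure1E//; transitivity (m1 A1 * m2 A2)%E => //.
by rewrite m1A1 m2A2 mule1.
Qed.

Lemma product3_measure : ((m1 \x m2) \x m3)%E (A1 `*` A2 `*` A3) = 1%E.
Proof.
rewrite product_measure1E//; last exact: measurableX.
transitivity ((m1 \x m2) (A1 `*` A2) * m3 A3)%E => //.
by rewrite product2_measure m3A3 mule1.
Qed.

Lemma bm_Fubini3 f : bm (A1 `*` A2 `*` A3) f ->
  \int[((m1 \x m2) \x m3)%E]_(z in A1 `*` A2 `*` A3) f z =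
  \int[(m1 \x m2)%E]_(z in A1 `*` A2) \int[m3]_(v in A3) f (z, v).
Proof.
exact: (@bm_Fubini _ _ _ _ _ (product_sfm m1 m2) m3 _ _ f
  (measurableX mA1 mA2) mA3 product2_measure m3A3).
Qed.

Lemma bm_Fubini4 f : bm (A1 `*` A2 `*` A3 `*` A4) f ->
  \int[(((m1 \x m2) \x m3) \x m4)%E]_(z in A1 `*` A2 `*` A3 `*` A4) f z =
  \int[((m1 \x m2) \x m3)%E]_(z in A1 `*` A2 `*` A3) \int[m4]_(v in A4) f (z, v).
Proof.
exact: (@bm_Fubini _ _ _ _ _ (product_sfm (product_sfm m1 m2) m3) m4 _ _ f
  (measurableX (measurableX mA1 mA2) mA3) mA4 product3_measure m4A4).
Qed.

End IteratedProduct.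

(** * Motif integrals of a polynomial edge function *)

Section CubeIntegrals.
Context {R : realType}.
Local Notation mu := (@lebesgue_measure R).
Local Notation mu2 := (mu \x mu)%E.
Local Notation mu3 := (mu2 \x mu)%E.
Local Notation mu4 := (mu3 \x mu)%E.
Local Notation I := (`[0%R, 1%R]%classic : set R).
Implicit Types (p : {poly R}) (x : R).

Let mI := @measurable_unit_itv R.
Let muI := @unit_itv_measure R.

Lemma measurable_square : measurable (I `*` I).
Proof. exact: measurableX. Qed.

Lemma measurable_cube : measurable (I `*` I `*` I).
Proof. by apply: measurableX => //; exact: measurable_square. Qed.

Lemma measurable_tesseract : measurable (I `*` I `*` I `*` I).
Proof. by apply: measurableX => //; exact: measurable_cube. Qed.

Lemma square_measure : mu2 (I `*` I) = 1%E.
Proof.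
rewrite product_measure1E//; transitivity (mu I * mu I)%E => //.
by rewrite muI mule1.
Qed.

Lemma cube_measure : mu3 (I `*` I `*` I) = 1%E.
Proof.
rewrite product_measure1E//; last exact: measurable_square.
transitivity (mu2 (I `*` I) * mu I)%E => //.
by rewrite square_measure muI mule1.
Qed.

Lemma tesseract_measure : mu4 (I `*` I `*` I `*` I) = 1%E.
Proof.
rewrite product_measure1E//; last exact: measurable_cube.
transitivity (mu3 (I `*` I `*` I) * mu I)%E => //.
by rewrite cube_measure muI mule1.
Qed.

Lemma square_Fubini (f : R * R -> R) : bm (I `*` I) f ->
  \int[mu2]_(z in I `*` I) f z = \int[mu]_(u in I) \int[mu]_(v in I) f (u, v).
Proof. exact: (bm_Fubini (m1 := mu) (m2 := mu) mI mI muI muI). Qed.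

Lemma cube_Fubini (f : R * R * R -> R) : bm (I `*` I `*` I) f ->
  \int[mu3]_(z in I `*` I `*` I) f z =
  \int[mu2]_(z in I `*` I) \int[mu]_(v in I) f (z, v).
Proof. exact: (bm_Fubini3 (m1 := mu) (m2 := mu) (m3 := mu) mI mI mI muI muI muI). Qed.

Lemma tesseract_Fubini (f : R * R * R * R -> R) : bm (I `*` I `*` I `*` I) f ->
  \int[mu4]_(z in I `*` I `*` I `*` I) f z =
  \int[mu3]_(z in I `*` I `*` I) \int[mu]_(v in I) f (z, v).
Proof. exact: (bm_Fubini4 (m1 := mu) (m2 := mu) (m3 := mu) (m4 := mu) mI mI mI mI muI muI muI muI). Qed.

Lemma bm_sq1 : bm (I `*` I) (fun z => z.1).
Proof. exact: bm_fst bm_id. Qed.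
Lemma bm_sq2 : bm (I `*` I) (fun z => z.2).
Proof. exact: bm_snd bm_id. Qed.
Lemma bm_cu1 : bm (I `*` I `*` I) (fun z => z.1.1).
Proof. exact: bm_fst bm_sq1. Qed.
Lemma bm_cu2 : bm (I `*` I `*` I) (fun z => z.1.2).
Proof. exact: bm_fst bm_sq2. Qed.
Lemma bm_cu3 : bm (I `*` I `*` I) (fun z => z.2).
Proof. exact: bm_snd bm_id. Qed.
Lemma bm_te1 : bm (I `*` I `*` I `*` I) (fun z => z.1.1.1).
Proof. exact: bm_fst bm_cu1. Qed.
Lemma bm_te2 : bm (I `*` I `*` I `*` I) (fun z => z.1.1.2).
Proof. exact: bm_fst bm_cu2. Qed.
Lemma bm_te3 : bm (I `*` I `*` I `*` I) (fun z => z.1.2).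
Proof. exact: bm_fst bm_cu3. Qed.
Lemma bm_te4 : bm (I `*` I `*` I `*` I) (fun z => z.2).
Proof. exact: bm_snd bm_id. Qed.

Ltac bm_tac := repeat first
  [ exact: bm_id | exact: bm_sq1 | exact: bm_sq2 | exact: bm_cu1 | exact: bm_cu2
  | exact: bm_cu3 | exact: bm_te1 | exact: bm_te2 | exact: bm_te3 | exact: bm_te4
  | exact: bm_cst | apply: bm_yvf | apply: bm_horner | apply: bmX | apply: bmM
  | apply: bmD ].

Lemma int_edge p g1 g2 x :
  \int[mu2]_(z in I `*` I) (p.[x * (z.1 * z.2)] * (yv g1 z.1 * yv g2 z.2)) =
  (wpoly g1 0 (wpoly g2 0 p)).[x].
Proof.
rewrite square_Fubini; last by bm_tac.
rewrite -int_wpoly0; apply: eq_Rintegral => u _.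
rewrite -int_wpoly0 -Iint_Zl; last by bm_tac.
by apply: eq_Rintegral => v _ /=; rewrite mulrA; ring.
Qed.

(** In a tree the leaves are integrated out first: for a fixed centre [u], a leaf contributes
    [wpoly _ 0 p] evaluated at [x * u]. The centre comes last. The star is treated in the same
    way. *)
Lemma int_wedge p g1 g2 g3 x :
  \int[mu3]_(z in I `*` I `*` I)
    (p.[x * (z.1.1 * z.1.2)] * p.[x * (z.1.1 * z.2)] *
     (yv g1 z.1.1 * yv g2 z.1.2 * yv g3 z.2)) =
  (wpoly g1 0 (wpoly g2 0 p * wpoly g3 0 p)).[x].
Proof.
rewrite cube_Fubini; last by bm_tac.
transitivity (\int[mu2]_(z in I `*` I)
    (p.[x * (z.1 * z.2)] * (yv g1 z.1 * yv g2 z.2) * (wpoly g3 0 p).[x * z.1])).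
  apply: eq_Rintegral => z _.
  rewrite -int_wpoly0 -Iint_Zl; last by bm_tac.
  by apply: eq_Rintegral => v _ /=; rewrite (mulrA x z.1 v); ring.
rewrite square_Fubini; last by bm_tac.
rewrite -int_wpoly0; apply: eq_Rintegral => u _.
rewrite hornerM -[X in _ * (X * _)]int_wpoly0 mulrA mulrAC -Iint_Zl; last by bm_tac.
by apply: eq_Rintegral => v _ /=; rewrite (mulrA x u v); ring.
Qed.

Lemma int_star p g1 g2 g3 g4 x :
  \int[mu4]_(z in I `*` I `*` I `*` I)
    (p.[x * (z.1.1.1 * z.1.1.2)] * p.[x * (z.1.1.1 * z.1.2)] *
     p.[x * (z.1.1.1 * z.2)] *
     (yv g1 z.1.1.1 * yv g2 z.1.1.2 * yv g3 z.1.2 * yv g4 z.2)) =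
  (wpoly g1 0 (wpoly g2 0 p * wpoly g3 0 p * wpoly g4 0 p)).[x].
Proof.
rewrite tesseract_Fubini; last by bm_tac.
transitivity (\int[mu3]_(z in I `*` I `*` I)
    (p.[x * (z.1.1 * z.1.2)] * p.[x * (z.1.1 * z.2)] *
     (yv g1 z.1.1 * yv g2 z.1.2 * yv g3 z.2) * (wpoly g4 0 p).[x * z.1.1])).
  apply: eq_Rintegral => z _.
  rewrite -int_wpoly0 -Iint_Zl; last by bm_tac.
  by apply: eq_Rintegral => v _ /=; rewrite (mulrA x z.1.1 v); ring.
rewrite cube_Fubini; last by bm_tac.
transitivity (\int[mu2]_(z in I `*` I)
    (p.[x * (z.1 * z.2)] * (yv g1 z.1 * yv g2 z.2) * (wpoly g3 0 p).[x * z.1]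
      * (wpoly g4 0 p).[x * z.1])).
  apply: eq_Rintegral => z _.
  rewrite -[X in _ * X * _]int_wpoly0 mulrAC -Iint_Zl; last by bm_tac.
  by apply: eq_Rintegral => v _ /=; rewrite (mulrA x z.1 v); ring.
rewrite square_Fubini; last by bm_tac.
rewrite -int_wpoly0; apply: eq_Rintegral => u _.
rewrite !hornerM -[X in _ * (X * _ * _)]int_wpoly0.
transitivity (yv g1 u * (wpoly g3 0 p).[x * u] * (wpoly g4 0 p).[x * u] *
  \int[mu]_(v in I) (yv g2 v * p.[x * u * v])); last by ring.
rewrite -Iint_Zl; last by bm_tac.
by apply: eq_Rintegral => v _ /=; rewrite (mulrA x u v); ring.
Qed.

(** Once the two leaves are integrated out, the middle edge still couples the inner labels [u] and
    [v]. Expanding it in monomials [(x u v)^i] separates them, at the price of one sum over [i]. *)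
Lemma int_path p g1 g2 g3 g4 x :
  \int[mu4]_(z in I `*` I `*` I `*` I)
    (p.[x * (z.1.1.1 * z.1.1.2)] * p.[x * (z.1.1.1 * z.1.2)] *
     p.[x * (z.1.1.2 * z.2)] *
     (yv g1 z.1.1.1 * yv g2 z.1.1.2 * yv g3 z.1.2 * yv g4 z.2)) =
  \sum_(i < size p) p`_i * x ^+ i *
    ((wpoly g1 i (wpoly g3 0 p)).[x] * (wpoly g2 i (wpoly g4 0 p)).[x]).
Proof.
rewrite tesseract_Fubini; last by bm_tac.
transitivity (\int[mu3]_(z in I `*` I `*` I)
    (p.[x * (z.1.1 * z.1.2)] * p.[x * (z.1.1 * z.2)] *
     (yv g1 z.1.1 * yv g2 z.1.2 * yv g3 z.2) * (wpoly g4 0 p).[x * z.1.2])).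
  apply: eq_Rintegral => z _.
  rewrite -int_wpoly0 -Iint_Zl; last by bm_tac.
  by apply: eq_Rintegral => v _ /=; rewrite (mulrA x z.1.2 v); ring.
rewrite cube_Fubini; last by bm_tac.
transitivity (\int[mu2]_(z in I `*` I)
    (p.[x * (z.1 * z.2)] * (yv g1 z.1 * yv g2 z.2) * (wpoly g3 0 p).[x * z.1]
      * (wpoly g4 0 p).[x * z.2])).
  apply: eq_Rintegral => z _.
  rewrite -[X in _ * X * _]int_wpoly0 mulrAC -Iint_Zl; last by bm_tac.
  by apply: eq_Rintegral => v _ /=; rewrite (mulrA x z.1 v); ring.
rewrite square_Fubini; last by bm_tac.
transitivity (\int[mu]_(u in I) \sum_(i < size p) p`_i * x ^+ i *
    (wpoly g2 i (wpoly g4 0 p)).[x] * (yv g1 u * u ^+ i * (wpoly g3 0 p).[x * u])).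
  apply: eq_Rintegral => u _.
  transitivity (\int[mu]_(v in I) \sum_(i < size p) p`_i * x ^+ i * u ^+ i * yv g1 u
      * (wpoly g3 0 p).[x * u] * (yv g2 v * v ^+ i * (wpoly g4 0 p).[x * v])).
    apply: eq_Rintegral => v _ /=.
    rewrite [p.[_]]horner_coef !mulr_suml; apply: eq_bigr => i _.
    by rewrite !exprMn; ring.
  rewrite bm_int_sum; last by move=> i; bm_tac.
  apply: eq_bigr => i _; rewrite Iint_Zl; last by bm_tac.
  by rewrite int_wpoly; ring.
rewrite bm_int_sum; last by move=> i; bm_tac.
apply: eq_bigr => i _; rewrite Iint_Zl; last by bm_tac.
by rewrite int_wpoly; ring.
Qed.

(** There is no leaf to remove, so all three edges are expanded in monomials and the integral
    factors into three moments. *)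
Lemma int_triangle p g1 g2 g3 x :
  \int[mu3]_(z in I `*` I `*` I)
    (p.[x * (z.1.1 * z.1.2)] * p.[x * (z.1.1 * z.2)] * p.[x * (z.1.2 * z.2)] *
     (yv g1 z.1.1 * yv g2 z.1.2 * yv g3 z.2)) =
  \sum_(i < size p) \sum_(j < size p) \sum_(k < size p)
    (p`_i * x ^+ i) * (p`_j * x ^+ j) * (p`_k * x ^+ k) *
    (wt g1 (i + j) * wt g2 (i + k) * wt g3 (j + k)).
Proof.
rewrite cube_Fubini; last by bm_tac.
transitivity (\int[mu2]_(z in I `*` I)
    (\sum_(i < size p) \sum_(j < size p) \sum_(k < size p)
    (p`_i * x ^+ i) * (p`_j * x ^+ j) * (p`_k * x ^+ k) * wt g3 (j + k) *
    (yv g1 z.1 * z.1 ^+ (i + j)) * (yv g2 z.2 * z.2 ^+ (i + k)))).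
  apply: eq_Rintegral => z _.
  transitivity (\int[mu]_(v in I) (\sum_(i < size p) \sum_(j < size p) \sum_(k < size p)
    (p`_i * x ^+ i) * (p`_j * x ^+ j) * (p`_k * x ^+ k) *
    (yv g1 z.1 * z.1 ^+ (i + j)) * (yv g2 z.2 * z.2 ^+ (i + k)) *
    (yv g3 v * v ^+ (j + k)))).
    apply: eq_Rintegral => v _ /=.
    rewrite !horner_coef !mulr_suml; apply: eq_bigr => i _.
    rewrite [X in X * _ * _]mulr_sumr !mulr_suml; apply: eq_bigr => j _.
    rewrite mulr_sumr !mulr_suml; apply: eq_bigr => k _.
    by rewrite !exprMn !exprD; ring.
  rewrite bm_int_sum; last by move=> i; apply: bm_sum => j; apply: bm_sum => k; bm_tac.
  apply: eq_bigr => i _.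
  rewrite bm_int_sum; last by move=> j; apply: bm_sum => k; bm_tac.
  apply: eq_bigr => j _.
  rewrite bm_int_sum; last by move=> k; bm_tac.
  apply: eq_bigr => k _.
  rewrite Iint_Zl; last by bm_tac.
  by rewrite int_yv_exprn; ring.
rewrite square_Fubini; last first.
  by apply: bm_sum => i; apply: bm_sum => j; apply: bm_sum => k; bm_tac.
transitivity (\int[mu]_(u in I) (\sum_(i < size p) \sum_(j < size p) \sum_(k < size p)
    (p`_i * x ^+ i) * (p`_j * x ^+ j) * (p`_k * x ^+ k) * wt g3 (j + k) *
    wt g2 (i + k) * (yv g1 u * u ^+ (i + j)))).
  apply: eq_Rintegral => u _.
  rewrite bm_int_sum; last by move=> i; apply: bm_sum => j; apply: bm_sum => k; bm_tac.
  apply: eq_bigr => i _.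
  rewrite bm_int_sum; last by move=> j; apply: bm_sum => k; bm_tac.
  apply: eq_bigr => j _.
  rewrite bm_int_sum; last by move=> k; bm_tac.
  apply: eq_bigr => k _.
  rewrite /= Iint_Zl; last by bm_tac.
  by rewrite int_yv_exprn; ring.
rewrite bm_int_sum; last by move=> i; apply: bm_sum => j; apply: bm_sum => k; bm_tac.
apply: eq_bigr => i _.
rewrite bm_int_sum; last by move=> j; apply: bm_sum => k; bm_tac.
apply: eq_bigr => j _.
rewrite bm_int_sum; last by move=> k; bm_tac.
apply: eq_bigr => k _.
rewrite Iint_Zl; last by bm_tac.
by rewrite int_yv_exprn; ring.
Qed.

End CubeIntegrals.

(** * Approximation of the edge function *)

Section EdgeFunction.
Context {R : realType}.
Implicit Types (x y : R).

Definition expc x : R := 1 - expR (- x).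
Definition dexpc x : R := expR (- x).

Lemma is_derive_expc x : is_derive x 1 expc (dexpc x).
Proof.
have h : is_derive x 1 (fun y : R => expR (- y)) (- expR (- x)).
  have h1 := is_deriveNid x (1:R).
  have := @is_derive1_comp _ expR (fun y : R => - y) x _ _ (is_derive_expR _) h1.
  by rewrite mulrN1.
have := @is_deriveB _ _ _ (cst (1 : R)) (fun y : R => expR (- y)) x 1 _ _ (is_derive_cst _ _ _) h.
by rewrite sub0r opprK.
Qed.

Lemma continuous_dexpc : continuous dexpc.
Proof.
move=> x; rewrite /dexpc; apply: continuous_comp; first exact: continuousN.
exact: continuous_expR.
Qed.

Lemma expc_bound c x : 0 <= x <= c -> `|expc x| <= 1.
Proof.
move=> /andP[x0 _]; rewrite /expc ger0_norm; last first.
  by rewrite subr_ge0 -expR0 ler_expR oppr_le0.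
by rewrite gerBl expR_ge0.
Qed.

Lemma dexpc_bound c x : 0 <= x <= c -> `|dexpc x| <= 1.
Proof.
by move=> /andP[x0 _]; rewrite /dexpc ger0_norm ?expR_ge0// -expR0 ler_expR oppr_le0.
Qed.

Lemma poly_bounded (c : {poly R}) (b : R) :
  exists M, forall x, 0 <= x <= b -> `|c.[x]| <= M.
Proof.
elim/poly_ind: c => [|c a [M IH]].
  by exists 0 => x _; rewrite horner0 normr0.
exists (M * `|b| + `|a|) => x /[dup] xb /andP[x0 xb'].
rewrite hornerMXaddC; apply: le_trans (ler_normD _ _) _; apply: lerD => //.
rewrite normrM; apply: ler_pM => //; first exact: IH.
by rewrite ger0_norm// (le_trans xb')// ler_norm.
Qed.

Lemma is_derive_scaled (c : {poly R}) x :
  is_derive x 1 (fun y => c.[y / 5]) (c^`().[x / 5] / 5).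
Proof.
have h1 : is_derive x 1 (fun y : R => y / 5) (5^-1).
  have := @is_deriveM _ _ id (cst (5^-1 : R)) x 1 _ _ (is_derive_id _ _)
    (is_derive_cst _ _ _).
  by rewrite scaler0 add0r /GRing.scale /= mulr1.
exact: (@is_derive1_comp _ (horner c) (fun y : R => y / 5) x _ _ (is_derive_poly c _) h1).
Qed.

Lemma continuous_scaled (c : {poly R}) : continuous (fun y : R => c.[y / 5]).
Proof.
move=> x; apply: differentiable_continuous; apply/derivable1_diffP.
by have [] := is_derive_scaled c x.
Qed.

Variables (pz : {poly R}) (eps : R).
Hypothesis pz0 : pz.[0] = 0.
Hypothesis dpz : forall z, 0 <= z <= 1 -> `|pz^`().[z] / 5 - expR (- (5 * z))| <= eps.
Hypothesis eps1 : eps <= 1.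
Hypothesis eps5 : 5 * eps <= expR (- 5).

Definition apx x : R := pz.[x / 5].
Definition dapx x : R := pz^`().[x / 5] / 5.

Lemma is_derive_apx x : is_derive x 1 apx (dapx x).
Proof. exact: is_derive_scaled. Qed.

Lemma continuous_dapx : continuous dapx.
Proof.
have -> : dapx = (fun x => (5^-1 *: pz^`()).[x / 5]).
  by apply/funext => x; rewrite /dapx hornerZ mulrC.
exact: continuous_scaled.
Qed.

Lemma eps_ge0 : 0 <= eps.
Proof. by apply: le_trans (dpz (z := 0) _); rewrite // lexx ler01. Qed.

Lemma dapx_dist x : 0 <= x <= 5 -> `|dexpc x - dapx x| <= eps.
Proof.
move=> /andP[x0 x5]; rewrite distrC /dexpc /dapx.
have {2}-> : x = 5 * (x / 5) by field.
by apply: dpz; lra.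
Qed.

(** Both functions vanish at 0; by the mean value theorem the error [eps] of the derivatives becomes
    at most [x * eps], and [x <= 5]. *)
Lemma apx_dist x : 0 <= x <= 5 -> `|expc x - apx x| <= 5 * eps.
Proof.
move=> /andP[x0 x5].
have [->|xn0] := eqVneq x 0.
  rewrite /expc /apx oppr0 expR0 mul0r pz0 !subrr normr0.
  by rewrite mulr_ge0// eps_ge0.
have x0' : 0 < x by rewrite lt_neqAle eq_sym xn0.
have dF (y : R) : is_derive y 1 (fun t => expc t - apx t) (dexpc y - dapx y).
  exact: is_deriveB (is_derive_expc y) (is_derive_apx y).
have cF : {within `[0, x], continuous (fun t => expc t - apx t)}.
  apply: continuous_subspaceT => y.
  by apply: differentiable_continuous; apply/derivable1_diffP; have [] := dF y.
have [y] := MVT x0' (fun y _ => dF y) cF.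
rewrite in_itv /= => /andP[y0 yx].
rewrite {2}/expc {2}/apx oppr0 expR0 mul0r pz0 !subrr !subr0 => ->.
rewrite normrM [5 * _]mulrC; apply: ler_pM => //; last by rewrite addr0 ger0_norm.
by apply: dapx_dist; lra.
Qed.

(** On [0, 5] the function [expc] is at most [1 - expR (- 5)]; the hypothesis [eps5] says that the
    error [5 * eps] fits in the remaining gap. *)
Lemma apx_bound x : 0 <= x <= 5 -> `|apx x| <= 1.
Proof.
move=> x5; have := apx_dist x5; rewrite ler_norml => /andP[h1 h2].
have h3 : expR (- 5) <= expR (- x) by rewrite ler_expR; lra.
have h4 : expR (- x) <= 1 by rewrite -expR0 ler_expR; lra.
have e0 := eps_ge0.
rewrite ler_norml; move: h1 h2 eps5 eps1; rewrite /expc; lra.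
Qed.

Lemma dapx_bound x : 0 <= x <= 5 -> `|dapx x| <= 2.
Proof.
move=> x5; have := dapx_dist x5; rewrite ler_norml => /andP[h1 h2].
have := dexpc_bound x5; rewrite !ler_norml => /andP[h3 h4]; move: eps1; lra.
Qed.

(* The factor [a] is a bound for the total mass of the weight. *)
Definition approx (F dF : R -> R) (c : {poly R}) (a : R) :=
  (forall lam : R, 0 < lam < 6 -> is_derive lam 1 F (dF lam)) /\
  forall lam, 0 < lam <= 5 ->
    `|F lam - c.[lam / 5]| <= a * (15 * eps) /\
    `|5 * dF lam - c^`().[lam / 5]| <= a * (615 * eps).

Lemma approxD F dF c a G dG d b : approx F dF c a -> approx G dG d b ->
  approx (fun t => F t + G t) (fun t => dF t + dG t) (c + d) (a + b).
Proof.
move=> [hF hF'] [hG hG']; split=> lam hl.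
  exact: (is_deriveD (hF _ hl) (hG _ hl)).
have [F1 F2] := hF' _ hl; have [G1 G2] := hG' _ hl.
rewrite derivD !hornerD; split.
  rewrite opprD addrACA [leRHS]mulrDl.
  by apply: le_trans (ler_normD _ _) _; exact: (lerD F1 G1).
rewrite mulrDr opprD addrACA [leRHS]mulrDl.
by apply: le_trans (ler_normD _ _) _; exact: (lerD F2 G2).
Qed.

Lemma approxZ k F dF c a : 0 <= k -> approx F dF c a ->
  approx (fun t => k * F t) (fun t => k * dF t) (k *: c) (k * a).
Proof.
move=> k0 [hF hF']; split=> lam hl; first exact: (is_deriveZ k (hF _ hl)).
have [F1 F2] := hF' _ hl.
rewrite derivZ !hornerZ; split.
  by rewrite -mulrBr normrM ger0_norm// -mulrA ler_wpM2l.
by rewrite mulrCA -mulrBr normrM ger0_norm// -mulrA ler_wpM2l.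
Qed.

(** With at most three edges, values differ by [3 * (5 * eps) = 15 * eps]. For slopes [deprod_dist]
    gives [3 * (eps + 8 * (5 * eps))], and the factor 5 of the variable [lam / 5] makes it
    [615 * eps]. Derivatives are taken on the interval from 0 to 6, which makes 5 an interior
    point. *)
Lemma approx_eint {d} {T : measurableType d} (mu : {measure set T -> \bar R})
    (D : set T) (l : seq (T -> R)) (w : T -> R) (c : {poly R}) :
  measurable D -> mu D = 1%E ->
  List.Forall (fun s => measurable_fun setT s) l -> unit_edges D l ->
  measurable_fun setT w -> (forall t, D t -> `|w t| <= 1) -> (size l <= 3)%N ->
  (forall lam, eint mu D l w apx lam = c.[lam / 5]) ->
  approx (eint mu D l w expc) (deint mu D l w expc dexpc) c 1.
Proof.
move=> mD muD ml lD mw w1 sl ec; split.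
  move=> lam hl; exact: (is_derive_eint mD muD ml lD mw w1 is_derive_expc
    (@expc_bound 6) (@dexpc_bound 6) hl).
move=> lam /[dup] hl /andP[l0 l5].
have hl' : 0 <= lam <= 5 by rewrite (ltW l0).
have sl3 : (size l)%:R <= 3 :> R by rewrite ler_nat.
have e0 := eps_ge0.
split.
  rewrite -ec mul1r.
  apply: le_trans (eint_dist mD muD ml lD mw w1 is_derive_expc is_derive_apx
    (@expc_bound 5) apx_bound apx_dist hl') _.
  rewrite (_ : 15 * eps = 3 * (5 * eps)); last by ring.
  by rewrite ler_wpM2r// mulr_ge0.
(* The integral with [apx] is differentiated in two ways, under the integral sign and as the
   polynomial [c]; uniqueness of the derivative identifies the results. The bounds [M1] and [M2]
   serve only for domination. *)
have [M1 hM1] := poly_bounded pz (6 / 5).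
have [M2 hM2] := poly_bounded (5^-1 *: pz^`()) (6 / 5).
have scale y : 0 <= y <= 6 -> 0 <= y / 5 <= 6 / 5 by move=> ?; lra.
have hl6 : 0 < lam < 6 by lra.
have dp : is_derive lam 1 (eint mu D l w apx) (deint mu D l w apx dapx lam).
  apply: (is_derive_eint (M := Num.max M1 M2) mD muD ml lD mw w1 is_derive_apx
    _ _ hl6) => y /scale hy; rewrite le_max; apply/orP.
    by left; exact: hM1.
  by right; have := hM2 _ hy; rewrite hornerZ mulrC.
have dc : is_derive lam 1 (eint mu D l w apx) (c^`().[lam / 5] / 5).
  have -> : eint mu D l w apx = (fun t => c.[t / 5]) by apply/funext.
  exact: is_derive_scaled.
have <- : 5 * deint mu D l w apx dapx lam = c^`().[lam / 5].
  have -> : deint mu D l w apx dapx lam = c^`().[lam / 5] / 5.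
    by case: dp => _ <-; case: dc => _ <-.
  by field.
rewrite -mulrBr normrM ger0_norm// mul1r.
rewrite (_ : 615 * eps = 5 * (3 * (eps + 8 * (5 * eps)))); last by ring.
rewrite ler_wpM2l//.
apply: le_trans (deint_dist mD muD ml lD mw w1 sl is_derive_expc is_derive_apx
  continuous_dexpc continuous_dapx (@expc_bound 5) apx_bound (@dexpc_bound 5)
  dapx_bound apx_dist dapx_dist hl') _.
by rewrite ler_wpM2r//; lra.
Qed.

End EdgeFunction.

(** * Decomposition of the motif integrals *)

Arguments yv : simpl never.


Section Omega.
Context {R : realType}.
Implicit Types (u v w t psi lam : R).

Lemma harm1M u v : harm1 u * harm1 v = 3 * (yv true u * yv true v).
Proof.
rewrite /harm1 /yv mulrACA -expr2 sqr_sqrtr//.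
Qed.

Lemma omega2E psi u v :
  omega psi [tuple u; v] = 1 + psi * (3 * (yv true u * yv true v)).
Proof.
rewrite /omega /= addr0; congr (_ + _ * _).
under eq_bigr do rewrite big_mkcond.
by rewrite !big_ord_recl !big_ord0 /= !(tnth_nth 0) /= harm1M; ring.
Qed.

Lemma omega3E psi u v w :
  omega psi [tuple u; v; w] =
  1 + psi * (3 * (yv true u * yv true v + yv true u * yv true w + yv true v * yv true w)).
Proof.
rewrite /omega /= addr0; congr (_ + _ * _).
under eq_bigr do rewrite big_mkcond.
rewrite !big_ord_recl !big_ord0 /= !(tnth_nth 0) /= !harm1M; ring.
Qed.

(** A pair of harmonics contributes [3], the square of [sqrt 3]; four of them contribute 9, whence
    [27 / 2 = 3 / 2 * 9]. *)
Lemma omega4E psi u v w t :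
  omega psi [tuple u; v; w; t] =
  1 + psi * (3 * (yv true u * yv true v + yv true u * yv true w + yv true u * yv true t
    + yv true v * yv true w + yv true v * yv true t + yv true w * yv true t))
  + psi ^+ 2 * (27 / 2 * (yv true u * yv true v * yv true w * yv true t)).
Proof.
rewrite /omega /=; congr (_ + _ + _).
  congr (_ * _); under eq_bigr do rewrite big_mkcond.
  by rewrite !big_ord_recl !big_ord0 /= !(tnth_nth 0) /= !harm1M; ring.
rewrite !big_ord_recl big_ord0 /= !(tnth_nth 0) /= mulr1.
have -> : harm1 u * (harm1 v * (harm1 w * harm1 t)) =
  (harm1 u * harm1 v) * (harm1 w * harm1 t) by ring.
by rewrite !harm1M; field.
Qed.

End Omega.

Lemma bm_int_lin {d} {T : measurableType d} {R : realType}
    (mu : {measure set T -> \bar R}) (D : set T) (s : seq (R * (T -> R))) :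
  measurable D -> mu D = 1%E -> List.Forall (fun p => bm D p.2) s ->
  \int[mu]_(x in D) (\sum_(p <- s) p.1 * p.2 x) =
  \sum_(p <- s) p.1 * \int[mu]_(x in D) p.2 x.
Proof.
move=> mD muD bs.
suff [] : bm D (fun x => \sum_(p <- s) p.1 * p.2 x) /\
  \int[mu]_(x in D) (\sum_(p <- s) p.1 * p.2 x) =
  \sum_(p <- s) p.1 * \int[mu]_(x in D) p.2 x by [].
elim: s bs => [|p s IH] bs.
  split; first by under eq_fun do rewrite big_nil; exact: bm_cst.
  by under eq_Rintegral do rewrite big_nil; rewrite Rintegral_cst// mul0r big_nil.
have [bp bs'] := Forall_consE bs.
have [IH1 IH2] := IH bs'.
have bcp : bm D (fun x => p.1 * p.2 x) by apply: bmM => //; exact: bm_cst.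
split; first by under eq_fun do rewrite big_cons; exact: bmD.
under eq_Rintegral do rewrite big_cons.
by rewrite (bm_intD mD muD bcp IH1) IH2 (bm_intZl mD muD _ bp) big_cons.
Qed.

Section Motifs.
Context {R : realType}.
Local Notation mu := (@lebesgue_measure R).
Local Notation mu2 := (mu \x mu)%E.
Local Notation mu3 := (mu2 \x mu)%E.
Local Notation mu4 := (mu3 \x mu)%E.
Local Notation I := (`[0%R, 1%R]%classic : set R).
Implicit Types (lam psi : R) (phi : R -> R).

Definition wt2 g1 g2 (z : R * R) : R := yv g1 z.1 * yv g2 z.2.
Definition wt3 g1 g2 g3 (z : R * R * R) : R :=
  yv g1 z.1.1 * yv g2 z.1.2 * yv g3 z.2.
Definition wt4 g1 g2 g3 g4 (z : R * R * R * R) : R :=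
  yv g1 z.1.1.1 * yv g2 z.1.1.2 * yv g3 z.1.2 * yv g4 z.2.

Definition edge_l : seq (R * R -> R) := [:: fun z => z.1 * z.2].
Definition wedge_l : seq (R * R * R -> R) :=
  [:: (fun z => z.1.1 * z.1.2); (fun z => z.1.1 * z.2)].
Definition triangle_l : seq (R * R * R -> R) :=
  [:: (fun z => z.1.1 * z.1.2); (fun z => z.1.1 * z.2); (fun z => z.1.2 * z.2)].
Definition path_l : seq (R * R * R * R -> R) :=
  [:: (fun z => z.1.1.1 * z.1.1.2); (fun z => z.1.1.1 * z.1.2);
      (fun z => z.1.1.2 * z.2)].
Definition star_l : seq (R * R * R * R -> R) :=
  [:: (fun z => z.1.1.1 * z.1.1.2); (fun z => z.1.1.1 * z.1.2);
      (fun z => z.1.1.1 * z.2)].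

Definition edgeI phi g1 g2 := eint mu2 (I `*` I) edge_l (wt2 g1 g2) phi.
Definition wedgeI phi g1 g2 g3 :=
  eint mu3 (I `*` I `*` I) wedge_l (wt3 g1 g2 g3) phi.
Definition triangleI phi g1 g2 g3 :=
  eint mu3 (I `*` I `*` I) triangle_l (wt3 g1 g2 g3) phi.
Definition pathI phi g1 g2 g3 g4 :=
  eint mu4 (I `*` I `*` I `*` I) path_l (wt4 g1 g2 g3 g4) phi.
Definition starI phi g1 g2 g3 g4 :=
  eint mu4 (I `*` I `*` I `*` I) star_l (wt4 g1 g2 g3 g4) phi.

Lemma yv_bound g (u : R) : I u -> `|yv g u| <= 1.
Proof.
rewrite /= in_itv /= => /andP[u0 u1]; case: g; last by rewrite normr1.
by rewrite ler_norml /yv; apply/andP; split; lra.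
Qed.

Lemma unitM (u v : R) : I u -> I v -> 0 <= u * v <= 1.
Proof.
rewrite /= !in_itv /= => /andP[u0 u1] /andP[v0 v1].
by rewrite mulr_ge0//= mulr_ile1.
Qed.

Lemma wt2_bound g1 g2 z : (I `*` I) z -> `|wt2 g1 g2 z| <= 1.
Proof. by case=> z1 z2; rewrite /wt2 normrM mulr_ile1// yv_bound. Qed.

Lemma wt3_bound g1 g2 g3 z : (I `*` I `*` I) z -> `|wt3 g1 g2 g3 z| <= 1.
Proof.
by case=> [[z1 z2] z3]; rewrite /wt3 !normrM !mulr_ile1// ?mulr_ge0// yv_bound.
Qed.

Lemma wt4_bound g1 g2 g3 g4 z : (I `*` I `*` I `*` I) z -> `|wt4 g1 g2 g3 g4 z| <= 1.
Proof.
by case=> [[[z1 z2] z3] z4]; rewrite /wt4 !normrM !mulr_ile1// ?mulr_ge0// yv_bound.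
Qed.

Ltac bm_tac := repeat first
  [ exact: bm_id | exact: bm_sq1 | exact: bm_sq2 | exact: bm_cu1 | exact: bm_cu2
  | exact: bm_cu3 | exact: bm_te1 | exact: bm_te2 | exact: bm_te3 | exact: bm_te4
  | exact: bm_cst | apply: bm_yvf | apply: bm_horner | apply: bmX | apply: bmM
  | apply: bmD ].

Lemma bm_wt2 g1 g2 : bm (I `*` I) (wt2 g1 g2).
Proof. by rewrite /wt2; bm_tac. Qed.
Lemma bm_wt3 g1 g2 g3 : bm (I `*` I `*` I) (wt3 g1 g2 g3).
Proof. by rewrite /wt3; bm_tac. Qed.
Lemma bm_wt4 g1 g2 g3 g4 : bm (I `*` I `*` I `*` I) (wt4 g1 g2 g3 g4).
Proof. by rewrite /wt4; bm_tac. Qed.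

Ltac edges_tac := repeat apply: List.Forall_cons; try exact: List.Forall_nil.

Lemma measurable_edge_l : List.Forall (fun s => measurable_fun setT s) edge_l.
Proof.
edges_tac.
have b : bm (I `*` I) (fun z : R * R => z.1 * z.2) by bm_tac.
by case: b.
Qed.

Lemma measurable_triangle_l : List.Forall (fun s => measurable_fun setT s) triangle_l.
Proof.
have b1 : bm (I `*` I `*` I) (fun z => z.1.1 * z.1.2) by bm_tac.
have b2 : bm (I `*` I `*` I) (fun z => z.1.1 * z.2) by bm_tac.
have b3 : bm (I `*` I `*` I) (fun z => z.1.2 * z.2) by bm_tac.
by edges_tac; [case: b1 | case: b2 | case: b3].
Qed.

Lemma measurable_wedge_l : List.Forall (fun s => measurable_fun setT s) wedge_l.
Proof.
have b1 : bm (I `*` I `*` I) (fun z => z.1.1 * z.1.2) by bm_tac.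
have b2 : bm (I `*` I `*` I) (fun z => z.1.1 * z.2) by bm_tac.
by edges_tac; [case: b1 | case: b2].
Qed.

Lemma measurable_path_l : List.Forall (fun s => measurable_fun setT s) path_l.
Proof.
have b1 : bm (I `*` I `*` I `*` I) (fun z => z.1.1.1 * z.1.1.2) by bm_tac.
have b2 : bm (I `*` I `*` I `*` I) (fun z => z.1.1.1 * z.1.2) by bm_tac.
have b3 : bm (I `*` I `*` I `*` I) (fun z => z.1.1.2 * z.2) by bm_tac.
by edges_tac; [case: b1 | case: b2 | case: b3].
Qed.

Lemma measurable_star_l : List.Forall (fun s => measurable_fun setT s) star_l.
Proof.
have b1 : bm (I `*` I `*` I `*` I) (fun z => z.1.1.1 * z.1.1.2) by bm_tac.
have b2 : bm (I `*` I `*` I `*` I) (fun z => z.1.1.1 * z.1.2) by bm_tac.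
have b3 : bm (I `*` I `*` I `*` I) (fun z => z.1.1.1 * z.2) by bm_tac.
by edges_tac; [case: b1 | case: b2 | case: b3].
Qed.

Lemma unit_edge_l : unit_edges (I `*` I) edge_l.
Proof. by move=> z [z1 z2]; edges_tac; exact: unitM. Qed.

Lemma unit_wedge_l : unit_edges (I `*` I `*` I) wedge_l.
Proof. by move=> z [[z1 z2] z3]; edges_tac; exact: unitM. Qed.

Lemma unit_triangle_l : unit_edges (I `*` I `*` I) triangle_l.
Proof. by move=> z [[z1 z2] z3]; edges_tac; exact: unitM. Qed.

Lemma unit_path_l : unit_edges (I `*` I `*` I `*` I) path_l.
Proof. by move=> z [[[z1 z2] z3] z4]; edges_tac; exact: unitM. Qed.

Lemma unit_star_l : unit_edges (I `*` I `*` I `*` I) star_l.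
Proof. by move=> z [[[z1 z2] z3] z4]; edges_tac; exact: unitM. Qed.

(** From here on, the coefficients of the powers of [psi] in the motif integrals. The flags mark the
    labels that carry a harmonic in a monomial of [omega]. *)
Definition E0f := edgeI expc false false.
Definition E1f t := 3 * edgeI expc true true t.
Definition S0f := wedgeI expc false false false.
Definition S1f t := 3 * (wedgeI expc true true false t
  + wedgeI expc true false true t + wedgeI expc false true true t).
Definition T0f := triangleI expc false false false.
Definition T1f t := 3 * (triangleI expc true true false t
  + triangleI expc true false true t + triangleI expc false true true t).
Definition P0f := pathI expc false false false false.
Definition P1f t := 3 * (pathI expc true true false false t
  + pathI expc true false true false t + pathI expc true false false true t
  + pathI expc false true true false t + pathI expc false true false true t
  + pathI expc false false true true t).
Definition P2f t := 27 / 2 * pathI expc true true true true t.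
Definition Q0f := starI expc false false false false.
Definition Q1f t := 3 * (starI expc true true false false t
  + starI expc true false true false t + starI expc true false false true t
  + starI expc false true true false t + starI expc false true false true t
  + starI expc false false true true t).
Definition Q2f t := 27 / 2 * starI expc true true true true t.


Lemma bm_edgeI lam g1 g2 : 0 <= lam ->
  bm (I `*` I) (fun z => eprod expc edge_l lam z * wt2 g1 g2 z).
Proof.
move=> l0; apply: (bm_eprod measurable_edge_l unit_edge_l
  (bm_wt2 g1 g2).1 (@wt2_bound g1 g2) is_derive_expc (@expc_bound _ lam)).
by rewrite l0 lexx.
Qed.

Lemma bm_wedgeI lam g1 g2 g3 : 0 <= lam ->
  bm (I `*` I `*` I) (fun z => eprod expc wedge_l lam z * wt3 g1 g2 g3 z).
Proof.
move=> l0; apply: (bm_eprod measurable_wedge_l unit_wedge_l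
  (bm_wt3 g1 g2 g3).1 (@wt3_bound g1 g2 g3) is_derive_expc (@expc_bound _ lam)).
by rewrite l0 lexx.
Qed.

Lemma bm_triangleI lam g1 g2 g3 : 0 <= lam ->
  bm (I `*` I `*` I) (fun z => eprod expc triangle_l lam z * wt3 g1 g2 g3 z).
Proof.
move=> l0; apply: (bm_eprod measurable_triangle_l unit_triangle_l
  (bm_wt3 g1 g2 g3).1 (@wt3_bound g1 g2 g3) is_derive_expc (@expc_bound _ lam)).
by rewrite l0 lexx.
Qed.

Lemma bm_pathI lam g1 g2 g3 g4 : 0 <= lam ->
  bm (I `*` I `*` I `*` I) (fun z => eprod expc path_l lam z * wt4 g1 g2 g3 g4 z).
Proof.
move=> l0; apply: (bm_eprod measurable_path_l unit_path_l
  (bm_wt4 g1 g2 g3 g4).1 (@wt4_bound g1 g2 g3 g4) is_derive_expc (@expc_bound _ lam)).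
by rewrite l0 lexx.
Qed.

Lemma bm_starI lam g1 g2 g3 g4 : 0 <= lam ->
  bm (I `*` I `*` I `*` I) (fun z => eprod expc star_l lam z * wt4 g1 g2 g3 g4 z).
Proof.
move=> l0; apply: (bm_eprod measurable_star_l unit_star_l
  (bm_wt4 g1 g2 g3 g4).1 (@wt4_bound g1 g2 g3 g4) is_derive_expc (@expc_bound _ lam)).
by rewrite l0 lexx.
Qed.

Lemma HconnE lam u v : Hconn lam u v = expc (lam * (u * v)).
Proof. by rewrite /Hconn /expc mulrA. Qed.


End Motifs.

Section MotifSplit.
Context {R : realType}.
Local Notation mu := (@lebesgue_measure R).
Local Notation mu2 := (mu \x mu)%E.
Local Notation mu3 := (mu2 \x mu)%E.
Local Notation mu4 := (mu3 \x mu)%E.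
Local Notation I := (`[0%R, 1%R]%classic : set R).
Implicit Types (lam psi : R).

Lemma motifE_split lam psi : 0 <= lam ->
  motifE lam psi = E0f lam + psi * E1f lam.
Proof.
move=> l0; pose F g1 g2 z := eprod expc edge_l lam z * wt2 g1 g2 z.
pose s : seq (R * (R * R -> R)) :=
  [:: (1, F false false); (3 * psi, F true true)].
have hs : List.Forall (fun p => bm (I `*` I) p.2) s.
  by repeat (apply: List.Forall_cons; first exact: bm_edgeI); exact: List.Forall_nil.
transitivity (\int[mu2]_(x in I `*` I) (\sum_(p <- s) p.1 * p.2 x)).
  rewrite /motifE; apply: eq_Rintegral => -[u v] _.
  by rewrite /s !big_cons big_nil /= omega2E !HconnE /F /wt2 /= /yv; ring.
rewrite (bm_int_lin (mu := mu2) (@measurable_square R) square_measure hs) /s !big_cons big_nil /= /F.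
by rewrite /E0f /E1f /edgeI /eint; ring.
Qed.

Lemma motifS_split lam psi : 0 <= lam ->
  motifS lam psi = S0f lam + psi * S1f lam.
Proof.
move=> l0; pose F g1 g2 g3 z := eprod expc wedge_l lam z * wt3 g1 g2 g3 z.
pose s : seq (R * (R * R * R -> R)) :=
  [:: (1, F false false false); (3 * psi, F true true false); (3 * psi, F true false true); (3 * psi, F false true true)].
have hs : List.Forall (fun p => bm (I `*` I `*` I) p.2) s.
  by repeat (apply: List.Forall_cons; first exact: bm_wedgeI); exact: List.Forall_nil.
transitivity (\int[mu3]_(x in I `*` I `*` I) (\sum_(p <- s) p.1 * p.2 x)).
  rewrite /motifS; apply: eq_Rintegral => -[[u v] w] _.
  by rewrite /s !big_cons big_nil /= omega3E !HconnE /F /wt3 /= /yv; ring.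
rewrite (bm_int_lin (mu := mu3) (@measurable_cube R) cube_measure hs) /s !big_cons big_nil /= /F.
by rewrite /S0f /S1f /wedgeI /eint; ring.
Qed.

Lemma motifT_split lam psi : 0 <= lam ->
  motifT lam psi = T0f lam + psi * T1f lam.
Proof.
move=> l0; pose F g1 g2 g3 z := eprod expc triangle_l lam z * wt3 g1 g2 g3 z.
pose s : seq (R * (R * R * R -> R)) :=
  [:: (1, F false false false); (3 * psi, F true true false); (3 * psi, F true false true); (3 * psi, F false true true)].
have hs : List.Forall (fun p => bm (I `*` I `*` I) p.2) s.
  by repeat (apply: List.Forall_cons; first exact: bm_triangleI); exact: List.Forall_nil.
transitivity (\int[mu3]_(x in I `*` I `*` I) (\sum_(p <- s) p.1 * p.2 x)).
  rewrite /motifT; apply: eq_Rintegral => -[[u v] w] _.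
  by rewrite /s !big_cons big_nil /= omega3E !HconnE /F /wt3 /= /yv; ring.
rewrite (bm_int_lin (mu := mu3) (@measurable_cube R) cube_measure hs) /s !big_cons big_nil /= /F.
by rewrite /T0f /T1f /triangleI /eint; ring.
Qed.

Lemma motifP_split lam psi : 0 <= lam ->
  motifP lam psi = P0f lam + psi * P1f lam + psi ^+ 2 * P2f lam.
Proof.
move=> l0; pose F g1 g2 g3 g4 z := eprod expc path_l lam z * wt4 g1 g2 g3 g4 z.
pose s : seq (R * (R * R * R * R -> R)) :=
  [:: (1, F false false false false); (3 * psi, F true true false false); (3 * psi, F true false true false); (3 * psi, F true false false true); (3 * psi, F false true true false); (3 * psi, F false true false true); (3 * psi, F false false true true); (27 / 2 * psi ^+ 2, F true true true true)].
have hs : List.Forall (fun p => bm (I `*` I `*` I `*` I) p.2) s.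
  by repeat (apply: List.Forall_cons; first exact: bm_pathI); exact: List.Forall_nil.
transitivity (\int[mu4]_(x in I `*` I `*` I `*` I) (\sum_(p <- s) p.1 * p.2 x)).
  rewrite /motifP; apply: eq_Rintegral => -[[[u v] w] t] _.
  by rewrite /s !big_cons big_nil /= omega4E !HconnE /F /wt4 /= /yv; ring.
rewrite (bm_int_lin (mu := mu4) (@measurable_tesseract R) tesseract_measure hs) /s !big_cons big_nil /= /F.
by rewrite /P0f /P1f /P2f /pathI /eint; ring.
Qed.

Lemma motifQ_split lam psi : 0 <= lam ->
  motifQ lam psi = Q0f lam + psi * Q1f lam + psi ^+ 2 * Q2f lam.
Proof.
move=> l0; pose F g1 g2 g3 g4 z := eprod expc star_l lam z * wt4 g1 g2 g3 g4 z.
pose s : seq (R * (R * R * R * R -> R)) :=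
  [:: (1, F false false false false); (3 * psi, F true true false false); (3 * psi, F true false true false); (3 * psi, F true false false true); (3 * psi, F false true true false); (3 * psi, F false true false true); (3 * psi, F false false true true); (27 / 2 * psi ^+ 2, F true true true true)].
have hs : List.Forall (fun p => bm (I `*` I `*` I `*` I) p.2) s.
  by repeat (apply: List.Forall_cons; first exact: bm_starI); exact: List.Forall_nil.
transitivity (\int[mu4]_(x in I `*` I `*` I `*` I) (\sum_(p <- s) p.1 * p.2 x)).
  rewrite /motifQ; apply: eq_Rintegral => -[[[u v] w] t] _.
  by rewrite /s !big_cons big_nil /= omega4E !HconnE /F /wt4 /= /yv; ring.
rewrite (bm_int_lin (mu := mu4) (@measurable_tesseract R) tesseract_measure hs) /s !big_cons big_nil /= /F.
by rewrite /Q0f /Q1f /Q2f /starI /eint; ring.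
Qed.

End MotifSplit.

(** * Polynomial approximations of the twelve coefficients *)

Section MotifPolynomials.
Context {R : realType}.
Variable p : {poly R}.

Definition edgeP g1 g2 := wpoly g1 0 (wpoly g2 0 p).
Definition wedgeP g1 g2 g3 := wpoly g1 0 (wpoly g2 0 p * wpoly g3 0 p).
Definition starP g1 g2 g3 g4 :=
  wpoly g1 0 (wpoly g2 0 p * wpoly g3 0 p * wpoly g4 0 p).
Definition pathP g1 g2 g3 g4 :=
  \sum_(i < size p) p`_i *: 'X^i *
    (wpoly g1 i (wpoly g3 0 p) * wpoly g2 i (wpoly g4 0 p)).
(** [i], [j], [k] are the exponents of the edges 12, 13, 23, so the first label occurs to the power
    [i + j], the second to [i + k], the third to [j + k]. *)
Definition triangleP g1 g2 g3 :=
  \sum_(i < size p) \sum_(j < size p) \sum_(k < size p)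
    (p`_i * p`_j * p`_k * (wt g1 (i + j) * wt g2 (i + k) * wt g3 (j + k)))
    *: 'X^(i + j + k).

End MotifPolynomials.

Section MotifApprox.
Context {R : realType}.
Implicit Types (lam : R).
Variables (pz : {poly R}) (eps : R).
Hypothesis pz0 : pz.[0] = 0.
Hypothesis dpz : forall z, 0 <= z <= 1 -> `|pz^`().[z] / 5 - expR (- (5 * z))| <= eps.
Hypothesis eps1 : eps <= 1.
Hypothesis eps5 : 5 * eps <= expR (- 5).

Local Notation mu := (@lebesgue_measure R).
Local Notation mu2 := (mu \x mu)%E.
Local Notation mu3 := (mu2 \x mu)%E.
Local Notation mu4 := (mu3 \x mu)%E.
Local Notation I := (`[0%R, 1%R]%classic : set R).

Lemma approx_edge g1 g2 :
  exists dF, approx eps (edgeI expc g1 g2) dF (edgeP pz g1 g2) 1.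
Proof.
eexists; apply: (approx_eint (mu := mu2) pz0 dpz eps1 eps5 (@measurable_square R)
  square_measure measurable_edge_l unit_edge_l (bm_wt2 g1 g2).1
  (@wt2_bound _ g1 g2)) => // lam.
rewrite -int_edge; apply: eq_Rintegral => z _.
by rewrite /= mulr1 /apx mulrAC.
Qed.

Lemma approx_wedge g1 g2 g3 :
  exists dF, approx eps (wedgeI expc g1 g2 g3) dF (wedgeP pz g1 g2 g3) 1.
Proof.
eexists; apply: (approx_eint (mu := mu3) pz0 dpz eps1 eps5 (@measurable_cube R)
  cube_measure measurable_wedge_l unit_wedge_l (bm_wt3 g1 g2 g3).1
  (@wt3_bound _ g1 g2 g3)) => // lam.
rewrite -int_wedge; apply: eq_Rintegral => z _.
by rewrite /= mulr1 /apx ![lam * _ / 5]mulrAC.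
Qed.

Lemma approx_triangle g1 g2 g3 :
  exists dF, approx eps (triangleI expc g1 g2 g3) dF (triangleP pz g1 g2 g3) 1.
Proof.
eexists; apply: (approx_eint (mu := mu3) pz0 dpz eps1 eps5 (@measurable_cube R)
  cube_measure measurable_triangle_l unit_triangle_l (bm_wt3 g1 g2 g3).1
  (@wt3_bound _ g1 g2 g3)) => // lam.
transitivity (\sum_(i < size pz) \sum_(j < size pz) \sum_(k < size pz)
    (pz`_i * (lam / 5) ^+ i) * (pz`_j * (lam / 5) ^+ j) * (pz`_k * (lam / 5) ^+ k) *
    (wt g1 (i + j) * wt g2 (i + k) * wt g3 (j + k)) : R).
  rewrite -int_triangle; apply: eq_Rintegral => z _.
  by rewrite /= mulr1 /apx ![lam * _ / 5]mulrAC !mulrA.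
rewrite /triangleP horner_sum; apply: eq_bigr => i _.
rewrite horner_sum; apply: eq_bigr => j _.
rewrite horner_sum; apply: eq_bigr => k _.
by rewrite hornerZ hornerXn !exprD; ring.
Qed.

Lemma approx_path g1 g2 g3 g4 :
  exists dF, approx eps (pathI expc g1 g2 g3 g4) dF (pathP pz g1 g2 g3 g4) 1.
Proof.
eexists; apply: (approx_eint (mu := mu4) pz0 dpz eps1 eps5 (@measurable_tesseract R)
  tesseract_measure measurable_path_l unit_path_l (bm_wt4 g1 g2 g3 g4).1
  (@wt4_bound _ g1 g2 g3 g4)) => // lam.
rewrite /pathP horner_sum.
under [RHS]eq_bigr => i _ do rewrite hornerM hornerZ hornerXn hornerM.
rewrite -int_path; apply: eq_Rintegral => z _.
by rewrite /= mulr1 /apx ![lam * _ / 5]mulrAC !mulrA.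
Qed.

Lemma approx_star g1 g2 g3 g4 :
  exists dF, approx eps (starI expc g1 g2 g3 g4) dF (starP pz g1 g2 g3 g4) 1.
Proof.
eexists; apply: (approx_eint (mu := mu4) pz0 dpz eps1 eps5 (@measurable_tesseract R)
  tesseract_measure measurable_star_l unit_star_l (bm_wt4 g1 g2 g3 g4).1
  (@wt4_bound _ g1 g2 g3 g4)) => // lam.
rewrite -int_star; apply: eq_Rintegral => z _.
by rewrite /= mulr1 /apx ![lam * _ / 5]mulrAC !mulrA.
Qed.

Lemma approxD_ex F G (c e : {poly R}) (a b : R) :
  (exists dF, approx eps F dF c a) -> (exists dG, approx eps G dG e b) ->
  exists dF, approx eps (fun t => F t + G t) dF (c + e) (a + b).
Proof. by move=> [dF hF] [dG hG]; eexists; exact: (approxD hF hG). Qed.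

Lemma approxZ_ex k F (c : {poly R}) (a : R) : 0 <= k ->
  (exists dF, approx eps F dF c a) ->
  exists dF, approx eps (fun t => k * F t) dF (k *: c) (k * a).
Proof. by move=> k0 [dF hF]; eexists; exact: (approxZ k0 hF). Qed.

(* Every weight of the motif sums has total mass at most 18. *)
Definition close (F : R -> R) (c : {poly R}) :=
  (forall lam : R, 0 < lam < 6 -> derivable F lam 1) /\
  forall lam, 0 < lam <= 5 ->
    `|F lam - c.[lam / 5]| <= 18 * (15 * eps) /\
    `|5 * derive1 F lam - c^`().[lam / 5]| <= 18 * (615 * eps).

Lemma approx_close F c a : a <= 18 -> (exists dF, approx eps F dF c a) -> close F c.
Proof.
move=> a18 [dF [h1 h2]]; have e0 := eps_ge0 dpz; split.
  by move=> lam /h1 [].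
move=> lam hl; have [h3 h4] := h2 _ hl.
have hl6 : 0 < lam < 6 by lra.
have dFE : derive1 F lam = dF lam by rewrite derive1E; have [_ ->] := h1 _ hl6.
rewrite dFE; split.
  have e1 : 0 <= 15 * eps by lra.
  exact: (le_trans h3 (ler_wpM2r e1 a18)).
have e1 : 0 <= 615 * eps by lra.
exact: (le_trans h4 (ler_wpM2r e1 a18)).
Qed.

(** The order is shared with [motif_funs], with the output of [coefs] and with the indices in
    [jet_of]. *)
Definition motif_polys : seq {poly R} :=
  [:: edgeP pz false false;
      3 *: edgeP pz true true;
      wedgeP pz false false false;
      3 *: (wedgeP pz true true false + wedgeP pz true false true
        + wedgeP pz false true true);
      triangleP pz false false false;
      3 *: (triangleP pz true true false + triangleP pz true false true
        + triangleP pz false true true);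
      pathP pz false false false false;
      3 *: (pathP pz true true false false + pathP pz true false true false
        + pathP pz true false false true + pathP pz false true true false
        + pathP pz false true false true + pathP pz false false true true);
      (27 / 2) *: pathP pz true true true true;
      starP pz false false false false;
      3 *: (starP pz true true false false + starP pz true false true false
        + starP pz true false false true + starP pz false true true false
        + starP pz false true false true + starP pz false false true true);
      (27 / 2) *: starP pz true true true true].

Definition motif_funs : seq (R -> R) :=
  [:: E0f; E1f; S0f; S1f; T0f; T1f; P0f; P1f; P2f; Q0f; Q1f; Q2f].

Lemma motif_close k : (k < 12)%N ->
  close (nth (fun=> 0) motif_funs k) (nth 0 motif_polys k).
Proof.
have c3 : 0 <= 3 :> R by [].
have c27 : 0 <= 27 / 2 :> R by lra.
case: k => [_|].
  by apply: (approx_close _ (approx_edge false false)); lra.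
case=> [_|].
  by apply: (approx_close _ (approxZ_ex c3 (approx_edge true true))); lra.
case=> [_|].
  by apply: (approx_close _ (approx_wedge false false false)); lra.
case=> [_|].
  by apply: (approx_close _ (approxZ_ex c3 (approxD_ex (approxD_ex
    (approx_wedge _ _ _) (approx_wedge _ _ _)) (approx_wedge _ _ _)))); lra.
case=> [_|].
  by apply: (approx_close _ (approx_triangle false false false)); lra.
case=> [_|].
  by apply: (approx_close _ (approxZ_ex c3 (approxD_ex (approxD_ex
    (approx_triangle _ _ _) (approx_triangle _ _ _)) (approx_triangle _ _ _)))); lra.
case=> [_|].
  by apply: (approx_close _ (approx_path false false false false)); lra.
case=> [_|].
  by apply: (approx_close _ (approxZ_ex c3 (approxD_ex (approxD_ex (approxD_ex
    (approxD_ex (approxD_ex (approx_path _ _ _ _) (approx_path _ _ _ _))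
    (approx_path _ _ _ _)) (approx_path _ _ _ _)) (approx_path _ _ _ _))
    (approx_path _ _ _ _)))); lra.
case=> [_|].
  by apply: (approx_close _ (approxZ_ex c27 (approx_path true true true true))); lra.
case=> [_|].
  by apply: (approx_close _ (approx_star false false false false)); lra.
case=> [_|].
  by apply: (approx_close _ (approxZ_ex c3 (approxD_ex (approxD_ex (approxD_ex
    (approxD_ex (approxD_ex (approx_star _ _ _ _) (approx_star _ _ _ _))
    (approx_star _ _ _ _)) (approx_star _ _ _ _)) (approx_star _ _ _ _))
    (approx_star _ _ _ _)))); lra.
case=> [_|n]; last by rewrite !ltnS ltn0.
by apply: (approx_close _ (approxZ_ex c27 (approx_star true true true true))); lra.
Qed.

End MotifApprox.

(** * The certificate *)

(** The operations are abstract so that one program has two readings: [iops] computes integers with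
    error radii, [rops] real numbers. [ofrac] is needed for the moments only, and for the scalar
    27/2. *)
Record ops A := Ops {
  ozero : A; oadd : A -> A -> A; omul : A -> A -> A;
  oscale : Z -> A -> A; ofrac : Z -> Z -> A }.

Section CoefficientProgram.
Local Open Scope Z_scope.
Context {A : Type} (o : ops A).
Implicit Types (u v w c m b p : seq A).

Fixpoint zipw (f : A -> A -> A) u v :=
  match u, v with x :: u, y :: v => f x y :: zipw f u v | _, _ => [::] end.
Fixpoint padd u v :=
  match u, v with
  | [::], _ => v
  | _, [::] => u
  | x :: u', y :: v' => oadd o x y :: padd u' v'
  end.
Definition pscal (x : A) u := map (omul o x) u.
Definition pzscal (k : Z) u := map (oscale o k) u.
Fixpoint pmul u v :=
  if u is x :: u then padd (pscal x v) (ozero o :: pmul u v) else [::].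
Definition wgt c w := zipw (omul o) c w.
(** The double sum of [u_j c_k w_(j+k) X^(j+k)]; the weight is the moment of the label shared by two
    edges of the triangle. *)
Fixpoint pquad c u w :=
  if u is x :: u then padd (pscal x (wgt c w)) (ozero o :: pquad c u (behead w))
  else [::].
Fixpoint moms (n : nat) (k : Z) :=
  if n is S n then ofrac o 1 (k + 1) :: moms n (k + 1) else [::].
Fixpoint bmoms (n : nat) (k : Z) :=
  if n is S n then ofrac o k ((k + 1) * (k + 2)) :: bmoms n (k + 1) else [::].
(** Sum over the exponent [i] of one edge expanded in monomials. Dropping a moment at each step
    raises by one the power of the labels at both ends of this edge. *)
Fixpoint isum (f : seq A -> seq A -> seq A) p m b :=
  if p is x :: p then
    padd (pscal x (f m b)) (ozero o :: isum f p (behead m) (behead b))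
  else [::].

(** [h0] and [h1] are a leaf integrated out without and with its harmonic. For edge, wedge, triangle
    and star, the integer scalars are 3 times the number of pairs of harmonics that a symmetry of
    the motif identifies. Cutting the path at its middle edge, the four pairs with one harmonic on
    each side form the square of [c], and the two pairs on a single side form the doubled
    product. *)
Definition coefs p : seq (seq A) :=
  let m := moms 60 0 in
  let b := bmoms 60 0 in
  let h0 := wgt p m in
  let h1 := wgt p b in
  let h00 := pmul h0 h0 in
  let h01 := pmul h0 h1 in
  let h11 := pmul h1 h1 in
  let q := ofrac o 27 2 in
  [:: wgt h0 m;
      pzscal 3 (wgt h1 b);
      wgt h00 m;
      padd (pzscal 6 (wgt h01 b)) (pzscal 3 (wgt h11 m));
      isum (fun mi _ => let c := wgt p mi in pquad c c m) p m b;
      pzscal 9 (isum (fun _ bi => let c := wgt p bi in pquad c c m) p m b);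
      isum (fun mi _ => let c := wgt h0 mi in pmul c c) p m b;
      pzscal 3 (isum (fun mi bi =>
        let c := padd (wgt h0 bi) (wgt h1 mi) in
        padd (pmul c c) (pzscal 2 (pmul (wgt h0 mi) (wgt h1 bi)))) p m b);
      pscal q (isum (fun _ bi => let c := wgt h1 bi in pmul c c) p m b);
      wgt (pmul h00 h0) m;
      padd (pzscal 9 (wgt (pmul h00 h1) b)) (pzscal 9 (wgt (pmul h01 h1) m));
      pscal q (wgt (pmul h11 h1) b)].

Fixpoint pderiv_from (k : Z) u :=
  if u is x :: u then oscale o k x :: pderiv_from (k + 1) u else [::].
Definition pderiv u := pderiv_from 1 (behead u).

End CoefficientProgram.

(** * Fixed-point intervals and Taylor models *)

Section FixedPoint.
Local Open Scope Z_scope.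

(* Fixed-point numbers carry the factor [2 ^ 42]. *)
Definition fp_prec : Z := 42.
Definition fp_unit : Z := 4398046511104.

(** A pair is a centre and a radius. Shifts and divisions round down: the 2 in a product pays for
    rounding the centre and the radius, the 1 in a fraction for rounding the quotient. *)
Definition iops : ops (Z * Z) := {|
  ozero := (0, 0);
  oadd := fun x y => (x.1 + y.1, x.2 + y.2);
  omul := fun x y =>
    let: (a, r) := x in let: (b, s) := y in
    (Z.shiftr (a * b) fp_prec,
     Z.shiftr (Z.abs a * s + r * (Z.abs b + s)) fp_prec + 2);
  oscale := fun k x => (k * x.1, Z.abs k * x.2);
  ofrac := fun n d => (n * fp_unit / d, 1) |}.

(* Taylor models of degree two in two variables ranging over [-1, 1]. *)
Record tm := Tm { tc : Z; ta : Z; tb : Z; taa : Z; tab : Z; tbb : Z; tr : Z }.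

Record tops A := Tops {
  tadd : A -> A -> A; tsub : A -> A -> A; tmul : A -> A -> A;
  tscale : Z -> A -> A; tcst : Z -> A }.

(** In a product, the remainder collects all terms of degree three and four and the products
    involving a remainder. Six coefficients and the remainder are rounded down, hence the 7. *)
Definition tmops : tops tm := {|
  tadd := fun x y => Tm (tc x + tc y) (ta x + ta y) (tb x + tb y)
    (taa x + taa y) (tab x + tab y) (tbb x + tbb y) (tr x + tr y);
  tsub := fun x y => Tm (tc x - tc y) (ta x - ta y) (tb x - tb y)
    (taa x - taa y) (tab x - tab y) (tbb x - tbb y) (tr x + tr y);
  tmul := fun x y =>
    let: Tm c a b aa ab bb r := x in let: Tm c' a' b' aa' ab' bb' r' := y in
    let n1 := Z.abs a + Z.abs b in
    let n2 := Z.abs aa + Z.abs ab + Z.abs bb in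
    let n1' := Z.abs a' + Z.abs b' in
    let n2' := Z.abs aa' + Z.abs ab' + Z.abs bb' in
    Tm (Z.shiftr (c * c') fp_prec)
       (Z.shiftr (c * a' + a * c') fp_prec)
       (Z.shiftr (c * b' + b * c') fp_prec)
       (Z.shiftr (c * aa' + a * a' + aa * c') fp_prec)
       (Z.shiftr (c * ab' + a * b' + b * a' + ab * c') fp_prec)
       (Z.shiftr (c * bb' + b * b' + bb * c') fp_prec)
       (Z.shiftr (n1 * n2' + n2 * (n1' + n2') + (Z.abs c + n1 + n2) * r'
                  + r * (Z.abs c' + n1' + n2' + r')) fp_prec + 7);
  tscale := fun k x => Tm (k * tc x) (k * ta x) (k * tb x)
    (k * taa x) (k * tab x) (k * tbb x) (Z.abs k * tr x);
  tcst := fun k => Tm (k * fp_unit) 0 0 0 0 0 0 |}.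

Definition tpos (x : tm) : bool :=
  Z.abs (ta x) + Z.abs (tb x) + Z.abs (taa x) + Z.abs (tab x) + Z.abs (tbb x)
    + tr x <? tc x.

(* Denominator [2 ^ 13] of the cell boundaries in the variable [lam / 5]. *)
Definition gbits : Z := 13.

(** One Horner step, multiplication of a truncated series in [t] by [(m + w * t) / 2 ^ 13]; [prev]
    is the coefficient one degree below. The product of [w] with the last coefficient exceeds the
    degree and is left to the remainder. *)
Fixpoint hstep (m w prev : Z) (l : seq Z) : seq Z :=
  if l is x :: l then Z.shiftr (m * x + w * prev) gbits :: hstep m w x l
  else [::].

(* Horner evaluation at [(m + w * t) / 2 ^ 13]: seven Taylor coefficients in
   [t] and a bound for the remainder. *)
Fixpoint horner_taylor (m w : Z) (l : seq (Z * Z)) : seq Z * Z :=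
  if l is x :: l then
    let: (s, r) := horner_taylor m w l in
    let: (c, e) := x in
    let s' := hstep m w 0 s in
    (c + head 0 s' :: behead s',
     Z.shiftr ((m + w) * r + w * Z.abs (last 0 s)) gbits + 8 + e)
  else (nseq 7 0, 0).

(** Three Taylor coefficients are kept, as a model in [t] alone; the four others join the remainder,
    together with the error [e] of the polynomial approximation. *)
Definition tm_of (e m w : Z) (l : seq (Z * Z)) : tm :=
  match horner_taylor m w l with
  | (a0 :: a1 :: a2 :: s, r) =>
      Tm a0 a1 0 a2 0 0 (foldr (fun x acc => Z.abs x + acc) (r + e) s)
  | (_, r) => Tm 0 0 0 0 0 0 r
  end.

End FixedPoint.

(** * The inequalities of one cell *)

Section CellProgram.
Local Open Scope Z_scope.
Context {A : Type} (o : tops A).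
Local Notation "x ⊕ y" := (tadd o x y) (at level 50, left associativity).
Local Notation "x ⊖ y" := (tsub o x y) (at level 50, left associativity).
Local Notation "x ⊗ y" := (tmul o x y) (at level 40, left associativity).
Local Notation "k ⋅ x" := (tscale o k x) (at level 39).

Record jet := Jet { jE : A; jEl : A; jEp : A; jS : A; jSl : A; jSp : A;
  jT : A; jTl : A; jTp : A; jP : A; jPl : A; jPp : A; jQ : A; jQl : A; jQp : A }.

Definition jet_of (f g : seq A) (p : A) : jet :=
  let z := tcst o 0 in
  let F := nth z f in let G := nth z g in
  let p8 := p ⊗ F 8%nat in
  let p11 := p ⊗ F 11%nat in
  Jet (F 0%nat ⊕ p ⊗ F 1%nat) (G 0%nat ⊕ p ⊗ G 1%nat) (F 1%nat)
      (F 2%nat ⊕ p ⊗ F 3%nat) (G 2%nat ⊕ p ⊗ G 3%nat) (F 3%nat)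
      (F 4%nat ⊕ p ⊗ F 5%nat) (G 4%nat ⊕ p ⊗ G 5%nat) (F 5%nat)
      (F 6%nat ⊕ p ⊗ (F 7%nat ⊕ p8)) (G 6%nat ⊕ p ⊗ (G 7%nat ⊕ p ⊗ G 8%nat))
      (F 7%nat ⊕ 2 ⋅ p8)
      (F 9%nat ⊕ p ⊗ (F 10%nat ⊕ p11)) (G 9%nat ⊕ p ⊗ (G 10%nat ⊕ p ⊗ G 11%nat))
      (F 10%nat ⊕ 2 ⋅ p11).

(* Bernstein coefficients of [q0 + q1 x + q2 x ^ 2] on [10, 30]. *)
Definition bern (q0 q1 q2 : A) : seq A :=
  [:: q0 ⊕ (10 ⋅ q1 ⊕ 100 ⋅ q2);
      q0 ⊕ (20 ⋅ q1 ⊕ 300 ⋅ q2);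
      q0 ⊕ (30 ⋅ q1 ⊕ 900 ⋅ q2)].

(* [El], [Sl], ... are derivatives in [lam / 5], and [k / 320] is the constant
   [rho] of the cell.  The last entry of the first list bounds the Frobenius norm
   of the inverse Jacobian by 100. *)
Definition cell_checks (j : jet) (c : A) (k : Z) : seq A :=
  let: Jet E El Ep Sv Sl Sp T Tl Tp P Pl Pp Q Ql Qp := j in
  let SSl := Sv ⊗ Sl in
  let SSp := Sv ⊗ Sp in
  let S2 := Sv ⊗ Sv in
  let X := P ⊗ E ⊖ S2 in
  let Xl := Pl ⊗ E ⊕ P ⊗ El ⊖ 2 ⋅ SSl in
  let Xp := Pp ⊗ E ⊕ P ⊗ Ep ⊖ 2 ⋅ SSp in
  let Y := Q ⊗ E ⊖ S2 in
  let Yl := Ql ⊗ E ⊕ Q ⊗ El ⊖ 2 ⋅ SSl in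
  let Yp := Qp ⊗ E ⊕ Q ⊗ Ep ⊖ 2 ⋅ SSp in
  let tl := Tl ⊗ Sv ⊖ T ⊗ Sl in
  let tp := Tp ⊗ Sv ⊖ T ⊗ Sp in
  let SE := Sv ⊗ E in
  let TE := T ⊗ E in
  let E2 := E ⊗ E in
  let cE2 := c ⊗ E2 in
  let wl0 := cE2 ⊗ tl in
  let wl1 := Xl ⊗ SE ⊖ X ⊗ (Sl ⊗ E ⊕ 2 ⋅ (Sv ⊗ El))
             ⊕ c ⊗ ((Tl ⊗ E ⊕ 2 ⋅ (T ⊗ El)) ⊗ Y ⊖ TE ⊗ Yl) in
  let wl2 := Xl ⊗ Y ⊖ X ⊗ Yl in
  let wp0 := cE2 ⊗ tp in
  let wp1 := Xp ⊗ SE ⊖ X ⊗ (Sp ⊗ E ⊕ 2 ⋅ (Sv ⊗ Ep))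
             ⊕ c ⊗ ((Tp ⊗ E ⊕ 2 ⋅ (T ⊗ Ep)) ⊗ Y ⊖ TE ⊗ Yp) in
  let wp2 := Xp ⊗ Y ⊖ X ⊗ Yp in
  let SE2 := SE ⊗ SE in
  let SEY := SE ⊗ Y in
  let Y2 := Y ⊗ Y in
  let i2 := El ⊗ tp ⊖ Ep ⊗ tl in
  let S4 := S2 ⊗ S2 in
  let cc := c ⊗ c in
  let ccE2 := cc ⊗ E2 in
  let z := 4 ⋅ (X ⊗ Sv ⊖ c ⊗ (T ⊗ Y)) in
  let u := 64 ⋅ El ⊖ k ⋅ Ep in
  let d := 64 ⋅ tl ⊖ k ⋅ tp in
  let lhs := 2 ⋅ ((102400 + k * k) ⋅ (S4 ⊗ E2) ⊕ 225 ⋅ (S4 ⊗ (u ⊗ u)))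
             ⊕ 36864 ⋅ (ccE2 ⊗ (tl ⊗ tl ⊕ 25 ⋅ (tp ⊗ tp))
                        ⊕ 225 ⋅ (cc ⊗ (i2 ⊗ i2))) in
  [:: 5 ⋅ E ⊖ tcst o 1; tcst o 7 ⊖ 12 ⋅ E; Ep; Sv; Sp; tp; Y; i2; d;
      SE2 ⊖ z; SE2 ⊕ z; 19974 ⋅ (ccE2 ⊗ (d ⊗ d)) ⊖ lhs]
  ++ bern (2 ⋅ wp0 ⊖ SE2) (2 ⋅ wp1 ⊖ 2 ⋅ SEY) (2 ⋅ wp2 ⊖ Y2)
  ++ bern (k ⋅ wp0 ⊖ 64 ⋅ wl0) (k ⋅ wp1 ⊖ 64 ⋅ wl1) (k ⋅ wp2 ⊖ 64 ⋅ wl2)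
  ++ bern (k ⋅ wp0 ⊕ 64 ⋅ wl0) (k ⋅ wp1 ⊕ 64 ⋅ wl1) (k ⋅ wp2 ⊕ 64 ⋅ wl2).

End CellProgram.

Section Certificate.
Local Open Scope Z_scope.

(* The polynomial of degree 14 in [z] whose derivative [5 y] satisfies
   [y' + 5 y = 5 tau T_13(2 z - 1)] and [y(0) = 1], rounded. *)
Definition pdata : seq Z :=
  [:: 0; 21990232555520; -54975581358792; 91625965550449; -114532362273661;
      114531112703584; -95433073385729; 68120238396460; -42423809601381;
      23224712347399; -11061842950533; 4409887026365; -1360227842554;
      281929896427; -28768356778].

(* [fp_unit] times the errors [18 * 15 / 2 ^ 30] and [18 * 615 / 2 ^ 30] of the
   polynomial approximations of values and slopes. *)
Definition verr : Z := 1105920.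
Definition derr : Z := 45342720.

(* The [j]-th of [n] equal subintervals of [0, 3 / 20]. *)
Definition psi_tm (j n : Z) : tm :=
  Tm (3 * fp_unit * (2 * j + 1) / (40 * n)) 0 (3 * fp_unit / (40 * n)) 0 0 0 2.
(** The enclosure [0.5865] with radius [0.0002] of [c2], at scale [2 ^ 42]. *)
Definition c_tm : tm := Tm 2579454278762 0 0 0 0 0 879609303.

Definition cell_ok (f g : seq tm) (n j k : Z) : bool :=
  all tpos (cell_checks tmops (jet_of tmops f g (psi_tm j n)) c_tm k).

Fixpoint row_check (f g : seq tm) (n j : Z) (ks : seq Z) : bool :=
  if ks is k :: ks then
    if cell_ok f g n j k then row_check f g n (j + 1) ks else false
  else true.

Fixpoint rows_check (cs ds : seq (seq (Z * Z))) (lo : Z) (rows : seq (Z * seq Z)) :=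
  if rows is (hi, ks) :: rows then
    let m := Z.shiftr (lo + hi) 1 in
    let w := m - lo in
    if row_check (map (tm_of verr m w) cs) (map (tm_of derr m w) ds)
         (Z.of_nat (size ks)) 0 ks
    then rows_check cs ds hi rows else false
  else true.

(** An entry is a strip of [lam / 5] ending at its first component over [2 ^ 13], the first strip
    starting at 1638, just below one fifth of [2 ^ 13]. The length of the list is the number of
    [psi] cells in the strip and its members are the values of [320 * rho]. *)
Definition grid : seq (Z * seq Z) :=
  [:: (1702, [:: 35; 41; 49; 52; 54; 57]);
      (1830, [:: 35; 42; 49; 53; 55; 58]);
      (1990, [:: 37; 47; 53; 57]); (2182, [:: 39; 52; 56]);
      (2502, [:: 40; 50; 55; 59]); (2822, [:: 39; 54]); (3270, [:: 40; 54]);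
      (3782, [:: 37; 46]); (4550, [:: 35; 42]); (5446, [:: 27; 30]);
      (6470, [:: 20; 22]); (7494, [:: 15; 15]); (8192, [:: 12; 11])].

(* The mean degree is at most 5 / 2 at (1, 5, 0) and at least 33 / 2 at
   (5, 15, 3 / 20). *)
Definition corner_check (cs : seq (seq (Z * Z))) : bool :=
  let F m k := tm_of verr m 1 (nth [::] cs k) in
  if tpos (tsub tmops (tcst tmops 1) (tscale tmops 4 (F 1638 0%nat))) then
    tpos (tsub tmops
      (tadd tmops (tscale tmops 400 (F 8191 0%nat)) (tscale tmops 60 (F 8191 1%nat)))
      (tcst tmops 220))
  else false.

Definition certificate : bool :=
  let cs := coefs iops (map (fun x => (x, 0)) pdata) in
  if corner_check cs then rows_check cs (map (pderiv iops) cs) 1638 grid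
  else false.

End Certificate.

Lemma certificateE : certificate = true.
Proof. by vm_cast_no_check (erefl true). Qed.

(** * Soundness of the certificate *)

Section ZtoR.
Context {R : realType}.
Implicit Types (x y z : Z).

(* Locked, so that no tactic computes a large image in unary notation. *)
Definition zr (z : Z) : R := locked (int_of_Z z)%:~R.

Lemma zrD x y : zr (Z.add x y) = zr x + zr y.
Proof. by rewrite /zr -!lock (rmorphD int_of_Z) intrD. Qed.
Lemma zrM x y : zr (Z.mul x y) = zr x * zr y.
Proof. by rewrite /zr -!lock (rmorphM int_of_Z) intrM. Qed.
Lemma zrN x : zr (Z.opp x) = - zr x.
Proof. by rewrite /zr -!lock (rmorphN int_of_Z) intrN. Qed.
Lemma zrB x y : zr (Z.sub x y) = zr x - zr y.
Proof. by rewrite -Z.add_opp_r zrD zrN. Qed.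
Lemma zr0 : zr Z0 = 0. Proof. by rewrite /zr -lock. Qed.
Lemma zr1 : zr (Zpos xH) = 1. Proof. by rewrite /zr -lock. Qed.
Lemma zr2 : zr (Zpos (xO xH)) = 2. Proof. by rewrite /zr -lock. Qed.
Lemma zr_xO p : zr (Zpos (xO p)) = 2 * zr (Zpos p).
Proof. by rewrite (Pos2Z.inj_xO p) zrM zr2. Qed.
Lemma zr_xI p : zr (Zpos (xI p)) = 2 * zr (Zpos p) + 1.
Proof. by rewrite (Pos2Z.inj_xI p) zrD zrM zr1 zr2. Qed.
Lemma zr_neg p : zr (Zneg p) = - zr (Zpos p).
Proof. by rewrite -zrN. Qed.

Lemma zr_ge0 x : Z.le Z0 x -> 0 <= zr x.
Proof. by case: x => [|p|p] // _; rewrite /zr -lock ler0z. Qed.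

Lemma ler_zr x y : Z.le x y -> zr x <= zr y.
Proof. by move=> xy; rewrite -subr_ge0 -zrB zr_ge0//; apply/Z.le_0_sub. Qed.

Lemma zr_gt0 x : Z.lt Z0 x -> 0 < zr x.
Proof.
move=> x0; apply: lt_le_trans ltr01 _; rewrite -zr1; apply: ler_zr.
exact: (proj2 (Z.le_succ_l Z0 x) x0).
Qed.

Lemma ltr_zr x y : Z.lt x y -> zr x < zr y.
Proof. by move=> xy; rewrite -subr_gt0 -zrB zr_gt0//; apply/Z.lt_0_sub. Qed.

Lemma zr_abs x : zr (Z.abs x) = `|zr x|.
Proof.
case: x => [|p|p] /=; first by rewrite zr0 normr0.
  by rewrite ger0_norm// zr_ge0.
by rewrite zr_neg normrN ger0_norm// zr_ge0.
Qed.

Lemma zr_div x y : Z.lt Z0 y ->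
  zr (Z.div x y) * zr y <= zr x < (zr (Z.div x y) + 1) * zr y.
Proof.
move=> y0; have := Z.div_mod x y; have [m0 my] := Z.mod_pos_bound x y y0.
move=> /(_ _); have yn0 : y <> Z0 by move=> y0'; rewrite y0' in y0.
move=> /(_ yn0) xE; rewrite {2 3}xE zrD zrM [zr y * _]mulrC mulrDl mul1r.
by rewrite lerDl ltrD2l zr_ge0//= ltr_zr.
Qed.

Lemma zr_pow2 (n : nat) : zr (Z.pow 2 (Z.of_nat n)) = 2 ^+ n.
Proof.
elim: n => [|n IH]; first by rewrite expr0 zr1.
by rewrite Nat2Z.inj_succ Z.pow_succ_r ?zrM ?zr2 ?IH ?exprS//; exact: Nat2Z.is_nonneg.
Qed.

Lemma zr_shiftr x n : Z.le Z0 n ->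
  zr (Z.shiftr x n) * zr (Z.pow 2 n) <= zr x
    < (zr (Z.shiftr x n) + 1) * zr (Z.pow 2 n).
Proof.
move=> n0; rewrite Z.shiftr_div_pow2//; apply: zr_div.
exact: Z.pow_pos_nonneg.
Qed.

End ZtoR.

Section IntervalSound.
Context {R : realType}.
Local Notation K := (zr fp_unit : R).

Lemma unit_gt0 : 0 < K. Proof. exact: zr_gt0. Qed.

Lemma shiftr_prec x : zr (Z.shiftr x fp_prec) <= (zr x : R) / K < zr (Z.shiftr x fp_prec) + 1.
Proof.
rewrite ler_pdivlMr ?unit_gt0// ltr_pdivrMr ?unit_gt0//.
exact: zr_shiftr.
Qed.

Definition rops : ops R := {|
  ozero := 0; oadd := +%R; omul := *%R;
  oscale := fun k x => zr k * x; ofrac := fun n d => zr n / zr d |}.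

Definition irel (x : R) (a : Z * Z) := `|x * K - zr a.1| <= zr a.2.

Lemma irel_zero : irel (ozero rops) (ozero iops).
Proof. by rewrite /irel /= mul0r zr0 subrr normr0. Qed.

Lemma irel_add x y a b : irel x a -> irel y b ->
  irel (oadd rops x y) (oadd iops a b).
Proof.
rewrite /irel /= !zrD mulrDl opprD addrACA => h1 h2.
by apply: le_trans (ler_normD _ _) _; exact: lerD.
Qed.

Lemma irel_scale k x a : irel x a -> irel (oscale rops k x) (oscale iops k a).
Proof.
rewrite /irel /= !zrM zr_abs -mulrA -mulrBr normrM => h.
exact: ler_wpM2l.
Qed.

Lemma irel_frac n d : Z.lt Z0 d -> irel (ofrac rops n d) (ofrac iops n d).
Proof.
move=> d0; rewrite /irel /=; have D0 : 0 < (zr d : R) by exact: zr_gt0.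
have /andP[] := @zr_div R (Z.mul n fp_unit) d d0.
rewrite zrM -ler_pdivlMr// -ltr_pdivrMr// => h1 h2.
rewrite zr1 [X in `|X - _|]mulrAC ger0_norm ?subr_ge0//.
by rewrite lerBlDl ltW// addrC.
Qed.

Lemma irel_mul x y a b : irel x a -> irel y b ->
  irel (omul rops x y) (omul iops a b).
Proof.
case: a b => [a r] [b s] h1 h2.
have {}h1 : `|x * K - zr a| <= zr r by exact: h1.
have {}h2 : `|y * K - zr b| <= zr s by exact: h2.
have K0 := unit_gt0.
change (`|x * y * K - zr (Z.shiftr (Z.mul a b) fp_prec)| <=
  zr (Z.add (Z.shiftr (Z.add (Z.mul (Z.abs a) s)
    (Z.mul r (Z.add (Z.abs b) s))) fp_prec) (Zpos (xO xH)))).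
have := shiftr_prec (Z.mul a b).
have := shiftr_prec (Z.add (Z.mul (Z.abs a) s) (Z.mul r (Z.add (Z.abs b) s))).
set u := Z.shiftr _ _; set v := Z.shiftr _ _.
rewrite !(zrD, zrM, zr_abs) => /andP[u1 u2] /andP[v1 v2].
have -> : x * y * K = (x * K) * (y * K) / K.
  by rewrite mulrACA [_ * (K * K)]mulrA mulfK// gt_eqF.
have -> : (x * K) * (y * K) / K = zr a * zr b / K +
  (zr a * (y * K - zr b) + (x * K - zr a) * (y * K)) / K.
  by rewrite -mulrDl; congr (_ / _); ring.
have e1 : `|(zr a * (y * K - zr b) + (x * K - zr a) * (y * K)) / K| <=
    (`|zr a| * zr s + zr r * (`|zr b| + zr s)) / K.
  have Ki : 0 < K^-1 by rewrite invr_gt0.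
  rewrite normrM [`|K^-1|](gtr0_norm Ki) (ler_pM2r Ki).
  apply: le_trans (ler_normD _ _) _; apply: lerD.
    by rewrite normrM; exact: ler_wpM2l.
  rewrite normrM; apply: ler_pM => //.
  have -> : y * K = zr b + (y * K - zr b) by ring.
  by apply: le_trans (ler_normD _ _) _; rewrite lerD2l.
rewrite zr2; move: u1 u2 v1 v2 e1.
move: (_ / K) (_ / K) (_ / K) => p q e u1 u2 v1 v2.
by rewrite !ler_norml => /andP[e1 e2]; apply/andP; split; lra.
Qed.

End IntervalSound.

(** * Relational parametricity of the coefficient program *)

Section ProgramParametricity.
Context {A B : Type} (o : ops A) (o' : ops B) (r : A -> B -> Prop).
Hypothesis r0 : r (ozero o) (ozero o').
Hypothesis rD : forall x y a b, r x a -> r y b -> r (oadd o x y) (oadd o' a b).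
Hypothesis rM : forall x y a b, r x a -> r y b -> r (omul o x y) (omul o' a b).
Hypothesis rZ : forall k x a, r x a -> r (oscale o k x) (oscale o' k a).
Hypothesis rF : forall n d, Z.lt Z0 d -> r (ofrac o n d) (ofrac o' n d).

Local Notation rl := (List.Forall2 r).

Lemma rl_zipw u v u' v' : rl u u' -> rl v v' ->
  rl (wgt o u v) (wgt o' u' v').
Proof.
rewrite /wgt; move=> h; elim: h v v' => [|x a u0 u0' xa _ IH] v v'.
  by move=> _; constructor.
case=> [|y b v0 v0' yb hv] /=; first by constructor.
by constructor; [exact: rM|exact: IH].
Qed.

Lemma rl_padd u v u' v' : rl u u' -> rl v v' -> rl (padd o u v) (padd o' u' v').
Proof.
move=> h; elim: h v v' => [|x a u0 u0' xa h IH] v v' //=.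
case=> [|y b v0 v0' yb hv] /=; first by constructor.
by constructor; [exact: rD|exact: IH].
Qed.

Lemma rl_pscal x a u u' : r x a -> rl u u' -> rl (pscal o x u) (pscal o' a u').
Proof.
by move=> xa; elim=> [|y b v v' yb h IH] /=; constructor => //; exact: rM.
Qed.

Lemma rl_pzscal k u u' : rl u u' -> rl (pzscal o k u) (pzscal o' k u').
Proof. by elim=> [|y b v v' yb h IH] /=; constructor => //; exact: rZ. Qed.

Lemma rl_pmul u v u' v' : rl u u' -> rl v v' -> rl (pmul o u v) (pmul o' u' v').
Proof.
move=> h hv; elim: h => [|x a u0 u0' xa h IH] /=; first by constructor.
by apply: rl_padd; [exact: rl_pscal|constructor].
Qed.

Lemma rl_behead u u' : rl u u' -> rl (behead u) (behead u').
Proof. by case. Qed.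

Lemma rl_pquad c u w c' u' w' : rl c c' -> rl u u' -> rl w w' ->
  rl (pquad o c u w) (pquad o' c' u' w').
Proof.
move=> hc h; elim: h w w' => [|x a u0 u0' xa h IH] w w' hw /=; first by constructor.
apply: rl_padd; first by apply: rl_pscal => //; exact: rl_zipw.
by constructor => //; apply: IH; exact: rl_behead.
Qed.

Lemma rl_moms n k : Z.le Z0 k -> rl (moms o n k) (moms o' n k).
Proof.
elim: n k => [|n IH] k k0 /=; constructor.
  by apply: rF; apply: Z.add_nonneg_pos.
by apply: IH; apply: Z.add_nonneg_nonneg.
Qed.

Lemma rl_bmoms n k : Z.le Z0 k -> rl (bmoms o n k) (bmoms o' n k).
Proof.
elim: n k => [|n IH] k k0 /=; constructor.
  by apply: rF; apply: Z.mul_pos_pos; apply: Z.add_nonneg_pos.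
by apply: IH; apply: Z.add_nonneg_nonneg.
Qed.

Lemma rl_isum f f' p p' m m' b b' :
  (forall m m' b b', rl m m' -> rl b b' -> rl (f m b) (f' m' b')) ->
  rl p p' -> rl m m' -> rl b b' -> rl (isum o f p m b) (isum o' f' p' m' b').
Proof.
move=> hf h; elim: h m m' b b' => [|x a u0 u0' xa h IH] m m' b b' hm hb /=.
  by constructor.
apply: rl_padd; first by apply: rl_pscal => //; exact: hf.
by constructor => //; apply: IH; exact: rl_behead.
Qed.

Lemma rl_coefs p p' : rl p p' -> List.Forall2 rl (coefs o p) (coefs o' p').
Proof.
move=> hp; rewrite /coefs; cbv zeta.
have := rl_moms 60 (Z.le_refl Z0); have := rl_bmoms 60 (Z.le_refl Z0).
move: (bmoms o 60 _) (bmoms o' 60 _) (moms o 60 _) (moms o' 60 _).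
move=> b b' m m' hb hm.
have h0 := rl_zipw hp hm; have h1 := rl_zipw hp hb.
move: h0 h1; move: (wgt o p m) (wgt o' p' m') (wgt o p b) (wgt o' p' b').
move=> h0 h0' h1 h1' hh0 hh1.
repeat first [apply: List.Forall2_cons | apply: List.Forall2_nil].
- exact: rl_zipw.
- by apply: rl_pzscal; exact: rl_zipw.
- by apply: rl_zipw => //; exact: rl_pmul.
- by apply: rl_padd; apply: rl_pzscal; apply: rl_zipw => //; exact: rl_pmul.
- by apply: rl_isum => // *; apply: rl_pquad => //; exact: rl_zipw.
- by apply: rl_pzscal; apply: rl_isum => // *; apply: rl_pquad => //; exact: rl_zipw.
- by apply: rl_isum => // *; apply: rl_pmul; exact: rl_zipw.
- apply: rl_pzscal; apply: rl_isum => // *; apply: rl_padd.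
    by apply: rl_pmul; apply: rl_padd; exact: rl_zipw.
  by apply: rl_pzscal; apply: rl_pmul; exact: rl_zipw.
- apply: rl_pscal; [exact: rF|]; apply: rl_isum => // *; apply: rl_pmul; exact: rl_zipw.
- by apply: rl_zipw => //; do 2 apply: rl_pmul => //.
- by apply: rl_padd; apply: rl_pzscal; apply: rl_zipw => //; do 2 apply: rl_pmul => //.
- apply: rl_pscal; [exact: rF|]; apply: rl_zipw => //; do 2 apply: rl_pmul => //.
Qed.

Lemma rl_pderiv u u' : rl u u' -> rl (pderiv o u) (pderiv o' u').
Proof.
rewrite /pderiv => /rl_behead h; move: (Zpos xH) => k.
by elim: h k => [|x a v v' xa h IH] k /=; constructor; [exact: rZ|exact: IH].
Qed.

End ProgramParametricity.

Local Arguments Poly : simpl never.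


(** * The coefficient program over the reals *)

Section RealProgram.
Context {R : realType}.
Local Notation o := (@rops R).
Implicit Types (u v w c p m b : seq R) (g : bool).

Lemma Poly_cons (x : R) u : Poly (x :: u) = Poly u * 'X + x%:P.
Proof. by rewrite -cons_poly_def. Qed.

Lemma nth_padd u v k : (padd o u v)`_k = u`_k + v`_k.
Proof.
elim: u v k => [|x u IH] [|y v] [|k] /=; rewrite ?add0r ?addr0//; exact: IH.
Qed.

Lemma Poly_padd u v : Poly (padd o u v) = Poly u + Poly v.
Proof. by apply/polyP => k; rewrite coefD !coef_Poly nth_padd. Qed.

Lemma Poly_pscal x u : Poly (pscal o x u) = x *: Poly u.
Proof.
elim: u => [|y u IH]; first by rewrite scaler0.
by rewrite /= !Poly_cons IH scalerDr -scalerAl scale_polyC.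
Qed.

Lemma Poly_pzscal k u : Poly (pzscal o k u) = zr k *: Poly u.
Proof. exact: (Poly_pscal (zr k)). Qed.

Lemma Poly_pmul u v : Poly (pmul o u v) = Poly u * Poly v.
Proof.
elim: u => [|x u IH]; first by rewrite mul0r.
rewrite /= Poly_padd Poly_pscal !Poly_cons IH polyC0 addr0.
by rewrite mulrDl -mul_polyC addrC mulrAC.
Qed.

Lemma nth_wgt c w k : (wgt o c w)`_k = c`_k * w`_k.
Proof.
elim: c w k => [|x c IH] [|y w] [|k] /=; rewrite ?mul0r ?mulr0//; exact: IH.
Qed.

Lemma size_wgt c w : (size (wgt o c w) <= size c)%N.
Proof. by elim: c w => [|x c IH] [|y w] //=; rewrite ltnS; exact: IH. Qed.

Lemma size_padd u v : size (padd o u v) = maxn (size u) (size v).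
Proof.
by elim: u v => [|x u IH] [|y v] //=; rewrite ?max0n ?maxn0// IH maxnSS.
Qed.

Lemma size_pmul u v : (size (pmul o u v) <= size u + size v)%N.
Proof.
elim: u => [|x u IH] //=; rewrite size_padd geq_max size_map leq_addl /=.
by rewrite addSn ltnS.
Qed.

(** The computed moment lists are finite and are shifted by [isum]; this keeps track of how many
    entries are still correct after a shift by [i]. *)
Definition momlike g i n w := forall k, (k < n)%N -> w`_k = wt g (i + k).

Lemma momlike_drop g i n w : (i <= n)%N ->
  momlike g 0 n w -> momlike g i (n - i) (drop i w).
Proof. by move=> ik h k kn; rewrite nth_drop h// -ltn_subRL. Qed.

Lemma zr_nat n : zr (Z.of_nat n) = n%:R :> R.
Proof.
elim: n => [|n IH]; first by rewrite zr0.
by rewrite Nat2Z.inj_succ -Z.add_1_r zrD zr1 IH natr1.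
Qed.

Lemma momlike_moms n i : momlike false i n (moms o n (Z.of_nat i)).
Proof.
elim: n i => [//|n IH] i [|k] kn.
  change (zr (Zpos xH) / zr (Z.add (Z.of_nat i) (Zpos xH)) = wt false (i + 0) :> R).
  by rewrite Z.add_1_r -Nat2Z.inj_succ zr_nat zr1 addn0 /wt !div1r.
change ((moms o n (Z.add (Z.of_nat i) (Zpos xH)))`_k = wt false (i + k.+1)).
by rewrite Z.add_1_r -Nat2Z.inj_succ IH ?addSnnS.
Qed.

Lemma momlike_bmoms n i : momlike true i n (bmoms o n (Z.of_nat i)).
Proof.
elim: n i => [//|n IH] i [|k] kn.
  change (zr (Z.of_nat i) / zr (Z.mul (Z.add (Z.of_nat i) (Zpos xH))
    (Z.add (Z.of_nat i) (Zpos (xO xH)))) = wt true (i + 0) :> R).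
  by rewrite zrM !zrD zr_nat zr1 zr2 natr1 -natrD addn2 addn0 /wt.
change ((bmoms o n (Z.add (Z.of_nat i) (Zpos xH)))`_k = wt true (i + k.+1)).
by rewrite Z.add_1_r -Nat2Z.inj_succ IH ?addSnnS.
Qed.

Lemma Poly_wgt g i n c w : momlike g i n w -> (size c <= n)%N ->
  Poly (wgt o c w) = wpoly g i (Poly c).
Proof.
move=> h cn; apply/polyP => k; rewrite coef_Poly nth_wgt coef_poly coef_Poly.
case: ltnP => [ks|sk].
  by rewrite h// (leq_trans ks)// (leq_trans (size_Poly _)).
have -> : c`_k = (Poly c)`_k by rewrite coef_Poly.
by rewrite nth_default// mul0r.
Qed.

Lemma Poly_isum f p m b : Poly (isum o f p m b) =
  \sum_(i < size p) p`_i *: 'X^i * Poly (f (drop i m) (drop i b)).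
Proof.
elim: p m b => [|x p IH] m b; first by rewrite big_ord0.
rewrite /= Poly_padd Poly_pscal Poly_cons IH polyC0 addr0 big_ord_recl.
rewrite expr0 !drop0 alg_polyC mul_polyC; congr (_ + _).
rewrite mulr_suml; apply: eq_bigr => i _; rewrite /= /bump /= add1n exprSr.
by rewrite -!drop1 !drop_drop addn1 -!scalerAl mulrAC.
Qed.

Lemma Poly_pquad c u w : Poly (pquad o c u w) =
  \sum_(j < size u) u`_j *: 'X^j * Poly (wgt o c (drop j w)).
Proof.
elim: u w => [|x u IH] w; first by rewrite big_ord0.
rewrite /= Poly_padd Poly_pscal Poly_cons IH polyC0 addr0 big_ord_recl.
rewrite expr0 !drop0 alg_polyC mul_polyC; congr (_ + _).
rewrite mulr_suml; apply: eq_bigr => i _; rewrite /= /bump /= add1n exprSr.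
by rewrite -!drop1 !drop_drop addn1 -!scalerAl mulrAC.
Qed.

(** [Poly p] loses the trailing zeros of the list [p], so sums over the size of the polynomial and
    over the length of the list have to be compared. *)
Lemma sum_ord_widen (V : nmodType) (F : nat -> V) n n' : (n <= n')%N ->
  (forall i, (n <= i)%N -> F i = 0) -> \sum_(i < n) F i = \sum_(i < n') F i.
Proof.
move=> nn F0; rewrite (big_ord_widen _ _ nn) [RHS](bigID (fun i : 'I_n' => (i < n)%N)) /=.
by rewrite [X in _ + X]big1 ?addr0// => i; rewrite -leqNgt => /F0.
Qed.

Lemma triangleP_swap12 (q : {poly R}) g1 g2 g3 :
  triangleP q g1 g2 g3 = triangleP q g2 g1 g3.
Proof.
rewrite /triangleP; apply: eq_bigr => i _; rewrite exchange_big /=.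
apply: eq_bigr => j _; apply: eq_bigr => k _.
by rewrite addnAC [(k + j)%N]addnC; congr (_ *: _); ring.
Qed.

Lemma triangleP_swap23 (q : {poly R}) g1 g2 g3 :
  triangleP q g1 g2 g3 = triangleP q g1 g3 g2.
Proof.
rewrite /triangleP exchange_big /=.
apply: eq_bigr => i _; apply: eq_bigr => j _; apply: eq_bigr => k _.
by rewrite [(j + i)%N]addnC; congr (_ *: _); ring.
Qed.

Lemma Poly_sum u n : (size u <= n)%N -> Poly u = \sum_(k < n) u`_k *: 'X^k.
Proof.
move=> un; rewrite -(sum_ord_widen (F := fun k => u`_k *: 'X^k) un); last first.
  by move=> k uk; rewrite nth_default// scale0r.
by rewrite -poly_def; apply/polyP => k; rewrite coef_Poly coef_poly; case: ltnP => // uk;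
  rewrite nth_default.
Qed.

(** The largest moment index is a sum of two exponents, each below [size p]; this is the reason for
    [2 * size p <= n]. *)
Lemma triangleP_list g p w m n : momlike g 0 n w -> momlike false 0 n m ->
  (2 * size p <= n)%N ->
  \sum_(i < size p) p`_i *: 'X^i *
     Poly (pquad o (wgt o p (drop i w)) (wgt o p (drop i w)) m) =
  triangleP (Poly p) g g false.
Proof.
move=> hw hm pn; rewrite /triangleP.
set q := Poly p.
pose G i j k : {poly R} := (q`_i * q`_j * q`_k *
  (wt g (i + j) * wt g (i + k) * wt false (j + k))) *: 'X^(i + j + k).
transitivity (\sum_(i < size p) \sum_(j < size p) \sum_(k < size p) G i j k); last first.
  have sq : (size q <= size p)%N by exact: size_Poly.
  have z i : (size q <= i)%N -> q`_i = 0 by move=> h; rewrite nth_default.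
  rewrite -(sum_ord_widen (F := fun i => \sum_(j < size p) \sum_(k < size p) G i j k) sq);
    last first.
    by move=> i /z q0; apply: big1 => j _; apply: big1 => k _; rewrite /G q0 !mul0r scale0r.
  apply: eq_bigr => i _.
  rewrite -(sum_ord_widen (F := fun j => \sum_(k < size p) G i j k) sq); last first.
    by move=> j /z q0; apply: big1 => k _; rewrite /G q0 mulr0 !mul0r scale0r.
  apply: eq_bigr => j _; rewrite -(sum_ord_widen (F := G i j) sq)//.
  by move=> k /z q0; rewrite /G q0 mulr0 !mul0r scale0r.
apply: eq_bigr => i _; rewrite Poly_pquad.
have in' : (i < n)%N by rewrite (leq_trans (ltn_ord i))// (leq_trans _ pn)// leq_pmull.
have spi : (size p <= n - i)%N.
  rewrite leq_subRL ?(ltnW in')//; apply: leq_trans pn.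
  by rewrite mul2n -addnn leq_add2r ltnW.
set u := wgt o p (drop i w).
have su : (size u <= size p)%N by exact: size_wgt.
have uE j : (j < size p)%N -> u`_j = q`_j * wt g (i + j).
  move=> jp; rewrite nth_wgt nth_drop hw ?coef_Poly// -ltn_subRL.
  exact: leq_trans jp spi.
rewrite (sum_ord_widen (F := fun j => u`_j *: 'X^j * Poly (wgt o u (drop j m))) su);
  last by move=> j uj; rewrite nth_default// scale0r mul0r.
rewrite mulr_sumr; apply: eq_bigr => j _.
rewrite (Poly_sum (leq_trans (size_wgt u _) su)) !mulr_sumr; apply: eq_bigr => k _.
have jkn : (j + k < n)%N.
  by rewrite (leq_trans _ pn)// mul2n -addnn -addSn leq_add// ltnW.
rewrite nth_wgt nth_drop (hm _ jkn) add0n !uE// /G -!mul_polyC !polyCM !exprD.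
by rewrite /q !coef_Poly; ring.
Qed.

Lemma Poly_isum_path f p m b (q : nat -> {poly R}) :
  (forall i, (i < size p)%N -> Poly (f (drop i m) (drop i b)) = q i) ->
  Poly (isum o f p m b) =
    \sum_(i < size (Poly p)) (Poly p)`_i *: 'X^i * q i.
Proof.
move=> fq; rewrite Poly_isum.
rewrite (sum_ord_widen (F := fun i => (Poly p)`_i *: 'X^i * q i) (size_Poly p));
  last by move=> i pi; rewrite nth_default// scale0r mul0r.
by apply: eq_bigr => i _; rewrite fq// coef_Poly.
Qed.

(** A product of three lists of length at most 15 has length at most 45, and a shift by less than 15
    leaves more than 30 valid moments for products of two: 60 moments are enough. The rest is the
    count of equivalent pairs of harmonics. *)
Lemma Poly_coefs p : (size p <= 15)%N ->
  map (@Poly R) (coefs o p) = motif_polys (Poly p).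
Proof.
move=> p15; rewrite /coefs; cbv zeta.
have hm : momlike false 0 60 (moms o 60 Z0) := @momlike_moms 60 0.
have hb : momlike true 0 60 (bmoms o 60 Z0) := @momlike_bmoms 60 0.
(* From here on only the moment property of the two lists is used; they are generalized so that they
   are never computed. *)
move: (moms o 60 Z0) (bmoms o 60 Z0) hm hb => m b hm hb.
have W0 c : (size c <= 60)%N -> Poly (wgt o c m) = wpoly false 0 (Poly c).
  exact: Poly_wgt.
have W1 c : (size c <= 60)%N -> Poly (wgt o c b) = wpoly true 0 (Poly c).
  exact: Poly_wgt.
have le15 c : (size c <= 15)%N -> (size c <= 60)%N by move=> h; exact: leq_trans h _.
have drop60 i c : (i < size p)%N -> (size c <= 15)%N -> (size c <= 60 - i)%N.
  move=> ip c15; rewrite leq_subRL; last by rewrite ltnW// (leq_trans ip)// le15.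
  by apply: (@leq_trans (15 + 15)%N) => //; rewrite leq_add// ltnW// (leq_trans ip).
have D0 i c : (i < size p)%N -> (size c <= 15)%N ->
    Poly (wgt o c (drop i m)) = wpoly false i (Poly c).
  move=> ip c15; apply: (@Poly_wgt _ _ (60 - i)); last exact: drop60.
  by apply: momlike_drop => //; rewrite ltnW// (leq_trans ip)// le15.
have D1 i c : (i < size p)%N -> (size c <= 15)%N ->
    Poly (wgt o c (drop i b)) = wpoly true i (Poly c).
  move=> ip c15; apply: (@Poly_wgt _ _ (60 - i)); last exact: drop60.
  by apply: momlike_drop => //; rewrite ltnW// (leq_trans ip)// le15.
have p60 : (2 * size p <= 60)%N.
  by apply: (@leq_trans (2 * 15)%N) => //; rewrite leq_mul2l.
have s0 : (size (wgt o p m) <= 15)%N by exact: leq_trans (size_wgt _ _) _.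
have s1 : (size (wgt o p b) <= 15)%N by exact: leq_trans (size_wgt _ _) _.
have E0 := W0 _ (le15 _ p15); have E1 := W1 _ (le15 _ p15).
have S (u v : seq R) k l : (size u <= k)%N -> (size v <= l)%N ->
    (size (pmul o u v) <= k + l)%N.
  by move=> uk vl; apply: leq_trans (size_pmul _ _) _; exact: leq_add.
set h0 := wgt o p m in E0 s0 *; set h1 := wgt o p b in E1 s1 *.
have s00 := S _ _ _ _ s0 s0; have s01 := S _ _ _ _ s0 s1.
have s11 := S _ _ _ _ s1 s1.
have le30 c : (size c <= 15 + 15)%N -> (size c <= 60)%N.
  by move=> h; exact: leq_trans h _.
have le45 c : (size c <= 15 + 15 + 15)%N -> (size c <= 60)%N.
  by move=> h; exact: leq_trans h _.
have z2 : zr (Zpos 2) = 2 :> R by exact: zr2.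
have z3 : zr (Zpos 3) = 3 :> R by rewrite zr_xI zr1; ring.
have z6 : zr (Zpos 6) = 6 :> R by rewrite zr_xO z3; ring.
have z9 : zr (Zpos 9) = 9 :> R by rewrite zr_xI zr_xO zr2; ring.
have z27 : zr (Zpos 27) / zr (Zpos 2) = 27 / 2 :> R.
  by rewrite z2; congr (_ / _); rewrite !(zr_xI, zr_xO) zr1; ring.
rewrite /motif_polys /=; congr [:: _; _; _; _; _; _; _; _; _; _; _; _].
- by rewrite W0 ?le15// E0.
- by rewrite Poly_pzscal z3 W1 ?le15// E1.
- by rewrite W0 ?le30// Poly_pmul E0.
- rewrite Poly_padd !Poly_pzscal z3 z6 W1 ?le30// W0 ?le30// !Poly_pmul E0 E1.
  rewrite /wedgeP [wpoly true 0 (Poly p) * wpoly false 0 (Poly p)]mulrC.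
  by rewrite -!mul_polyC; ring.
- rewrite Poly_isum -(triangleP_list hm hm p60).
  by apply: eq_bigr.
- rewrite Poly_pzscal z9 Poly_isum (triangleP_list hb hm p60).
  rewrite [triangleP _ true false true]triangleP_swap23.
  rewrite [triangleP _ false true true]triangleP_swap12.
  rewrite [triangleP _ true false true]triangleP_swap23.
  by rewrite -!mul_polyC; ring.
- rewrite (@Poly_isum_path _ _ _ _ (fun i => wpoly false i (wpoly false 0 (Poly p)) *
    wpoly false i (wpoly false 0 (Poly p))))// => i ip.
  by rewrite Poly_pmul D0// E0.
- rewrite Poly_pzscal z3 (@Poly_isum_path _ _ _ _ (fun i =>
    (wpoly true i (wpoly false 0 (Poly p)) + wpoly false i (wpoly true 0 (Poly p))) ^+ 2
    + 2 * (wpoly false i (wpoly false 0 (Poly p)) * wpoly true i (wpoly true 0 (Poly p))))).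
    rewrite /pathP -!big_split /=; congr (_ *: _); apply: eq_bigr => i _; ring.
  move=> i ip; rewrite Poly_padd Poly_pzscal !Poly_pmul Poly_padd !D0// !D1// E0 E1.
  by rewrite z2 -mul_polyC polyC_natr; ring.
- rewrite Poly_pscal /= z27; congr (_ *: _).
  rewrite (@Poly_isum_path _ _ _ _ (fun i => wpoly true i (wpoly true 0 (Poly p)) *
    wpoly true i (wpoly true 0 (Poly p))))// => i ip.
  by rewrite Poly_pmul D1// E1.
- by rewrite W0 ?le45 ?S// !Poly_pmul E0.
- rewrite Poly_padd !Poly_pzscal z9 W1 ?le45 ?S// W0 ?le45 ?S// !Poly_pmul E0 E1.
  rewrite /starP; set x := wpoly false 0 (Poly p); set y := wpoly true 0 (Poly p).
  have -> : y * x * x = x * x * y by ring.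
  have -> : x * y * x = x * x * y by ring.
  have -> : y * y * x = x * y * y by ring.
  have -> : y * x * y = x * y * y by ring.
  by rewrite -!mul_polyC; ring.
- by rewrite Poly_pscal /= z27 W1 ?le45 ?S// !Poly_pmul E1.
Qed.

Lemma Poly_pderiv u : Poly (pderiv o u) = (Poly u)^`().
Proof.
have nthd v k j : (pderiv_from o (Z.of_nat k) v)`_j = v`_j *+ (k + j).
  elim: v k j => [|x v IH] k [|j] //=; rewrite ?mul0rn//.
    by rewrite zr_nat addn0 mulr_natl.
  by rewrite Z.add_1_r -Nat2Z.inj_succ IH addSnnS.
apply/polyP => k; rewrite coef_Poly coef_deriv coef_Poly.
by rewrite /pderiv (nthd _ 1%N) add1n nth_behead.
Qed.

End RealProgram.

(** * Relational parametricity of the cell program *)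

Section CellParametricity.
Context {A B : Type} (o : tops A) (o' : tops B) (r : A -> B -> Prop).
Hypothesis rD : forall x y a b, r x a -> r y b -> r (tadd o x y) (tadd o' a b).
Hypothesis rB : forall x y a b, r x a -> r y b -> r (tsub o x y) (tsub o' a b).
Hypothesis rM : forall x y a b, r x a -> r y b -> r (tmul o x y) (tmul o' a b).
Hypothesis rZ : forall k x a, r x a -> r (tscale o k x) (tscale o' k a).
Hypothesis rC : forall k, r (tcst o k) (tcst o' k).

Local Notation rl := (List.Forall2 r).

(** Passes through a [let] without substituting it, so that a shared intermediate value is related
    only once. *)
Lemma let_rel (P : seq A -> seq B -> Prop) a b f g :
  r a b -> (forall x y, r x y -> P (f x) (g y)) -> P (f a) (g b).
Proof. by move=> ab; exact. Qed.

Ltac rel := repeat first [assumption | apply: rD | apply: rB | apply: rM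
  | apply: rZ | apply: rC].

Ltac step := lazymatch goal with
  |- List.Forall2 r (let x := ?a in @?f x) (let y := ?b in @?g y) =>
    refine (@let_rel (List.Forall2 r) a b f g _ _); [rel|intros ? ? ?]; cbv beta
  end.

Lemma rl_nth u v k x y : r x y -> rl u v -> r (nth x u k) (nth y v k).
Proof.
move=> xy h; elim: h k => [|a b u' v' ab h IH] [|k] //=; exact: IH.
Qed.

Inductive jrel : @jet A -> @jet B -> Prop :=
  JRel E El Ep S Sl Sp T Tl Tp P Pl Pp Q Ql Qp E' El' Ep' S' Sl' Sp' T' Tl' Tp'
    P' Pl' Pp' Q' Ql' Qp' of r E E' & r El El' & r Ep Ep' & r S S' & r Sl Sl'
    & r Sp Sp' & r T T' & r Tl Tl' & r Tp Tp' & r P P' & r Pl Pl' & r Pp Pp'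
    & r Q Q' & r Ql Ql' & r Qp Qp' :
  jrel (Jet E El Ep S Sl Sp T Tl Tp P Pl Pp Q Ql Qp)
    (Jet E' El' Ep' S' Sl' Sp' T' Tl' Tp' P' Pl' Pp' Q' Ql' Qp').

Lemma jrel_jet_of f g p f' g' p' : rl f f' -> rl g g' -> r p p' ->
  jrel (jet_of o f g p) (jet_of o' f' g' p').
Proof.
move=> hf hg hp; rewrite /jet_of; cbv zeta.
have F k := rl_nth k (rC Z0) hf.
have G k := rl_nth k (rC Z0) hg.
by constructor; repeat first [assumption | apply: rD | apply: rM | apply: rZ].
Qed.

Lemma rl_bern q0 q1 q2 q0' q1' q2' : r q0 q0' -> r q1 q1' -> r q2 q2' ->
  rl (bern o q0 q1 q2) (bern o' q0' q1' q2').
Proof. by move=> h0 h1 h2; rewrite /bern; repeat constructor; rel. Qed.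

Lemma rl_cat u v u' v' : rl u u' -> rl v v' -> rl (u ++ v) (u' ++ v').
Proof. by move=> h hv; elim: h => //= *; constructor. Qed.

Lemma rl_cell_checks j c k j' c' : jrel j j' -> r c c' ->
  rl (cell_checks o j c k) (cell_checks o' j' c' k).
Proof.
case=> *; rewrite /cell_checks; do 43 try step.
apply: rl_cat; first by repeat constructor; rel.
by apply: rl_cat; [|apply: rl_cat]; apply: rl_bern; rel.
Qed.

End CellParametricity.

(** * Soundness of Taylor model arithmetic *)

Section TaylorModelSound.
Context {R : realType}.
Local Notation K := (zr fp_unit : R).
Variables (t s : R).
Hypotheses (t1 : `|t| <= 1) (s1 : `|s| <= 1).

Definition rtops : tops R := {|
  tadd := +%R; tsub := fun x y => x - y; tmul := *%R;
  tscale := fun k x => zr k * x; tcst := fun k => zr k |}.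

Definition tmain (a : tm) : R := zr (tc a) + zr (ta a) * t + zr (tb a) * s
  + zr (taa a) * (t * t) + zr (tab a) * (t * s) + zr (tbb a) * (s * s).

(** [t] and [s] locate one fixed point of the cell, so a model is related to a real number and not
    to a function. *)
Definition trel (y : R) (a : tm) := `|y * K - tmain a| <= zr (tr a).

Lemma trel_cst k : trel (tcst rtops k) (tcst tmops k).
Proof.
rewrite /trel /tmain; change (tc (tcst tmops k)) with (Z.mul k fp_unit) => /=.
by rewrite !zr0 zrM !mul0r !addr0 subrr normr0.
Qed.

Lemma trel_add x y a b : trel x a -> trel y b ->
  trel (tadd rtops x y) (tadd tmops a b).
Proof.
rewrite /trel /tmain /= !zrD => h1 h2; apply: le_trans (lerD h1 h2).
apply: le_trans (ler_normD _ _); rewrite le_eqVlt; apply/orP; left; apply/eqP.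
by congr `|_|; ring.
Qed.

Lemma trel_sub x y a b : trel x a -> trel y b ->
  trel (tsub rtops x y) (tsub tmops a b).
Proof.
rewrite /trel /tmain /= !(zrD, zrB, zrN) => h1; rewrite -normrN => h2.
apply: le_trans (lerD h1 h2).
apply: le_trans (ler_normD _ _); rewrite le_eqVlt; apply/orP; left; apply/eqP.
by congr `|_|; ring.
Qed.

Lemma trel_scale k x a : trel x a -> trel (tscale rtops k x) (tscale tmops k a).
Proof.
rewrite /trel /tmain /= !zrM zr_abs => h.
apply: le_trans (ler_wpM2l (normr_ge0 (zr k)) h); rewrite -normrM.
by rewrite le_eqVlt; apply/orP; left; apply/eqP; congr `|_|; ring.
Qed.

Lemma normM_le1 (x y : R) : `|x| <= 1 -> `|y| <= 1 -> `|x * y| <= 1.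
Proof. by move=> *; rewrite normrM -[1]mulr1; apply: ler_pM. Qed.

Lemma normM_le (x y b : R) : `|x| <= b -> `|y| <= 1 -> `|x * y| <= b.
Proof.
by move=> xb y1; rewrite normrM -[b]mulr1; apply: ler_pM.
Qed.

Lemma norm_round (p q m : R) : q <= p < q + 1 -> `|m| <= 1 -> `|p * m - q * m| <= 1.
Proof.
move=> /andP[h1 h2] m1; rewrite -mulrBl; apply: normM_le => //.
by rewrite ler_norml; apply/andP; split; lra.
Qed.

Lemma norm_add (x y a b : R) : `|x| <= a -> `|y| <= b -> `|x + y| <= a + b.
Proof. by move=> h1 h2; apply: le_trans (ler_normD _ _) _; exact: lerD. Qed.

Lemma norm_mul (x y a b : R) : `|x| <= a -> `|y| <= b -> `|x * y| <= a * b.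
Proof. by move=> h1 h2; rewrite normrM; exact: ler_pM. Qed.

Lemma trel_mul x y a b : trel x a -> trel y b ->
  trel (tmul rtops x y) (tmul tmops a b).
Proof.
case: a b => [c a b aa ab bb r] [c' a' b' aa' ab' bb' r'] h1 h2.
have K0 : 0 < K := unit_gt0.
set L := zr a * t + zr b * s; set L' := zr a' * t + zr b' * s.
set M := zr aa * (t * t) + zr ab * (t * s) + zr bb * (s * s).
set M' := zr aa' * (t * t) + zr ab' * (t * s) + zr bb' * (s * s).
have hz z (m : R) : `|m| <= 1 -> `|zr z * m| <= `|zr z| by apply: normM_le.
have tt1 := normM_le1 t1 t1; have ts1 := normM_le1 t1 s1.
have ss1 := normM_le1 s1 s1.
have hL : `|L| <= `|zr a| + `|zr b| by apply: norm_add; exact: hz.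
have hL' : `|L'| <= `|zr a'| + `|zr b'| by apply: norm_add; exact: hz.
have hM : `|M| <= `|zr aa| + `|zr ab| + `|zr bb|.
  by apply: norm_add; [apply: norm_add|]; exact: hz.
have hM' : `|M'| <= `|zr aa'| + `|zr ab'| + `|zr bb'|.
  by apply: norm_add; [apply: norm_add|]; exact: hz.
set ex := x * K - (zr c + L + M); set ey := y * K - (zr c' + L' + M').
have hx : `|ex| <= zr r.
  by apply: le_trans h1; rewrite /tmain /= /ex /L /M !addrA.
have hy : `|ey| <= zr r'.
  by apply: le_trans h2; rewrite /tmain /= /ey /L' /M' !addrA.
pose n1 := Z.add (Z.abs a) (Z.abs b).
pose n2 := Z.add (Z.add (Z.abs aa) (Z.abs ab)) (Z.abs bb).
pose n1' := Z.add (Z.abs a') (Z.abs b').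
pose n2' := Z.add (Z.add (Z.abs aa') (Z.abs ab')) (Z.abs bb').
pose rem := Z.add (Z.add (Z.add (Z.mul n1 n2') (Z.mul n2 (Z.add n1' n2')))
   (Z.mul (Z.add (Z.add (Z.abs c) n1) n2) r'))
   (Z.mul r (Z.add (Z.add (Z.add (Z.abs c') n1') n2') r')).
pose q0 := Z.mul c c'.
pose qa := Z.add (Z.mul c a') (Z.mul a c').
pose qb := Z.add (Z.mul c b') (Z.mul b c').
pose qaa := Z.add (Z.add (Z.mul c aa') (Z.mul a a')) (Z.mul aa c').
pose qab := Z.add (Z.add (Z.add (Z.mul c ab') (Z.mul a b')) (Z.mul b a')) (Z.mul ab c').
pose qbb := Z.add (Z.add (Z.mul c bb') (Z.mul b b')) (Z.mul bb c').
pose sh z := Z.shiftr z fp_prec.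
change (`|x * y * K - (zr (sh q0) + zr (sh qa) * t + zr (sh qb) * s
  + zr (sh qaa) * (t * t) + zr (sh qab) * (t * s) + zr (sh qbb) * (s * s))|
  <= zr (Z.add (sh rem) 7)).
have hsh z : zr (sh z) <= zr z / K < zr (sh z) + 1 by exact: shiftr_prec.
(* The part of the product of degree at least three in [t] and [s], together with the contributions
   of the two errors; [rem] is its bound. *)
pose rest := L * M' + M * (L' + M') + (zr c + L + M) * ey
   + ex * (zr c' + L' + M' + ey).
have hn1 : zr n1 = `|zr a| + `|zr b| :> R by rewrite /n1 /n2 /n1' /n2' zrD !zr_abs.
have hn2 : zr n2 = `|zr aa| + `|zr ab| + `|zr bb| :> R by rewrite /n1 /n2 /n1' /n2' !zrD !zr_abs.
have hn1' : zr n1' = `|zr a'| + `|zr b'| :> R by rewrite /n1 /n2 /n1' /n2' zrD !zr_abs.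
have hn2' : zr n2' = `|zr aa'| + `|zr ab'| + `|zr bb'| :> R by rewrite /n1 /n2 /n1' /n2' !zrD !zr_abs.
have hrest : `|rest| <= zr rem.
  rewrite -hn1 in hL; rewrite -hn2 in hM; rewrite -hn1' in hL'; rewrite -hn2' in hM'.
  rewrite /rem; clearbody n1 n2 n1' n2'; rewrite !(zrD, zrM) !zr_abs.
  apply: norm_add; [apply: norm_add; [apply: norm_add|]|].
  - exact: norm_mul.
  - by apply: norm_mul => //; exact: norm_add.
  - by apply: norm_mul => //; apply: norm_add => //; exact: norm_add.
  - by apply: norm_mul => //; do 3 apply: norm_add => //.
have hrest' : `|rest / K| <= zr (sh rem) + 1.
  apply/ltW; case/andP: (hsh rem) => _; apply: le_lt_trans.
  by rewrite normrM normfV (gtr0_norm K0) ler_pM2r ?invr_gt0.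
have -> : x * y * K - (zr (sh q0) + zr (sh qa) * t + zr (sh qb) * s
  + zr (sh qaa) * (t * t) + zr (sh qab) * (t * s) + zr (sh qbb) * (s * s)) =
  rest / K + (zr q0 / K * 1 - zr (sh q0) * 1) + (zr qa / K * t - zr (sh qa) * t)
  + (zr qb / K * s - zr (sh qb) * s)
  + (zr qaa / K * (t * t) - zr (sh qaa) * (t * t))
  + (zr qab / K * (t * s) - zr (sh qab) * (t * s))
  + (zr qbb / K * (s * s) - zr (sh qbb) * (s * s)).
  have -> : x * y * K = (x * K) * (y * K) / K.
    by rewrite mulrACA [_ * (K * K)]mulrA mulfK// gt_eqF.
  have -> : x * K = zr c + L + M + ex by rewrite /ex addrC subrK.
  have -> : y * K = zr c' + L' + M' + ey by rewrite /ey addrC subrK.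
  rewrite /rest /q0 /qa /qb /qaa /qab /qbb !(zrD, zrM).
  rewrite /L /M /L' /M'; ring.
have -> : zr (Z.add (sh rem) 7) = zr (sh rem) + 1 + 1 + 1 + 1 + 1 + 1 + 1 :> R.
  by rewrite zrD !(zr_xI, zr_xO) zr1; ring.
have one1 : `|1 : R| <= 1 by rewrite normr1.
do 6 (apply: norm_add; last by apply: norm_round).
exact: hrest'.
Qed.

Lemma trel_pos y a : trel y a -> tpos a -> 0 < y.
Proof.
have K0 : 0 < K := unit_gt0.
rewrite /tpos /trel => h /Z.ltb_lt /(@ltr_zr R); rewrite !zrD !zr_abs => p.
rewrite -(pmulr_lgt0 _ K0); move: h p; rewrite /tmain.
set ya := zr (ta a) * t; set yb := zr (tb a) * s.
set yaa := zr (taa a) * (t * t); set yab := zr (tab a) * (t * s).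
set ybb := zr (tbb a) * (s * s).
have hz z (m : R) : `|m| <= 1 -> `|zr z * m| <= `|zr z| by apply: normM_le.
have := hz (ta a) _ t1; have := hz (tb a) _ s1.
have := hz (taa a) _ (normM_le1 t1 t1); have := hz (tab a) _ (normM_le1 t1 s1).
have := hz (tbb a) _ (normM_le1 s1 s1); rewrite -/ya -/yb -/yaa -/yab -/ybb.
move: (y * K) (zr _) `|zr _| `|zr _| `|zr _| `|zr _| `|zr _| (zr (tr a)).
move=> Y c a5 a4 a3 a2 a1 r.
by rewrite !ler_norml => /andP[? ?] /andP[? ?] /andP[? ?] /andP[? ?] /andP[? ?]
  /andP[? ?] ?; lra.
Qed.

End TaylorModelSound.

Section TaylorExpansion.
Context {R : realType}.
Local Notation K := (zr fp_unit : R).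
Local Notation G := (zr (Z.pow 2 gbits) : R).

Fixpoint zeval (l : seq Z) (t : R) : R :=
  if l is x :: l then zr x + t * zeval l t else 0.

Lemma gbits_gt0 : 0 < G. Proof. exact: zr_gt0. Qed.

Lemma shiftr_gbits z : zr (Z.shiftr z gbits) <= (zr z : R) / G < zr (Z.shiftr z gbits) + 1.
Proof.
rewrite ler_pdivlMr ?gbits_gt0// ltr_pdivrMr ?gbits_gt0//.
exact: zr_shiftr.
Qed.

Lemma size_hstep m w prev l : size (hstep m w prev l) = size l.
Proof. by elim: l prev => //= x l IH prev; rewrite IH. Qed.

(** The term in [t ^+ size l] is the overflow dropped by [hstep]. Each coefficient of the result is
    rounded down once, hence the error [size l]. *)
Lemma hstep_sound m w prev l (t : R) : `|t| <= 1 ->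
  `|(zr m * zeval l t + zr w * (zr prev + t * zeval l t
       - t ^+ size l * zr (last prev l))) / G - zeval (hstep m w prev l) t| <= (size l)%:R.
Proof.
move=> t1; elim: l prev => [|x l IH] prev.
  by rewrite /= !mulr0 expr0 mul1r addr0 add0r subrr mulr0 mul0r subr0 normr0.
set z := Z.add (Z.mul m x) (Z.mul w prev).
change (`|(zr m * (zr x + t * zeval l t) + zr w * (zr prev + t * (zr x + t * zeval l t)
  - t ^+ (size l).+1 * zr (last x l))) / G
  - (zr (Z.shiftr z gbits) + t * zeval (hstep m w x l) t)| <= (size l).+1%:R).
have /andP[h1 h2] := shiftr_gbits z; have {}IH := IH x.
rewrite -natr1; set u := (_ / G - _) in IH.
set v := zr z / G - zr (Z.shiftr z gbits).
have -> : (zr m * (zr x + t * zeval l t) + zr w * (zr prev + t * (zr x + t * zeval l t)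
  - t ^+ (size l).+1 * zr (last x l))) / G
  - (zr (Z.shiftr z gbits) + t * zeval (hstep m w x l) t) = u * t + v.
  by rewrite /u /v /z zrD !zrM exprS; ring.
apply: norm_add; first exact: normM_le.
by rewrite /v ler_norml; apply/andP; split; lra.
Qed.

Lemma zeval_head (c : Z) l (t : R) : (0 < size l)%N ->
  zeval (Z.add c (head Z0 l) :: behead l) t = zr c + zeval l t.
Proof. by case: l => // x l _ /=; rewrite zrD addrA. Qed.

Lemma horner_taylor_sound m w (us : seq R) l (t : R) :
  Z.le Z0 m -> Z.le Z0 w -> `|t| <= 1 -> List.Forall2 irel us l ->
  size (horner_taylor m w l).1 = 7 /\
  `|(Poly us).[(zr m + zr w * t) / G] * K - zeval (horner_taylor m w l).1 t|
    <= zr (horner_taylor m w l).2.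
Proof.
move=> m0 w0 t1; elim=> [|x [c e] us0 l0 hx h [IH1 IH2]].
  by rewrite /= zr0 horner0 mul0r !(mulr0, addr0) subrr normr0.
rewrite /=; case: horner_taylor IH1 IH2 => [s r] /= s7 IH.
have S7 := size_hstep m w Z0 s.
have s0 : (0 < size (hstep m w Z0 s))%N by rewrite S7 s7.
split; first by rewrite size_behead S7 s7.
change (`|(Poly (x :: us0)).[(zr m + zr w * t) / G] * K -
  zeval (Z.add c (head Z0 (hstep m w Z0 s)) :: behead (hstep m w Z0 s)) t|
  <= zr (Z.add (Z.add (Z.shiftr (Z.add (Z.mul (Z.add m w) r)
       (Z.mul w (Z.abs (last Z0 s)))) gbits) 8) e)).
rewrite zeval_head// Poly_cons hornerD hornerM hornerX hornerC.
have hs := hstep_sound m w Z0 s t1; rewrite s7 zr0 add0r in hs.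
set q := (Poly us0).[_] in IH *; set mu := (zr m + _) / G.
rewrite !zrD; set z := Z.add (Z.mul (Z.add m w) r) _.
have /andP[_ /ltW h2] := shiftr_gbits z.
have G0 := gbits_gt0.
have hmu : `|mu| <= (zr m + zr w) / G.
  rewrite normrM normfV (gtr0_norm G0) ler_pM2r ?invr_gt0//.
  apply: norm_add; first by rewrite ger0_norm// zr_ge0.
  by apply: normM_le => //; rewrite ger0_norm// zr_ge0.
(* The 7 is the rounding of the seven coefficients, from [hstep_sound]; the 1 is the rounding of the
   remainder bound. *)
have z8 : zr 8 = 1 + 7%:R :> R by rewrite !zr_xO zr1; ring.
rewrite z8.
have -> : (q * mu + x) * K - (zr c + zeval (hstep m w Z0 s) t) =
  (mu * (q * K - zeval s t) + zr w * (t ^+ 7 * zr (last Z0 s)) / G) +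
  ((zr m * zeval s t + zr w * (t * zeval s t - t ^+ 7 * zr (last Z0 s))) / G -
  zeval (hstep m w Z0 s) t) + (x * K - zr c).
  by rewrite /mu; ring.
apply: norm_add hx; rewrite [leRHS]addrA; apply: norm_add hs.
apply: le_trans h2.
have -> : zr z / G = (zr m + zr w) / G * zr r + zr w * `|zr (last Z0 s)| / G :> R.
  by rewrite /z zrD !zrM zrD zr_abs; ring.
apply: norm_add; first exact: norm_mul.
rewrite normrM normfV (gtr0_norm G0) ler_pM2r ?invr_gt0//.
apply: norm_mul; first by rewrite ger0_norm// zr_ge0.
by rewrite mulrC; apply: normM_le => //; rewrite normrX; exact: exprn_ile1.
Qed.

Lemma zeval_bound l (t : R) : `|t| <= 1 ->
  `|zeval l t| <= zr (foldr (fun x acc => Z.add (Z.abs x) acc) Z0 l).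
Proof.
move=> t1; elim: l => [|x l IH]; first by rewrite /= normr0 zr0.
rewrite /= zrD zr_abs; apply: norm_add => //.
by rewrite mulrC; exact: normM_le.
Qed.

Lemma foldr_Zabs (l : seq Z) z :
  foldr (fun x acc => Z.add (Z.abs x) acc) z l =
  Z.add (foldr (fun x acc => Z.add (Z.abs x) acc) Z0 l) z.
Proof. by elim: l => //= x l ->; rewrite Z.add_assoc. Qed.

Lemma tm_of_sound e m w (us : seq R) l (t s y : R) :
  Z.le Z0 m -> Z.le Z0 w -> `|t| <= 1 -> List.Forall2 irel us l ->
  `|y - (Poly us).[(zr m + zr w * t) / G]| * K <= zr e ->
  trel t s y (tm_of e m w l).
Proof.
move=> m0 w0 t1 h hy; have [] := horner_taylor_sound m0 w0 t1 h.
rewrite /tm_of; case: horner_taylor => [[|a0 [|a1 [|a2 l']]] r] //= _.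
set p := (Poly us).[_] in hy *; rewrite /trel /tmain /= foldr_Zabs !zrD => hp.
have hl := zeval_bound l' t1; have K0 : 0 < K := unit_gt0.
rewrite zr0 !mul0r !addr0.
have -> : y * K - (zr a0 + zr a1 * t + zr a2 * (t * t)) =
  t ^+ 3 * zeval l' t + ((p * K - (zr a0 + t * (zr a1 + t * (zr a2 + t * zeval l' t))))
  + (y - p) * K) by ring.
apply: norm_add; last apply: norm_add => //.
  by rewrite mulrC; apply: normM_le => //; rewrite normrX; exact: exprn_ile1.
by rewrite normrM (gtr0_norm K0).
Qed.

Lemma zr_divr x y : Z.lt Z0 y ->
  zr (Z.div x y) <= (zr x : R) / zr y < zr (Z.div x y) + 1.
Proof.
move=> y0; have Y0 : 0 < zr y :> R by exact: zr_gt0.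
by rewrite ler_pdivlMr// ltr_pdivrMr//; exact: zr_div.
Qed.

Lemma psi_tm_sound (j n : Z) (t s : R) : Z.lt Z0 n -> `|s| <= 1 ->
  trel t s (3 * (2 * zr j + 1 + s) / (40 * zr n)) (psi_tm j n).
Proof.
move=> n0 s1; rewrite /trel /tmain /psi_tm.
change (`|3 * (2 * zr j + 1 + s) / (40 * zr n) * K -
 (zr (Z.div (Z.mul (Z.mul 3 fp_unit) (Z.add (Z.mul 2 j) 1)) (Z.mul 40 n)) + zr Z0 * t
 + zr (Z.div (Z.mul 3 fp_unit) (Z.mul 40 n)) * s + zr Z0 * (t * t) + zr Z0 * (t * s)
 + zr Z0 * (s * s))| <= zr 2).
have N0 : Z.lt Z0 (Z.mul 40 n) by exact: Z.mul_pos_pos.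
have := zr_divr (Z.mul (Z.mul 3 fp_unit) (Z.add (Z.mul 2 j) 1)) N0.
have := zr_divr (Z.mul 3 fp_unit) N0; set b := Z.div _ _; set c := Z.div _ _.
have z40 : zr 40 = 40 :> R by rewrite !(zr_xI, zr_xO) zr1; ring.
have z3 : zr 3 = 3 :> R by rewrite !(zr_xI, zr_xO) zr1; ring.
rewrite !(zrM, zrD) z40 z3 zr1 zr2 zr0 => h1 h2.
rewrite !mul0r !addr0; set p := 3 * K / _ in h1.
have -> : 3 * (2 * zr j + 1 + s) / (40 * zr n) * K - (zr c + zr b * s) =
  (3 * K * (2 * zr j + 1) / (40 * zr n) * 1 - zr c * 1) + (p * s - zr b * s).
  by rewrite /p; ring.
by apply: norm_add; apply: norm_round; rewrite // normr1.
Qed.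

End TaylorExpansion.

(** * The cells cover the box *)

Section Coverage.
Context {R : realType}.
Local Notation K := (zr fp_unit : R).
Local Notation G := (zr (Z.pow 2 gbits) : R).

(** An even sum of the end points makes the midpoint of a strip an integer, so that halving by a
    shift is exact. *)
Fixpoint grid_valid (lo : Z) (rows : seq (Z * seq Z)) : bool :=
  if rows is (hi, ks) :: rows then
    [&& Z.ltb lo hi, Z.even (Z.add lo hi), ks != [::] & grid_valid hi rows]
  else true.

Definition grid_end (lo : Z) (rows : seq (Z * seq Z)) := last lo (map fst rows).

Lemma half_cell lo hi : Z.lt lo hi -> Z.even (Z.add lo hi) ->
  let m := Z.shiftr (Z.add lo hi) 1 in let w := Z.sub m lo in
  [/\ Z.sub m w = lo, Z.add m w = hi & Z.lt Z0 w].
Proof.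
move=> lh /Z.even_spec [q qE]; cbv zeta; rewrite qE.
have -> : Z.shiftr (Z.mul 2 q) 1 = q.
  by rewrite Z.shiftr_div_pow2// Z.mul_comm Z.div_mul.
rewrite -Z.add_diag in qE; split; Lia.lia.
Qed.

Lemma nat_cell n (x : R) : (0 < n)%N -> 0 <= x <= n%:R ->
  exists j, (j < n)%N /\ j%:R <= x <= j%:R + 1.
Proof.
case: n => // n _; elim: n => [|n IH] /andP[x0 xn].
  by exists 0%N; rewrite add0r x0.
have [xn'|nx] := lerP x n.+1%:R; last by exists n.+1; rewrite ltnS leqnn ltW// natr1.
by have [j [jn hj]] := IH (introT andP (conj x0 xn')); exists j; rewrite (leq_trans jn).
Qed.

Lemma psi_cell n (psi : R) : (0 < n)%N -> 0 <= psi <= 3 / 20 ->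
  exists j s, [/\ (j < n)%N, `|s| <= 1 &
    psi = 3 * (2 * zr (Z.of_nat j) + 1 + s) / (40 * zr (Z.of_nat n))].
Proof.
move=> n0 /andP[p0 p1]; have N0 : 0 < n%:R :> R by rewrite ltr0n.
have [|j [jn /andP[h1 h2]]] := @nat_cell n (psi * 20 * n%:R / 3) n0.
  apply/andP; split; first by rewrite !mulr_ge0 ?invr_ge0// ltW.
  have : psi * n%:R <= 3 / 20 * n%:R by rewrite ler_pM2r.
  by move=> ?; lra.
exists j, (2 * (psi * 20 * n%:R / 3) - 2 * j%:R - 1); split => //.
  by rewrite ler_norml; apply/andP; split; lra.
rewrite !zr_nat; field; exact: lt0r_neq0.
Qed.

Lemma mu_cell lo hi (mu : R) : Z.lt lo hi -> Z.even (Z.add lo hi) ->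
  zr lo / G <= mu <= zr hi / G ->
  let m := Z.shiftr (Z.add lo hi) 1 in let w := Z.sub m lo in
  exists t, `|t| <= 1 /\ mu = (zr m + zr w * t) / G.
Proof.
move=> lh ev /andP[h1 h2] m w; have [e1 e2 w0] := half_cell lh ev.
rewrite -/m -/w in e1 e2 w0.
have W0 : 0 < zr w :> R by exact: zr_gt0.
have G0 := @gbits_gt0 R.
rewrite ler_pdivrMr// in h1; rewrite ler_pdivlMr// in h2.
rewrite -e1 zrB in h1; rewrite -e2 zrD in h2.
exists ((mu * G - zr m) / zr w); split.
  rewrite normrM normfV (gtr0_norm W0) ler_pdivrMr// mul1r ler_norml.
  by apply/andP; split; lra.
by rewrite mulrCA divff ?gt_eqF// mulr1 addrC subrK mulfK// gt_eqF.
Qed.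

(** Two errors are kept apart: the radii in [l] concern the coefficients of the approximating
    polynomial, [e] its distance from the true value. *)
Definition tracks (e : Z) (mu : R) (y : R) (l : seq (Z * Z)) :=
  exists2 u, List.Forall2 irel u l & `|y - (Poly u).[mu]| * K <= zr e.

Lemma tracks_tm e m w (t s : R) f ls : Z.le Z0 m -> Z.le Z0 w -> `|t| <= 1 ->
  List.Forall2 (tracks e ((zr m + zr w * t) / G)) f ls ->
  List.Forall2 (trel t s) f (map (tm_of e m w) ls).
Proof.
move=> m0 w0 t1; elim=> [|y l f' ls' [u ul hy] _ IH] /=; constructor => //.
exact: tm_of_sound ul hy.
Qed.

Lemma tpos_all (t s : R) ys l : `|t| <= 1 -> `|s| <= 1 ->
  List.Forall2 (trel t s) ys l -> all tpos l -> all (fun y => 0 < y) ys.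
Proof.
move=> t1 s1; elim=> //= y a ys' l' ya _ IH /andP[/(trel_pos t1 s1 ya) -> /IH ->].
by [].
Qed.

Local Opaque cell_ok.

Lemma row_check_nth f g n j ks i : row_check f g n j ks -> (i < size ks)%N ->
  cell_ok f g n (Z.add j (Z.of_nat i)) (nth Z0 ks i).
Proof.
elim: ks j i => // k ks IH j [|i] /=; case: ifP => // h1 h2.
  by rewrite Z.add_0_r.
move=> /(IH _ _ h2).
by rewrite -[Z.add j 1]/(Z.add j (Z.of_nat 1)) -Z.add_assoc -Nat2Z.inj_add.
Qed.

Local Opaque row_check.

(** Descends to the strip that contains [mu] and uses the single cell that contains the point. The
    strict inequality between the end points rules out an empty grid. *)
Lemma rows_check_sound cs ds lo rows (mu psi c : R) f g :
  Z.le Z0 lo -> grid_valid lo rows -> rows_check cs ds lo rows ->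
  zr lo / G <= mu <= zr (grid_end lo rows) / G -> zr lo / G < zr (grid_end lo rows) / G ->
  0 <= psi <= 3 / 20 ->
  `|c * K - zr (tc c_tm)| <= zr (tr c_tm) ->
  List.Forall2 (tracks verr mu) f cs -> List.Forall2 (tracks derr mu) g ds ->
  exists k, all (fun y => 0 < y) (cell_checks rtops (jet_of rtops f g psi) c k).
Proof.
move=> lo0 gv rc hmu lt hpsi hc hf hg.
elim: rows lo lo0 gv rc hmu lt => [|[hi ks] rows IH] lo lo0.
  by move=> _ _ _; rewrite [grid_end _ _]/=; rewrite ltxx.
rewrite [grid_valid _ _]/= => /and4P[/Z.ltb_lt lh ev ks0 gv].
rewrite [rows_check _ _ _ _]/=; case: ifP => // rc rcs hmu lt.
have hi0 : Z.le Z0 hi := Z.le_trans _ _ _ lo0 (Z.lt_le_incl _ _ lh).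
have [hh|hh] := lerP mu (zr hi / G); last first.
  apply: (IH hi) => //; first by case/andP: hmu => _ ->; rewrite ltW.
  by case/andP: hmu => _; exact: lt_le_trans.
have [//|t [t1 muE]] := mu_cell lh ev (mu := mu).
  by case/andP: hmu => -> _.
have [e1 e2 w0] := half_cell lh ev.
move: rc; set m := Z.shiftr _ _ in muE e1 e2 w0 *; set w := Z.sub m lo in muE e1 e2 w0 *.
move=> rc; have n0 : (0 < size ks)%N by case: (ks) ks0.
have [j [s [jn s1 psiE]]] := psi_cell n0 hpsi.
exists (nth Z0 ks j); have := row_check_nth rc jn; rewrite Z.add_0_l.
move=> ok; apply: (tpos_all t1 s1 _ ok); apply: rl_cell_checks.
- exact: trel_add.
- exact: trel_sub.
- exact: (trel_mul t1 s1).
- exact: trel_scale.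
- exact: trel_cst.
- have m0 : Z.le Z0 m by clear -e1 w0 lo0; Lia.lia.
  have w0' : Z.le Z0 w := Z.lt_le_incl _ _ w0.
  apply: jrel_jet_of.
  + exact: trel_add.
  + exact: (trel_mul t1 s1).
  + exact: trel_scale.
  + exact: trel_cst.
  + by apply: tracks_tm => //; rewrite -muE.
  + by apply: tracks_tm => //; rewrite -muE.
  + rewrite psiE; apply: psi_tm_sound => //.
    by case: (size ks) n0 => // n _; rewrite Nat2Z.inj_succ; Lia.lia.
- by rewrite /trel /tmain [tc _]/= [ta _]/= [tb _]/= [taa _]/= [tab _]/= [tbb _]/=
    zr0 !mul0r !addr0.
Qed.

End Coverage.

(** * The polynomial approximating the exponential *)

Section ResidualProgram.
Local Open Scope Z_scope.

Definition zops : ops Z := {|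
  ozero := Z0; oadd := Z.add; omul := Z.mul; oscale := Z.mul; ofrac := Z.div |}.

(** The recurrence of the shifted Chebyshev polynomials [T_n(2 z - 1)]: the next one is
    [4 z T - 2 T] minus the one before. The pair holds two consecutive ones as coefficient lists. *)
Definition cheb_step (p : seq Z * seq Z) : seq Z * seq Z :=
  (p.2, padd zops (Z0 :: pzscal zops 4 p.2)
          (padd zops (pzscal zops (-2) p.2) (pzscal zops (-1) p.1))).

Definition cheb (n : nat) := iter n cheb_step ([:: 1], [:: -1; 2]).

(* [25 tau] at scale [2 ^ 82], for the [tau] of [pdata]. *)
Definition tau_int : Z := (-65987706043761434).

Definition residual : seq Z :=
  padd zops (pderiv zops (pderiv zops pdata)) (pzscal zops 5 (pderiv zops pdata)).

(** What rounding [pdata] leaves over: the residual minus its ideal value [25 tau T_13(2 z - 1)], at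
    scale [2 ^ 82]. *)
Definition residual_dev : seq Z :=
  padd zops (pzscal zops (Z.pow 2 40) residual)
    (pzscal zops (Z.opp tau_int) (cheb 13).1).

Definition residual_bound : Z :=
  Z.add (Z.abs tau_int)
    (foldr (fun x acc => Z.add (Z.abs x) acc) Z0 residual_dev).

(** Divided by [2 ^ 82], this says that [p'' + 5 p'] is at most [25 * 2 ^ -30] on [0, 1]; for
    [p' / 5] it yields the accuracy [2 ^ -30], which is [peps]. *)
Lemma residual_boundE : Z.le residual_bound (Z.mul 25 (Z.mul (Z.pow 2 40) 4096)).
Proof. by apply/Z.leb_le; vm_compute. Qed.

End ResidualProgram.

Section ExponentialPolynomial.
Context {R : realType}.
Local Notation K := (zr fp_unit : R).

Lemma zeval_padd u v (z : R) : zeval (padd zops u v) z = zeval u z + zeval v z.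
Proof.
elim: u v => [|x u IH] [|y v]; rewrite ?add0r ?addr0//.
rewrite -[LHS]/(zr (Z.add x y) + z * zeval (padd zops u v) z) IH zrD /=; ring.
Qed.

Lemma zeval_pzscal k u (z : R) : zeval (pzscal zops k u) z = zr k * zeval u z.
Proof.
elim: u => [|x u IH]; first by rewrite /= mulr0.
rewrite -[LHS]/(zr (Z.mul k x) + z * zeval (pzscal zops k u) z) IH zrM /=; ring.
Qed.

Lemma zeval0 l : zeval l 0 = zr (head Z0 l) :> R.
Proof. by case: l => [|x l] /=; rewrite ?zr0// mul0r addr0. Qed.

(** The substitution [2 z - 1 = cos a] turns the recurrence into the addition formula for
    [cos (n a)]; this gives the bound 1 on [0, 1]. *)
Lemma zeval_cheb n (a : R) :
  zeval (cheb n).1 ((1 + cos a) / 2) = cos (n%:R * a) /\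
  zeval (cheb n).2 ((1 + cos a) / 2) = cos (n.+1%:R * a).
Proof.
have zm1 : zr (-1) = -1 :> R by rewrite zr_neg zr1.
have zm2 : zr (-2) = -2 :> R by rewrite zr_neg zr2.
have z4 : zr 4 = 4 :> R by rewrite !zr_xO zr1; ring.
elim: n => [|n [IH1 IH2]].
  by rewrite /= mul0r cos0 mul1r zr1 zr2 zm1; split; field.
rewrite /cheb iterS -/(cheb n); case: (cheb n) IH1 IH2 => u v; rewrite [(u, v).1]/= [(u, v).2]/=.
move=> IH1 IH2; split; first by rewrite -IH2.
rewrite -[(cheb_step (u, v)).2]/(padd zops (Z0 :: pzscal zops 4 v)
  (padd zops (pzscal zops (-2) v) (pzscal zops (-1) u))).
rewrite !zeval_padd [zeval (Z0 :: _) _]/= !zeval_pzscal zr0 add0r z4 zm1 zm2 IH1 IH2.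
have -> : n.+2%:R * a = n.+1%:R * a + a by rewrite -natr1; ring.
have -> : n%:R * a = n.+1%:R * a - a by rewrite -natr1; ring.
by rewrite cosB cosD; field.
Qed.

Lemma cheb_bound n (z : R) : 0 <= z <= 1 -> `|zeval (cheb n).1 z| <= 1.
Proof.
move=> hz; have -> : z = (1 + cos (acos (2 * z - 1))) / 2.
  by rewrite acosK ?in_itv/=; [field|lra].
by rewrite (zeval_cheb n _).1 ler_norml cos_geN1 cos_le1.
Qed.

Definition pcoef : seq R := map (fun x => zr x / K) pdata.

Lemma pderiv_from_zr k u :
  map (fun x => zr x / K) (pderiv_from zops k u) =
  pderiv_from rops k (map (fun x => zr x / K) u) :> seq R.
Proof.
by elim: u k => //= x u IH k; rewrite IH zrM mulrA.
Qed.

Lemma pderiv_zr u :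
  map (fun x => zr x / K) (pderiv zops u) = pderiv rops (map (fun x => zr x / K) u).
Proof. by rewrite /pderiv pderiv_from_zr; case: u. Qed.

Lemma horner_zr u (z : R) : (Poly (map (fun x => zr x / K) u)).[z] = zeval u z / K.
Proof.
elim: u => [|x u IH]; first by rewrite horner0 mul0r.
by rewrite map_cons Poly_cons hornerD hornerM hornerX hornerC IH /=; ring.
Qed.

Lemma deriv_zr u :
  (Poly (map (fun x => zr x / K) u))^`() =
  Poly (map (fun x => zr x / K) (pderiv zops u)) :> {poly R}.
Proof. by rewrite pderiv_zr Poly_pderiv. Qed.

Lemma residual_le (z : R) : 0 <= z <= 1 ->
  `|zeval residual z| * zr (Z.pow 2 40) <= zr residual_bound.
Proof.
move=> hz; have z1 : `|z| <= 1 by rewrite ger0_norm; lra.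
have z40 : 0 < zr (Z.pow 2 40) :> R by exact: zr_gt0.
rewrite -(gtr0_norm z40) -normrM /residual_bound zrD zr_abs.
have -> : zeval residual z * zr (Z.pow 2 40) =
    zr tau_int * zeval (cheb 13).1 z + zeval residual_dev z.
  rewrite /residual_dev zeval_padd !zeval_pzscal zrN; ring.
apply: norm_add; last exact: zeval_bound.
by apply: normM_le => //; exact: cheb_bound.
Qed.

(** For [|a| <= 1] the function [expR (5 x) * (a * y x - rho / 5)] has derivative [expR (5 x) * (a *
    (dy x + 5 * y x) - rho)], which is nonpositive. Comparing its values at 0 and [z] for [a = 1]
    and [a = -1] gives the two sides. *)
Lemma expn_approx (y dy : R -> R) (rho : R) :
  (forall z : R, is_derive z 1 y (dy z)) -> y 0 = 1 ->
  (forall z : R, 0 <= z <= 1 -> `|dy z + 5 * y z| <= rho) ->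
  forall z : R, 0 <= z <= 1 -> `|y z - expR (- (5 * z))| <= rho / 5.
Proof.
move=> dyP y0 hr z /andP[z0 z1].
have rho0 : 0 <= rho by apply: le_trans (hr 0 _); rewrite ?lexx ?ler01.
pose g (a : R) x := expR (5 * x) * (a * y x - rho / 5).
pose dg (a : R) x := expR (5 * x) * (a * (dy x + 5 * y x) - rho).
have dgP (a x : R) : is_derive x 1 (g a) (dg a x).
  have h0 : is_derive x 1 (fun x : R => 5 * x) (5 : R).
    have := @is_deriveZ _ _ _ id 5 x 1 _ (is_derive_id _ _).
    by rewrite /GRing.scale /= mulr1.
  have h1 := @is_derive1_comp _ expR (fun x : R => 5 * x) x _ _ (is_derive_expR _) h0.
  have h2 := @is_deriveZ _ _ _ y a x 1 _ (dyP x).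
  have h3 := @is_deriveB _ _ _ (fun x => a * y x) (cst (rho / 5)) x 1 _ _ h2
    (is_derive_cst _ _ _).
  have := @is_deriveM _ _ (fun x : R => expR (5 * x)) (fun x => a * y x - rho / 5) x 1 _ _ h1 h3.
  by move/is_derive_eq; apply; rewrite /dg /GRing.scale /=; field.
have key (a : R) : `|a| <= 1 -> expR (5 * z) * (a * y z - rho / 5) <= a - rho / 5.
  move=> a1; have cg : {within `[0, z], continuous (g a)}.
    apply: derivable_within_continuous => x _; by have [] := dgP a x.
  have [x] := @MVT_segment _ (g a) (dg a) 0 z z0 (fun x _ => dgP a x) cg.
  rewrite in_itv/= => /andP[x0 xz]; rewrite subr0 {1 2}/g mulr0 expR0 mul1r y0 mulr1.
  move=> gE; suff : dg a x * z <= 0 by rewrite -gE subr_le0.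
  apply: mulr_le0_ge0 => //; rewrite /dg pmulr_rle0 ?expR_gt0// subr_le0.
  apply: le_trans (ler_norm _) _; rewrite mulrC; apply: normM_le => //.
  by apply: hr; rewrite x0 (le_trans xz).
have e0 : 0 < expR (- (5 * z)) :> R by exact: expR_gt0.
have ek : expR (5 * z) * expR (- (5 * z)) = 1 :> R by rewrite -expRD subrr expR0.
have e1 : expR (- (5 * z)) <= 1 :> R by rewrite -expR0 ler_expR oppr_le0 mulr_ge0.
have aux (a : R) : `|a| <= 1 -> a * y z - rho / 5 <= expR (- (5 * z)) * (a - rho / 5).
  move=> /key; rewrite -(ler_pM2l e0) mulrA [_ * expR (5 * z)]mulrC ek mul1r.
  exact.
have n1 : `|1 : R| <= 1 by rewrite normr1.
have nm1 : `|- 1 : R| <= 1 by rewrite normrN.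
have k1 := aux _ nm1; have k2 := aux _ n1.
have : 0 <= expR (- (5 * z)) * (rho / 5).
  by apply: mulr_ge0; [exact: ltW|exact: divr_ge0].
by move=> h; rewrite ler_norml; apply/andP; split; lra.
Qed.

Definition peps : R := zr 4096 / K.

Lemma pcoef_horner0 : (Poly pcoef).[0] = 0.
Proof.
by rewrite /pcoef horner_zr /= zr0 mul0r addr0 mul0r.
Qed.

Lemma scaled_bound (m a b k : R) : 0 < k -> 0 < a -> m <= 25 * (a * b) ->
  m / (5 * k * a) / 5 <= b / k.
Proof.
move=> k0 a0 h; rewrite -mulrA -invfM ler_pdivrMr; last by rewrite !mulr_gt0.
apply: le_trans h _; rewrite le_eqVlt; apply/orP; left; apply/eqP.
by field; rewrite gt_eqF.
Qed.

Lemma scaled_residual (u v m a k : R) : 0 < k -> 0 < a -> `|v + 5 * u| * a <= m ->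
  `|v / k / 5 + 5 * (u / k / 5)| <= m / (5 * k * a).
Proof.
move=> k0 a0 h; have -> : v / k / 5 + 5 * (u / k / 5) = (v + 5 * u) / (5 * k).
  by field; rewrite gt_eqF.
have -> : m / (5 * k * a) = m / a / (5 * k) by field; rewrite !gt_eqF.
rewrite normrM normfV [`|5 * k|]gtr0_norm ?mulr_gt0//.
by rewrite ler_pM2r ?invr_gt0 ?mulr_gt0// ler_pdivlMr.
Qed.

Lemma scaled_one (k : R) : 0 < k -> 5 * k / k / 5 = 1.
Proof. by move=> k0; rewrite mulfK ?gt_eqF// divff. Qed.

Lemma residual_bound_zr : zr residual_bound <= 25 * (zr (Z.pow 2 40) * zr 4096) :> R.
Proof.
have -> : 25 = zr 25 :> R by rewrite !(zr_xI, zr_xO) zr1; ring.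
by rewrite -!zrM; apply: ler_zr; exact: residual_boundE.
Qed.

Lemma pcoef_deriv (z : R) : 0 <= z <= 1 ->
  `|(Poly pcoef)^`().[z] / 5 - expR (- (5 * z))| <= peps.
Proof.
move=> hz; have K0 : 0 < K := unit_gt0.
have z40 : 0 < zr (Z.pow 2 40) :> R by exact: zr_gt0.
pose rho : R := zr residual_bound / (5 * K * zr (Z.pow 2 40)).
have rhoE : rho / 5 <= peps by exact: scaled_bound residual_bound_zr.
apply: le_trans rhoE.
pose q := Poly pcoef.
apply: (@expn_approx (fun z => q^`().[z] / 5) (fun z => q^`()^`().[z] / 5)) => //.
- move=> x.
  have := @is_deriveM _ _ (horner q^`()) (cst (5^-1 : R)) x 1 _ _ (is_derive_poly _ _)
    (is_derive_cst _ _ _).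
  by move/is_derive_eq; apply; rewrite scaler0 add0r /GRing.scale /= mulrC.
- rewrite /q /pcoef deriv_zr horner_zr.
  have -> : zeval (pderiv zops pdata) 0 = zr (Z.mul 5 fp_unit) :> R.
    by rewrite zeval0; congr zr.
  rewrite zrM; have -> : zr 5 = 5 :> R by rewrite !(zr_xI, zr_xO) zr1; ring.
  exact: scaled_one.
- move=> x hx; have := residual_le hx.
  rewrite /q /pcoef !deriv_zr !horner_zr /residual zeval_padd zeval_pzscal.
  have -> : zr 5 = 5 :> R by rewrite !(zr_xI, zr_xO) zr1; ring.
  exact: scaled_residual.
Qed.

(** The tenth power of [expR (- 1 / 2) >= 1 / 2]; this crude bound is far above [5 * peps]. *)
Lemma expR_m5_ge : (2 ^+ 10)^-1 <= expR (- 5) :> R.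
Proof.
have -> : - 5 = - 2^-1 * 10%:R :> R by field.
have h : 2^-1 <= expR (- 2^-1) :> R by apply: le_trans (expR_ge1Dx _); lra.
rewrite -exprVn expRM_natr; apply: lerXn2r h; by rewrite nnegrE ?expR_ge0 ?invr_ge0.
Qed.

Lemma peps_bounds : peps <= 1 /\ 5 * peps <= expR (- 5).
Proof.
have K0 : 0 < K := unit_gt0.
have Kl : zr (Z.mul 4096 (Z.pow 2 20)) <= K by apply: ler_zr.
have z20 : zr (Z.pow 2 20) = 2 ^+ 10 * 2 ^+ 10 :> R.
  by rewrite (@zr_pow2 R 20) -exprD.
have p20 : 1 <= 2 ^+ 10 :> R by rewrite exprn_ege1 ?ler1n.
have pe : peps <= (2 ^+ 10)^-1 / 2 ^+ 10.
  rewrite /peps ler_pdivrMr// -invfM -z20 mulrC ler_pdivlMr ?zr_gt0//.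
  by rewrite -zrM.
have i1 : (2 ^+ 10)^-1 <= 1 :> R by rewrite invf_le1 ?exprn_gt0.
have i0 : 0 < (2 ^+ 10)^-1 :> R by rewrite invr_gt0 exprn_gt0.
have i2 : 5 * (2 ^+ 10)^-1 <= 1 :> R.
  by rewrite ler_pdivrMr ?exprn_gt0// mul1r -natrX ler_nat.
have e5 := expR_m5_ge.
move: pe i1 i0 i2 e5; move: peps (2 ^+ 10)^-1 (expR _) => p q e h1 h2 h3 h4 h5.
have h6 : q * (5 * q) <= q by rewrite -[leRHS]mulr1 ler_pM2l.
by clear Kl z20 p20 K0; split; lra.
Qed.

End ExponentialPolynomial.

Local Opaque coefs tm_of rows_check corner_check pdata tpos.

Lemma Forall2_nth A B (r : A -> B -> Prop) u v x y k :
  List.Forall2 r u v -> (k < size u)%N -> r (nth x u k) (nth y v k).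
Proof. by move=> h; elim: h k => // a b u' v' ab _ IH [|k] //=; exact: IH. Qed.

Lemma Forall2_size A B (r : A -> B -> Prop) u v :
  List.Forall2 r u v -> size u = size v.
Proof. by elim=> //= *; congr _.+1. Qed.

Lemma nth_Forall2 A B (r : A -> B -> Prop) u v x y : size u = size v ->
  (forall k, (k < size u)%N -> r (nth x u k) (nth y v k)) -> List.Forall2 r u v.
Proof.
elim: u v => [|a u IH] [|b v] //= [uv] h.
constructor; first exact: (h 0%N).
by apply: IH => // k ku; exact: (h k.+1).
Qed.

(** * Transfer of the certificate to the motif integrals *)

Section MotifCertificate.
Context {R : realType}.
Local Notation K := (zr fp_unit : R).
Local Notation G := (zr (Z.pow 2 gbits) : R).

Definition motif_values (lam : R) : seq R :=
  map (fun F => F lam) motif_funs.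
(* Derivatives with respect to [lam / 5]. *)
Definition motif_slopes (lam : R) : seq R :=
  map (fun F : R -> R => 5 * derive1 F lam) motif_funs.

Definition icoefs : seq (seq (Z * Z)) :=
  coefs iops (map (fun x => (x, Z0)) pdata).

Lemma irel_pcoef : List.Forall2 (@irel R) pcoef (map (fun x => (x, Z0)) pdata).
Proof.
rewrite /pcoef; elim: pdata => [|x l IH] /=; constructor => //.
by rewrite /irel /= divfK ?gt_eqF ?unit_gt0// subrr normr0 zr0.
Qed.

Lemma irel_coefs :
  List.Forall2 (List.Forall2 (@irel R)) (coefs rops pcoef) icoefs.
Proof.
apply: rl_coefs irel_pcoef.
- exact: irel_zero.
- exact: irel_add.
- exact: irel_mul.
- exact: irel_scale.
- exact: irel_frac.
Qed.

Lemma size_pdata : size pdata = 15. Proof. by []. Qed.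

Lemma Poly_coefs_pcoef :
  map (@Poly R) (coefs rops pcoef) = motif_polys (Poly pcoef).
Proof. by apply: Poly_coefs; rewrite /pcoef size_map size_pdata. Qed.

Lemma motif_funs_close k : (k < 12)%N ->
  close (@peps R) (nth (fun=> 0) motif_funs k) (nth 0 (motif_polys (Poly pcoef)) k).
Proof.
have [e1 e5] := @peps_bounds R.
exact: (motif_close pcoef_horner0 pcoef_deriv e1 e5).
Qed.

Lemma size_rcoefs : size (coefs (@rops R) pcoef) = 12.
Proof. by rewrite -(size_map (@Poly R)) Poly_coefs_pcoef. Qed.

Lemma size_icoefs : size icoefs = 12.
Proof. by rewrite -(Forall2_size irel_coefs) size_rcoefs. Qed.

Lemma zr_15 : zr 15 = 15 :> R. Proof. by rewrite !(zr_xI, zr_xO) zr1; ring. Qed.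
Lemma zr_18 : zr 18 = 18 :> R. Proof. by rewrite !(zr_xI, zr_xO) zr1; ring. Qed.

Lemma peps_unit : peps * K = zr 4096.
Proof. by rewrite /peps divfK// gt_eqF ?unit_gt0. Qed.

Lemma verr_bound (x : R) : x <= 18 * (15 * peps) -> x * K <= zr verr.
Proof.
have -> : zr verr = 18 * (15 * peps) * K.
  rewrite -(mulrA 18) -(mulrA 15) peps_unit -zr_15 -zr_18 -!zrM; congr zr.
by rewrite ler_pM2r// unit_gt0.
Qed.

Lemma derr_bound (x : R) : x <= 18 * (615 * peps) -> x * K <= zr derr.
Proof.
have -> : zr derr = 18 * (615 * peps) * K.
  rewrite -(mulrA 18) -(mulrA 615) peps_unit.
  have -> : 615 = zr 615 :> R by rewrite !(zr_xI, zr_xO) zr1; ring.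
  by rewrite -zr_18 -!zrM; congr zr.
by rewrite ler_pM2r// unit_gt0.
Qed.

Lemma motif_values_track (lam : R) : 0 < lam <= 5 ->
  List.Forall2 (tracks verr (lam / 5)) (motif_values lam) icoefs.
Proof.
move=> hl; apply: (@nth_Forall2 _ _ _ _ _ 0 [::]).
  by rewrite size_icoefs size_map.
move=> k; rewrite size_map => k12; have [_ /(_ _ hl) [h _]] := motif_funs_close k12.
exists (nth [::] (coefs rops pcoef) k).
  by apply: Forall2_nth irel_coefs _; rewrite size_rcoefs.
rewrite (nth_map (fun=> 0))// -(nth_map [::] 0) ?size_rcoefs// Poly_coefs_pcoef.
exact: verr_bound.
Qed.

Lemma motif_slopes_track (lam : R) : 0 < lam <= 5 ->
  List.Forall2 (tracks derr (lam / 5)) (motif_slopes lam) (map (pderiv iops) icoefs).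
Proof.
move=> hl; apply: (@nth_Forall2 _ _ _ _ _ 0 [::]).
  by rewrite !size_map size_icoefs.
move=> k; rewrite size_map => k12; have [_ /(_ _ hl) [_ h]] := motif_funs_close k12.
exists (pderiv rops (nth [::] (coefs rops pcoef) k)).
  rewrite (nth_map [::]) ?size_icoefs//; apply: rl_pderiv.
    exact: irel_scale.
  by apply: Forall2_nth irel_coefs _; rewrite size_rcoefs.
rewrite (nth_map (fun=> 0))// Poly_pderiv -(nth_map [::] 0) ?size_rcoefs// Poly_coefs_pcoef.
exact: derr_bound.
Qed.

Lemma certificate_split :
  corner_check icoefs /\ rows_check icoefs (map (pderiv iops) icoefs) 1638 grid.
Proof.
have h := certificateE; rewrite /certificate -/icoefs in h; cbv zeta in h.
by move: h; move: (corner_check icoefs) (rows_check _ _ _ _) => a b; case: a.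
Qed.

(** Clears the denominator of [a / b]: when the letters are images of integers, the last premise can
    be decided by computation. *)
Lemma rescaled_center (c a b k m r : R) : 0 < b -> 0 < k ->
  `|c - a / b| <= 2 / b -> 2 * k + `|a * k - b * m| <= b * r ->
  `|c * k - m| <= r.
Proof.
move=> b0 k0 h1 h2; rewrite -(ler_pM2l b0); apply: le_trans h2.
rewrite -(gtr0_norm b0) -normrM (gtr0_norm b0).
have -> : b * (c * k - m) = b * (c - a / b) * k + (a * k - b * m).
  by field; rewrite gt_eqF.
apply: norm_add => //; rewrite !normrM (gtr0_norm b0) (gtr0_norm k0) ler_pM2r//.
by rewrite mulrC -ler_pdivlMr.
Qed.

Lemma c_tm_track (c : R) : `|c - zr 5865 / zr 10000| <= 2 / zr 10000 ->
  `|c * K - zr (tc c_tm)| <= zr (tr c_tm).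
Proof.
move=> h; apply: (rescaled_center _ _ h); [exact: zr_gt0|exact: unit_gt0|].
have le : Z.le (Z.add (Z.mul 2 fp_unit)
    (Z.abs (Z.sub (Z.mul 5865 fp_unit) (Z.mul 10000 (tc c_tm)))))
    (Z.mul 10000 (tr c_tm)) by apply/Z.leb_le; vm_compute.
have := @ler_zr R _ _ le; rewrite zrD zr_abs zrB !zrM zr2; exact.
Qed.

Lemma grid_valid_grid : grid_valid 1638 grid = true.
Proof. by vm_compute. Qed.

Lemma grid_end_grid : zr (grid_end 1638 grid) / G = 1.
Proof.
have -> : grid_end 1638 grid = Z.pow 2 gbits by vm_compute.
by move: G (@gbits_gt0 R) => g g0; rewrite divff// gt_eqF.
Qed.

Lemma motif_certificate (lam psi c : R) : 1 <= lam <= 5 -> 0 <= psi <= 3 / 20 ->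
  `|c - zr 5865 / zr 10000| <= 2 / zr 10000 ->
  exists k, all (fun y => 0 < y)
    (cell_checks rtops (jet_of rtops (motif_values lam) (motif_slopes lam) psi) c k).
Proof.
move=> hl hpsi hc.
have hl' : 0 < lam <= 5 by lra.
have G0 := @gbits_gt0 R.
have lo : zr 1638 / G <= 5^-1.
  have le : Z.le (Z.mul 5 1638) (Z.pow 2 gbits) by [].
  have := @ler_zr R _ _ le; rewrite zrM.
  have -> : zr 5 = 5 :> R by rewrite !(zr_xI, zr_xO) zr1; ring.
  move: G G0 (zr 1638) => g g0 x h.
  by rewrite ler_pdivrMr// mulrC ler_pdivlMr// mulrC.
have [_ rc] := certificate_split.
have lo0 : Z.le Z0 1638 by [].
refine (rows_check_sound lo0 grid_valid_grid rc (mu := lam / 5) _ _ hpsi (c_tm_track hc)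
  (motif_values_track hl') (motif_slopes_track hl')).
  rewrite grid_end_grid; apply/andP; split; last by clear -hl; lra.
  by apply: le_trans lo _; clear -hl; lra.
by rewrite grid_end_grid; apply: le_lt_trans lo _; clear; lra.
Qed.

Lemma trel_values (m e : Z) k (lam : R) : 0 < lam <= 5 -> (k < 12)%N -> Z.le Z0 m ->
  forall t, `|t| <= 1 -> lam / 5 = (zr m + zr 1 * t) / G ->
  trel t 0 (nth 0 (motif_values lam) k) (tm_of verr m 1 (nth [::] icoefs k)).
Proof.
move=> hl k12 m0 t t1 lamE.
have s0 : size (motif_values lam) = 12 by rewrite size_map.
have [|u hu hy] := @Forall2_nth _ _ _ _ _ 0 [::] k (motif_values_track hl).
  by rewrite s0.
by rewrite lamE in hy; exact: tm_of_sound hu hy.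
Qed.

Lemma grid_point (m : Z) (x : R) : zr m <= x * G <= zr m + 1 ->
  exists2 t, `|t| <= 1 & x = (zr m + zr 1 * t) / G.
Proof.
have G0 := @gbits_gt0 R; move=> /andP[h1 h2]; exists (x * G - zr m).
  by rewrite ler_norml; apply/andP; split; lra.
by rewrite zr1 mul1r addrC subrK mulfK// gt_eqF.
Qed.

Local Transparent corner_check.

Lemma E0f_1 : E0f 1 <= 1 / 4 :> R.
Proof.
have [cc _] := certificate_split; move: cc; rewrite /corner_check; cbv zeta.
move=> cc; have {cc} : tpos (tsub tmops (tcst tmops 1) (tscale tmops 4
    (tm_of verr 1638 1 (nth [::] icoefs 0)))).
  by move: cc; move: (tpos _) (tpos _) => a b; case: b.
(* One fifth of [2 ^ 13] is 1638.4, so [1 / 5] lies within one unit of 1638. *)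
have [|t t1 tE] := @grid_point 1638 (1 / 5).
  have z5 : zr 5 = 5 :> R by rewrite !(zr_xI, zr_xO) zr1; ring.
  have l1 : Z.le (Z.mul 5 1638) (Z.pow 2 gbits) by [].
  have l2 : Z.le (Z.pow 2 gbits) (Z.add (Z.mul 5 1638) 5) by [].
  have := @ler_zr R _ _ l1; have := @ler_zr R _ _ l2.
  rewrite zrD !(zrM 5) z5; move: G (zr 1638) => g y h1 h2.
  by apply/andP; split; lra.
have s1 : `|0 : R| <= 1 by rewrite normr0.
have h01 : 0 < (1 : R) <= 5 by rewrite ltr01 ler1n.
have h0 : trel t 0 (E0f 1) _ := @trel_values 1638 verr 0 1 h01 isT (Pos2Z.is_nonneg _) t t1 tE.
move=> cc; have : 0 < zr 1 - zr 4 * E0f 1 :> R.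
  exact: (trel_pos t1 s1 (trel_sub (trel_cst t 0 1) (trel_scale 4 h0)) cc).
by rewrite zr1 !zr_xO zr1; clear; move: (E0f 1) => e; lra.
Qed.

Lemma E_corner : 11 / 20 <= E0f 5 + 3 / 20 * E1f 5 :> R.
Proof.
have [cc _] := certificate_split; move: cc; rewrite /corner_check; cbv zeta.
move=> cc; have {cc} : tpos (tsub tmops
      (tadd tmops (tscale tmops 400 (tm_of verr 8191 1 (nth [::] icoefs 0)))
        (tscale tmops 60 (tm_of verr 8191 1 (nth [::] icoefs 1))))
      (tcst tmops 220)).
  by move: cc; move: (tpos _) (tpos _) => a b; case: b.
(* [lam = 5] is the right end [t = 1] of the interval of radius one about 8191. *)
have [|t t1 tE] := @grid_point 8191 (5 / 5).
  have e : G = zr (Z.add 8191 1) by congr zr.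
  have e' := @zrD R 8191 1; rewrite e e' zr1; move: (zr 8191) => y.
  by clear; apply/andP; split; lra.
have s1 : `|0 : R| <= 1 by rewrite normr0.
have h01 : 0 < (5 : R) <= 5 by rewrite lexx andbT.
have h0 : trel t 0 (E0f 5) _ := @trel_values 8191 verr 0 5 h01 isT (Pos2Z.is_nonneg _) t t1 tE.
have h1 : trel t 0 (E1f 5) _ := @trel_values 8191 verr 1 5 h01 isT (Pos2Z.is_nonneg _) t t1 tE.
move=> cc; have : 0 < zr 400 * E0f 5 + zr 60 * E1f 5 - zr 220 :> R.
  exact: (trel_pos t1 s1 (trel_sub (trel_add (trel_scale 400 h0) (trel_scale 60 h1))
    (trel_cst t 0 220)) cc).
rewrite !(zr_xI, zr_xO) zr1; clear; move: (E0f 5) (E1f 5) => e0 e1.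
by lra.
Qed.

End MotifCertificate.

(** * Bounds for pi *)

Section PiBounds.
Context {R : realType}.
Implicit Types (x a b : R) (p : {poly R}).

Lemma derive_le (f g df dg : R -> R) :
  (forall x, is_derive x 1 f (df x)) -> (forall x, is_derive x 1 g (dg x)) ->
  f 0 <= g 0 -> (forall x, 0 <= x -> df x <= dg x) ->
  forall x, 0 <= x -> f x <= g x.
Proof.
move=> hf hg h0 hd x x0.
have hgf (y : R) : is_derive y 1 (fun z => g z - f z) (dg y - df y).
  exact: is_deriveB.
have cgf : {within `[0, x], continuous (fun z => g z - f z)}.
  by apply: derivable_within_continuous => y _; have [] := hgf y.
have [y] := MVT_segment x0 (fun y _ => hgf y) cgf.
rewrite in_itv/= => /andP[y0 _] e.
have : 0 <= (dg y - df y) * (x - 0) by rewrite subr0 mulr_ge0// subr_ge0 hd.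
by rewrite -e => h; lra.
Qed.

Lemma sin_le_poly p : 0 <= p.[0] -> (forall x, 0 <= x -> cos x <= (deriv p).[x]) ->
  forall x, 0 <= x -> sin x <= p.[x].
Proof.
by move=> p0; apply: derive_le; rewrite sin0.
Qed.

Lemma poly_le_sin p : p.[0] <= 0 -> (forall x, 0 <= x -> (deriv p).[x] <= cos x) ->
  forall x, 0 <= x -> p.[x] <= sin x.
Proof.
by move=> p0; apply: derive_le; rewrite sin0.
Qed.

Lemma cos_le_poly p : 1 <= p.[0] -> (forall x, 0 <= x -> - (deriv p).[x] <= sin x) ->
  forall x, 0 <= x -> cos x <= p.[x].
Proof.
move=> p0 hp.
apply: (derive_le (df := fun x => - sin x) (dg := fun x => (deriv p).[x])) => [|x x0].
  by rewrite cos0.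
by have := hp _ x0; lra.
Qed.

Lemma poly_le_cos p : p.[0] <= 1 -> (forall x, 0 <= x -> sin x <= - (deriv p).[x]) ->
  forall x, 0 <= x -> p.[x] <= cos x.
Proof.
move=> p0 hp.
apply: (derive_le (dg := fun x => - sin x) (df := fun x => (deriv p).[x])) => [|x x0].
  by rewrite cos0.
by have := hp _ x0; lra.
Qed.

Local Notation sinT1 := ('X : {poly R}).
Local Notation cosT1 := (1 - 2^-1 *: 'X^2 : {poly R}).
Local Notation sinT2 := (sinT1 - 6^-1 *: 'X^3 : {poly R}).
Local Notation cosT2 := (cosT1 + 24^-1 *: 'X^4 : {poly R}).
Local Notation sinT3 := (sinT2 + 120^-1 *: 'X^5 : {poly R}).
Local Notation cosT3 := (cosT2 - (6 * 120)^-1 *: 'X^6 : {poly R}).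
Local Notation sinT4 := (sinT3 - (42 * 120)^-1 *: 'X^7 : {poly R}).

Ltac coefs := rewrite ?poly.derivE ?hornerE /= ?expr0n /=; lra.

(** Starting from [cos <= 1], integration from 0 turns each bound into the next, alternately for the
    sine and the cosine, up to degree 7. The factorials 720 and 5040 are written [6 * 120] and
    [42 * 120]. *)
Lemma sin_taylor x : 0 <= x -> sinT4.[x] <= sin x <= sinT3.[x].
Proof.
have h1 : forall x, 0 <= x -> sin x <= sinT1.[x].
  apply: sin_le_poly; first by coefs.
  by move=> y y0; have := cos_le1 y; coefs.
have h2 : forall x, 0 <= x -> cosT1.[x] <= cos x.
  apply: poly_le_cos; first by coefs.
  by move=> y y0; have := h1 _ y0; coefs.
have h3 : forall x, 0 <= x -> sinT2.[x] <= sin x.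
  apply: poly_le_sin; first by coefs.
  by move=> y y0; have := h2 _ y0; coefs.
have h4 : forall x, 0 <= x -> cos x <= cosT2.[x].
  apply: cos_le_poly; first by coefs.
  by move=> y y0; have := h3 _ y0; coefs.
have h5 : forall x, 0 <= x -> sin x <= sinT3.[x].
  apply: sin_le_poly; first by coefs.
  by move=> y y0; have := h4 _ y0; coefs.
have h6 : forall x, 0 <= x -> cosT3.[x] <= cos x.
  apply: poly_le_cos; first by coefs.
  by move=> y y0; have := h5 _ y0; coefs.
move=> x0; rewrite h5// andbT; apply: poly_le_sin x0; first by coefs.
by move=> y y0; have := h6 _ y0; coefs.
Qed.

(** By the triple angle formula [s = sin (pi / 6)] satisfies [3 s - 4 s^3 = 1], that is
    [(s + 1) (2 s - 1)^2 = 0], and [s > 0]. *)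
Lemma sin_pi6 : sin (pi / 6) = 2^-1 :> R.
Proof.
have pg := @pi_gt0 R; have p4 : pi / 2 < 2 :> R := pihalf_lt2 R.
set a := pi / 6; set s := sin a.
have s0 : 0 < s by apply: sin_gt0_pihalf; rewrite /a; apply/andP; split; lra.
have e1 : sin (a + (a + a)) = 1.
  have -> : a + (a + a) = pi / 2 by rewrite /a; field.
  exact: sin_pihalf.
have e2 := cos2Dsin2 a; rewrite sinD sinD cosD -/s in e1.
have e3 : cos a * cos a = 1 - s * s by rewrite -!expr2 -e2 -/s; ring.
have e5 : 3 * s * (cos a * cos a) - s * s * s = 1 by rewrite -[RHS]e1; ring.
rewrite e3 in e5.
have e4 : (s + 1) * (2 * s - 1) ^+ 2 = 0.
  have -> : (s + 1) * (2 * s - 1) ^+ 2 = 1 - (3 * s * (1 - s * s) - s * s * s) by ring.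
  by rewrite e5 subrr.
move/eqP: e4; rewrite mulf_eq0 gt_eqF ?addr_gt0//= expf_eq0/= subr_eq0 => /eqP h.
by apply: (mulfI (x := 2)) => //; rewrite h divff.
Qed.

Lemma sin_lt_half x : 0 <= x <= 1 -> sin x < 2^-1 -> x < pi / 6.
Proof.
have pg := @pi_gt0 R; have p2 := @pihalf_ge1 R.
move=> /andP[x0 x1] hx; rewrite ltNge; apply/negP => px.
have [y] := MVT_segment px (fun y _ => is_derive_sin y)
  (derivable_within_continuous (fun y _ => @ex_derive _ _ _ _ _ _ _ (is_derive_sin y))).
rewrite in_itv/= sin_pi6 => /andP[y1 y2] e.
have : 0 <= cos y * (x - pi / 6).
  apply: mulr_ge0; last by rewrite subr_ge0.
  by apply: cos_ge0_pihalf; apply/andP; split; lra.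
by rewrite -e; lra.
Qed.

Lemma sin_gt_half x : 0 <= x -> 2^-1 < sin x -> pi / 6 < x.
Proof.
have pg := @pi_gt0 R.
move=> x0 hx; rewrite ltNge; apply/negP => px.
have [y] := MVT_segment px (fun y _ => is_derive_sin y)
  (derivable_within_continuous (fun y _ => @ex_derive _ _ _ _ _ _ _ (is_derive_sin y))).
rewrite in_itv/= sin_pi6 => /andP[y1 y2] e.
have : 0 <= cos y * (pi / 6 - x).
  apply: mulr_ge0; last by rewrite subr_ge0.
  by apply: cos_ge0_pihalf; apply/andP; split; lra.
by rewrite -e; lra.
Qed.

Lemma pi_bounds : 3 + 14 / 100 + 12 / (100 * 100) < (pi : R) < 3 + 142 / 1000.
Proof.
apply/andP; split.
  have h : (3 + 14 / 100 + 12 / (100 * 100)) / 6 < pi / 6 :> R.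
    apply: sin_lt_half; first by apply/andP; split; lra.
    have [|_] := andP (@sin_taylor ((3 + 14 / 100 + 12 / (100 * 100)) / 6) _); first by lra.
    move/le_lt_trans; apply.
    by rewrite !hornerE /=; lra.
  by lra.
have h : pi / 6 < (3 + 142 / 1000) / 6 :> R.
  apply: sin_gt_half; first by lra.
  have [|+ _] := andP (@sin_taylor ((3 + 142 / 1000) / 6) _); first by lra.
  apply: lt_le_trans.
  by rewrite !hornerE /=; lra.
by lra.
Qed.

Lemma sqrt3_bounds : (173 + 1 / 5) / 100 <= Num.sqrt (3 : R) <= (173 + 21 / 100) / 100.
Proof.
have s0 := sqrtr_ge0 (3 : R); have s2 : Num.sqrt 3 * Num.sqrt 3 = 3 :> R.
  by rewrite -expr2 sqr_sqrtr.
move: (Num.sqrt 3) s0 s2 => s s0 s2; apply/andP; split.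
  rewrite leNgt; apply/negP => h.
  have : s * s <= (173 + 1 / 5) / 100 * ((173 + 1 / 5) / 100) by apply: ler_pM => //; exact: ltW.
  by lra.
rewrite leNgt; apply/negP => h.
have h0 : 0 <= (173 + 21 / 100) / 100 :> R by lra.
have : (173 + 21 / 100) / 100 * ((173 + 21 / 100) / 100) <= s * s.
  by apply: ler_pM => //; exact: ltW.
by lra.
Qed.

Lemma c2_bounds : `|c2 - (58 * 100 + 65) / (100 * 100)| <= 2 / (100 * 100) :> R.
Proof.
have /andP[p1 p2] := pi_bounds; have /andP[t1 t2] := sqrt3_bounds.
rewrite /c2; have p0 : 0 < 4 * (pi : R) by lra.
have h1 : 3 * Num.sqrt 3 / (4 * pi) <= (41 + 37 / 100) / 100 :> R.
  by rewrite ler_pdivrMr//; lra.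
have h2 : (41 + 33 / 100) / 100 <= 3 * Num.sqrt 3 / (4 * pi) :> R.
  by rewrite ler_pdivlMr//; lra.
move: h1 h2; clear; move: (3 * Num.sqrt 3 / _) => y h1 h2.
by rewrite ler_norml; apply/andP; split; lra.
Qed.

Lemma sqrt_le (a b : R) : 0 <= a -> 0 <= b -> (Num.sqrt a <= b) = (a <= b ^+ 2).
Proof.
by move=> a0 b0; rewrite -[in RHS](sqr_sqrtr a0) ler_pXn2r ?nnegrE ?sqrtr_ge0.
Qed.

Lemma sqrt_ge (a b : R) : 0 <= a -> 0 <= b -> (b <= Num.sqrt a) = (b ^+ 2 <= a).
Proof.
by move=> a0 b0; rewrite -[in RHS](sqr_sqrtr a0) ler_pXn2r ?nnegrE ?sqrtr_ge0.
Qed.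

Lemma eta_interval (eta : R) : 0 <= eta ->
  (pi * eta ^+ 2 / 2 \in `[5, 15]) =
  (eta \in `[Num.sqrt (10 / pi), Num.sqrt (30 / pi)]).
Proof.
move=> e0; have pg := @pi_gt0 R.
have a0 : 0 <= 10 / pi :> R by rewrite divr_ge0// ltW.
have b0 : 0 <= 30 / pi :> R by rewrite divr_ge0// ltW.
rewrite !in_itv/= sqrt_le// sqrt_ge//.
have -> : (10 / pi <= eta ^+ 2) = (10 <= eta ^+ 2 * pi) by rewrite ler_pdivrMr.
have -> : (eta ^+ 2 <= 30 / pi) = (eta ^+ 2 * pi <= 30) by rewrite ler_pdivlMr.
rewrite [pi * _]mulrC; move: (eta ^+ 2 * pi) => y; clear.
by congr (_ && _); apply/idP/idP; lra.
Qed.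

Lemma eta_lower : `|Num.sqrt (10 / pi) - 1784 / 1000| <= 1 / 2000 :> R.
Proof.
have pg := @pi_gt0 R; have /andP[p1 p2] := pi_bounds.
have a0 : 0 <= 10 / pi :> R by rewrite divr_ge0// ltW.
have h1 : (178 + 7 / 20) / 100 <= Num.sqrt (10 / pi) :> R.
  by rewrite (sqrt_ge a0); [rewrite ler_pdivlMr; [rewrite expr2; lra|lra]|lra].
have h2 : Num.sqrt (10 / pi) <= (178 + 9 / 20) / 100 :> R.
  by rewrite (sqrt_le a0); [rewrite ler_pdivrMr; [rewrite expr2; lra|lra]|lra].
move: h1 h2; clear; move: (Num.sqrt _) => y h1 h2.
by rewrite ler_norml; apply/andP; split; lra.
Qed.

Lemma eta_upper : `|Num.sqrt (30 / pi) - 3090 / 1000| <= 1 / 2000 :> R.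
Proof.
have pg := @pi_gt0 R; have /andP[p1 p2] := pi_bounds.
have a0 : 0 <= 30 / pi :> R by rewrite divr_ge0// ltW.
have h1 : (308 + 19 / 20) / 100 <= Num.sqrt (30 / pi) :> R.
  by rewrite (sqrt_ge a0); [rewrite ler_pdivlMr; [rewrite expr2; lra|lra]|lra].
have h2 : Num.sqrt (30 / pi) <= (309 + 1 / 20) / 100 :> R.
  by rewrite (sqrt_le a0); [rewrite ler_pdivrMr; [rewrite expr2; lra|lra]|lra].
move: h1 h2; clear; move: (Num.sqrt _) => y h1 h2.
by rewrite ler_norml; apply/andP; split; lra.
Qed.

End PiBounds.

(** * The inverse Jacobian *)

Section JacobianBound.
Context {R : realFieldType}.

Lemma cauchy3 (y1 y2 y3 m1 m2 m3 : R) :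
  (y1 * m1 + y2 * m2 + y3 * m3) ^+ 2 <=
  (y1 ^+ 2 + y2 ^+ 2 + y3 ^+ 2) * (m1 ^+ 2 + m2 ^+ 2 + m3 ^+ 2).
Proof.
rewrite -subr_ge0.
have -> : (y1 ^+ 2 + y2 ^+ 2 + y3 ^+ 2) * (m1 ^+ 2 + m2 ^+ 2 + m3 ^+ 2) -
  (y1 * m1 + y2 * m2 + y3 * m3) ^+ 2 =
  (y1 * m2 - y2 * m1) ^+ 2 + (y1 * m3 - y3 * m1) ^+ 2 + (y2 * m3 - y3 * m2) ^+ 2 by ring.
by rewrite !addr_ge0 ?sqr_ge0.
Qed.

(* [r] is the slope [f / kappa] of the third row at fixed [y1], and
   [Delta = d - e * r] the determinant of the reduced 2 x 2 system. *)
Lemma jacobian_solve (E al be d e ka r G a b p y1 y2 y3 : R) : 0 < E -> 0 < ka ->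
  d - e * r != 0 ->
  y1 = 2 * E * (b + al * a + be * p) ->
  y2 = d * a + e * p ->
  y3 = ka * (r * a + p) + G * y1 ->
  let D := d - e * r in
  [/\ a = y1 * (G * e / (ka * D)) + y2 * (1 / D) + y3 * (- e / (ka * D)),
      b = y1 * (1 / (2 * E) - G * ((al * e - be * d) / (ka * D)))
          + y2 * (- (al - be * r) / D) + y3 * ((al * e - be * d) / (ka * D)) &
      p = y1 * (- (G * d) / (ka * D)) + y2 * (- r / D) + y3 * (d / (ka * D))].
Proof.
move=> E0 k0 D0 -> -> ->; cbv zeta; have E1 : E != 0 by rewrite gt_eqF.
have k1 : ka != 0 by rewrite gt_eqF.
by split; field; rewrite ?E1 ?k1 ?D0.
Qed.

(** An upper bound for the squared Frobenius norm of the inverse. The entry of the form [u - v] is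
    split by [(u - v)^2 <= 2 u^2 + 2 v^2], which is the origin of [2 * G ^+ 2] and of
    [1 / (2 * E ^+ 2)]. *)
Definition frob (E al be d e ka r G : R) : R :=
  (1 + (al - be * r) ^+ 2 + r ^+ 2) / (d - e * r) ^+ 2
  + (1 + 2 * G ^+ 2) * ((e ^+ 2 + d ^+ 2 + (al * e - be * d) ^+ 2) /
      (ka * (d - e * r)) ^+ 2)
  + 1 / (2 * E ^+ 2).

(** Cauchy-Schwarz on each row of the inverse from [jacobian_solve]; [frob] exceeds the sum of the
    nine squared entries by three squares. *)
Lemma jacobian_frob (E al be d e ka r G a b p y1 y2 y3 : R) : 0 < E -> 0 < ka ->
  d - e * r != 0 ->
  y1 = 2 * E * (b + al * a + be * p) ->
  y2 = d * a + e * p ->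
  y3 = ka * (r * a + p) + G * y1 ->
  a ^+ 2 + b ^+ 2 + p ^+ 2 <=
  (y1 ^+ 2 + y2 ^+ 2 + y3 ^+ 2) * frob E al be d e ka r G.
Proof.
move=> E0 k0 D0 h1 h2 h3.
have [aE bE pE] := jacobian_solve E0 k0 D0 h1 h2 h3.
set N := y1 ^+ 2 + _ + _; have N0 : 0 <= N by rewrite !addr_ge0 ?sqr_ge0.
have E1 : E != 0 by rewrite gt_eqF.
have k1 : ka != 0 by rewrite gt_eqF.
clear h1 h2 h3; rewrite aE bE pE.
have := cauchy3 y1 y2 y3 (G * e / (ka * (d - e * r))) (1 / (d - e * r))
  (- e / (ka * (d - e * r))).
have := cauchy3 y1 y2 y3
  (1 / (2 * E) - G * ((al * e - be * d) / (ka * (d - e * r))))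
  (- (al - be * r) / (d - e * r)) ((al * e - be * d) / (ka * (d - e * r))).
have := cauchy3 y1 y2 y3 (- (G * d) / (ka * (d - e * r))) (- r / (d - e * r))
  (d / (ka * (d - e * r))).
rewrite -/N => h3 h2 h1; apply: le_trans (lerD (lerD h1 h2) h3) _.
rewrite -!mulrDr; apply: ler_wpM2l => //; rewrite -subr_ge0.
have -> : frob E al be d e ka r G -
  ((G * e / (ka * (d - e * r))) ^+ 2 + (1 / (d - e * r)) ^+ 2 +
      (- e / (ka * (d - e * r))) ^+ 2 +
   ((1 / (2 * E) - G * ((al * e - be * d) / (ka * (d - e * r)))) ^+ 2 +
    (- (al - be * r) / (d - e * r)) ^+ 2 +
    ((al * e - be * d) / (ka * (d - e * r))) ^+ 2) +
   ((- (G * d) / (ka * (d - e * r))) ^+ 2 + (- r / (d - e * r)) ^+ 2 +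
    (d / (ka * (d - e * r))) ^+ 2)) =
   (G * e / (ka * (d - e * r))) ^+ 2 + (G * d / (ka * (d - e * r))) ^+ 2 +
   (1 / (2 * E) + G * ((al * e - be * d) / (ka * (d - e * r)))) ^+ 2.
  by rewrite /frob; field; rewrite ?E1 ?k1 ?D0.
by rewrite !addr_ge0 ?sqr_ge0.
Qed.

(* The quotient increases with [rho], its derivative having the sign of
   [El * tp - Ep * tl]. *)
Lemma slope_ratio (El Ep tl tp rho r : R) : 0 < Ep -> 0 < tp ->
  0 < El * tp - Ep * tl -> 0 < tl - rho * tp -> `|r| <= rho ->
  [/\ 0 < tl - r * tp, tl - rho * tp <= tl - r * tp, 0 <= El - r * Ep &
    (El - r * Ep) / (tl - r * tp) <= (El - rho * Ep) / (tl - rho * tp)].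
Proof.
move=> Ep0 tp0 i0 D0; rewrite ler_norml => /andP[_ hr].
have rt : r * tp <= rho * tp by rewrite ler_pM2r.
have rE : r * Ep <= rho * Ep by rewrite ler_pM2r.
have D1 : 0 < tl - r * tp by lra.
have U0 : 0 <= El - rho * Ep.
  rewrite -(pmulr_lge0 _ tp0).
  have : Ep * (rho * tp) <= Ep * tl by rewrite ler_pM2l//; lra.
  by move=> ?; lra.
split => //; try lra.
rewrite ler_pdivrMr// mulrAC ler_pdivlMr// -subr_ge0.
have -> : (El - rho * Ep) * (tl - r * tp) - (El - r * Ep) * (tl - rho * tp) =
  (rho - r) * (El * tp - Ep * tl) by ring.
by apply: mulr_ge0; [rewrite subr_ge0|exact: ltW].
Qed.

(** The worst case is inserted: [rho] for [r] by [slope_ratio], 15 for [h], 1/2 for [ka], 1/4 for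
    [|G|]. This gives [9 / 2 = 9 / 8 * 4] in the second term; [1 / (2 * E ^+ 2)] is below [25 / 2],
    hence below 13. Multiplication by [c ^+ 2 * E ^+ 2 * (tl - rho * tp) ^+ 2] turns what remains
    into the last hypothesis. *)
Lemma frob_le (E El Ep S tl tp c h ka G rho r : R) :
  1 < 5 * E -> 0 < S -> 0 < c -> 0 <= h <= 15 -> 0 < Ep -> 0 < tp ->
  0 < El * tp - Ep * tl -> 0 < tl - rho * tp -> `|r| <= rho ->
  1 <= 2 * ka -> 4 * `|G| <= 1 ->
  S ^+ 4 * ((1 + rho ^+ 2) * E ^+ 2 + 15 ^+ 2 * (El - rho * Ep) ^+ 2)
   + 9 / 2 * c ^+ 2 * (E ^+ 2 * (tl ^+ 2 + tp ^+ 2) + 15 ^+ 2 * (El * tp - Ep * tl) ^+ 2)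
   <= (100 * 100 - 13) * (c ^+ 2 * E ^+ 2 * (tl - rho * tp) ^+ 2) ->
  frob E (h * El / E) (h * Ep / E) (c * tl / S ^+ 2) (c * tp / S ^+ 2) ka r G
    <= 100 * 100.
Proof.
move=> hE S0 c0 /andP[h0 h15] Ep0 tp0 i0 D0 hr hka hG fin.
have [D1 D01 U0 ratio] := slope_ratio Ep0 tp0 i0 D0 hr.
have E0 : 0 < E by lra.
have ka0 : 0 < ka by lra.
have E1 : E != 0 by rewrite gt_eqF.
have k1 : ka != 0 by rewrite gt_eqF.
have c1 : c != 0 by rewrite gt_eqF.
have S1 : S != 0 by rewrite gt_eqF.
have D1' : tl - r * tp != 0 by rewrite gt_eqF.
have D0' : tl - rho * tp != 0 by rewrite gt_eqF.
pose D := tl - rho * tp; pose D' := tl - r * tp.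
pose U := El - rho * Ep; pose U' := El - r * Ep.
pose i2 := El * tp - Ep * tl.
have -> : frob E (h * El / E) (h * Ep / E) (c * tl / S ^+ 2) (c * tp / S ^+ 2) ka r G =
  (S ^+ 2 / c) ^+ 2 * ((1 + r ^+ 2) * (1 / D') ^+ 2 + (h / E) ^+ 2 * (U' / D') ^+ 2)
  + (1 + 2 * G ^+ 2) * (1 / ka) ^+ 2 *
      ((tl ^+ 2 + tp ^+ 2 + (h / E) ^+ 2 * i2 ^+ 2) * (1 / D') ^+ 2) + 1 / (2 * E ^+ 2).
  rewrite /frob.
  have -> : c * tl / S ^+ 2 - c * tp / S ^+ 2 * r = c / S ^+ 2 * D' by rewrite /D'; ring.
  have -> : h * El / E - h * Ep / E * r = h / E * U' by rewrite /U'; ring.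
  have -> : h * El / E * (c * tp / S ^+ 2) - h * Ep / E * (c * tl / S ^+ 2) =
    h / E * (c / S ^+ 2) * i2 by rewrite /i2; ring.
  by rewrite -/D' in D1'; move: D' U' i2 D1' => v u i v0; field; rewrite E1 k1 c1 S1 v0.
have a1 : (1 / D') ^+ 2 <= (1 / D) ^+ 2.
  rewrite !div1r !exprVn lef_pV2 ?posrE ?exprn_gt0//.
  by apply: lerXn2r; rewrite ?nnegrE; [exact: (ltW D0)|exact: (ltW D1)|exact: D01].
have a2 : (U' / D') ^+ 2 <= (U / D) ^+ 2.
  have h1 : 0 <= U' / D' by apply: divr_ge0 => //; exact: (ltW D1).
  by apply: lerXn2r; rewrite ?nnegrE//; exact: le_trans ratio.
have a3 : r ^+ 2 <= rho ^+ 2.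
  have rho0 : 0 <= rho by apply: le_trans hr.
  by rewrite -[r ^+ 2]real_normK ?num_real//; apply: lerXn2r; rewrite ?nnegrE.
have a4 : (h / E) ^+ 2 <= (15 / E) ^+ 2.
  have h1 : 0 <= h / E by apply: divr_ge0 => //; exact: (ltW E0).
  have h2 : h / E <= 15 / E by rewrite ler_pM2r ?invr_gt0.
  by apply: lerXn2r => //; rewrite nnegrE//; exact: le_trans h2.
have a5 : (1 / ka) ^+ 2 <= 2 ^+ 2.
  have h1 : 0 <= 1 / ka by apply: divr_ge0 => //; exact: (ltW ka0).
  by apply: lerXn2r => //; rewrite ?nnegrE// ler_pdivrMr.
have a6 : 1 + 2 * G ^+ 2 <= 9 / 8.
  have : (4 * `|G|) ^+ 2 <= 1 by rewrite expr_le1// mulr_ge0.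
  by rewrite exprMn real_normK ?num_real// => ?; lra.
have a7 : 1 / (2 * E ^+ 2) <= 13.
  have EE : 1 < (5 * E) ^+ 2 by rewrite exprn_egt1.
  rewrite exprMn in EE; rewrite ler_pdivrMr ?mulr_gt0 ?exprn_gt0//; lra.
have sq (x : R) : 0 <= x ^+ 2 by exact: sqr_ge0.
apply: (@le_trans _ _ ((S ^+ 2 / c) ^+ 2 *
    ((1 + rho ^+ 2) * (1 / D) ^+ 2 + (15 / E) ^+ 2 * (U / D) ^+ 2)
  + (9 / 8) * 2 ^+ 2 *
      ((tl ^+ 2 + tp ^+ 2 + (15 / E) ^+ 2 * i2 ^+ 2) * (1 / D) ^+ 2) + 13)).
  apply: lerD => //; apply: lerD.
    apply: ler_wpM2l => //; apply: lerD; apply: ler_pM => //.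
      by rewrite addr_ge0.
    by rewrite lerD2l.
  have q1 : 0 <= tl ^+ 2 + tp ^+ 2 + (h / E) ^+ 2 * i2 ^+ 2.
    by apply: addr_ge0; [exact: addr_ge0|exact: mulr_ge0].
  apply: ler_pM.
  - by apply: mulr_ge0 => //; apply: addr_ge0 => //; exact: mulr_ge0.
  - exact: mulr_ge0.
  - by apply: ler_pM => //; apply: addr_ge0 => //; exact: mulr_ge0.
  - by apply: ler_pM => //; rewrite lerD2l ler_wpM2r.
have P0 : 0 < c ^+ 2 * E ^+ 2 * D ^+ 2 by rewrite !mulr_gt0 ?exprn_gt0.
rewrite -lerBrDr -(ler_pM2r P0); apply: le_trans fin.
rewrite le_eqVlt; apply/orP; left; apply/eqP.
by rewrite -/D -/U -/i2; field; rewrite E1 c1 D0'.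
Qed.

(** [a], [b], [p] are the components of a vector in [lambda], [etat = x / 2] and [psi]. The reduced
    system has [h = x / 2], slope [r = wl / wp], [ka = wp / Dn ^+ 2] and [G = A / Dn ^+ 2]. *)
Lemma jacobian_bound (E El Ep S tl tp c x wl wp Dn A rho a b p y1 y2 y3 : R) :
  1 < 5 * E -> 0 < S -> 0 < c -> 0 <= x <= 30 -> 0 < Ep -> 0 < tp ->
  0 < El * tp - Ep * tl -> 0 < tl - rho * tp -> 0 < Dn ->
  Dn ^+ 2 <= 2 * wp -> `|wl| <= rho * wp -> 4 * `|A| <= Dn ^+ 2 ->
  S ^+ 4 * ((1 + rho ^+ 2) * E ^+ 2 + 15 ^+ 2 * (El - rho * Ep) ^+ 2)
   + 9 / 2 * c ^+ 2 * (E ^+ 2 * (tl ^+ 2 + tp ^+ 2) + 15 ^+ 2 * (El * tp - Ep * tl) ^+ 2)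
   <= (100 * 100 - 13) * (c ^+ 2 * E ^+ 2 * (tl - rho * tp) ^+ 2) ->
  y1 = x * El * a + 2 * E * b + x * Ep * p ->
  y2 = c * tl / S ^+ 2 * a + c * tp / S ^+ 2 * p ->
  y3 = wl / Dn ^+ 2 * a + wp / Dn ^+ 2 * p + A / Dn ^+ 2 * y1 ->
  a ^+ 2 + b ^+ 2 + p ^+ 2 <= 100 * 100 * (y1 ^+ 2 + y2 ^+ 2 + y3 ^+ 2).
Proof.
move=> hE S0 c0 hx Ep0 tp0 i0 D0 Dn0 hwp hwl hA fin h1 h2 h3.
have E0 : 0 < E by lra.
have Q0 : 0 < Dn ^+ 2 by rewrite exprn_gt0.
have wp0 : 0 < wp by lra.
have hr : `|wl / wp| <= rho by rewrite normrM normfV (gtr0_norm wp0) ler_pdivrMr.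
have hh : 0 <= x / 2 <= 15 by lra.
have hka : 1 <= 2 * (wp / Dn ^+ 2) by rewrite mulrA ler_pdivlMr// mul1r.
have hG : 4 * `|A / Dn ^+ 2| <= 1.
  by rewrite normrM normfV (gtr0_norm Q0) mulrA ler_pdivrMr// mul1r.
have F := frob_le hE S0 c0 hh Ep0 tp0 i0 D0 hr hka hG fin.
have ka0 : 0 < wp / Dn ^+ 2 by rewrite divr_gt0.
have [D1 _ _ _] := slope_ratio Ep0 tp0 i0 D0 hr.
have D1' : c * tl / S ^+ 2 - c * tp / S ^+ 2 * (wl / wp) != 0.
  have -> : c * tl / S ^+ 2 - c * tp / S ^+ 2 * (wl / wp) =
    c / S ^+ 2 * (tl - wl / wp * tp) by ring.
  by rewrite gt_eqF// mulr_gt0// divr_gt0// exprn_gt0.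
have h1' : y1 = 2 * E * (b + x / 2 * El / E * a + x / 2 * Ep / E * p).
  by rewrite h1; field; rewrite gt_eqF.
have h3' : y3 = wp / Dn ^+ 2 * (wl / wp * a + p) + A / Dn ^+ 2 * y1.
  by rewrite h3; field; rewrite !gt_eqF.
apply: le_trans (jacobian_frob E0 ka0 D1' h1' h2 h3') _.
by rewrite mulrC; apply: ler_wpM2r => //; rewrite !addr_ge0 ?sqr_ge0.
Qed.

End JacobianBound.

(** * The certified inequalities at a point *)

Section PointFacts.
Context {R : realType}.
Implicit Types x : R.

(* [rnum] is the numerator, over the squared denominator of
   [r2], of the derivative of [r2] along [v] at constant mean degree. *)
Definition rnum (x c E Ev S Sv T Tv A Av B Bv : R) : R :=
  x ^+ 2 * (Av * B - A * Bv)
  + x * (Av * (S * E) - A * (Sv * E + 2 * (S * Ev))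
         + c * ((Tv * E + 2 * (T * Ev)) * B - T * E * Bv))
  + c * E ^+ 2 * (Tv * S - T * Sv).

(** The letters [l] and [p] denote partial derivatives in [lambda] and [psi]; [A] and [B] are
    [P E - S^2] and [Q E - S^2]. The bound [pf_A] is taken at [x = 0] of the denominator of [r2],
    and [pf_final] is the Frobenius bound in the form required by [frob_le]. *)
Record point_facts (E El Ep S Sl Sp T Tl Tp A Al Ap B Bl Bp c rho : R) : Prop :=
  PointFacts {
    pf_E : 1 < 5 * E;
    pf_E7 : 12 * E < 7;
    pf_Ep : 0 < Ep;
    pf_S : 0 < S;
    pf_tp : 0 < Tp * S - T * Sp;
    pf_B : 0 < B;
    pf_i2 : 0 < El * (Tp * S - T * Sp) - Ep * (Tl * S - T * Sl);
    pf_D : 0 < Tl * S - T * Sl - rho * (Tp * S - T * Sp);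
    pf_A : 4 * `|A * S - c * (T * B)| <= (S * E) ^+ 2;
    pf_final :
      S ^+ 4 * ((1 + rho ^+ 2) * E ^+ 2 + 15 ^+ 2 * (El - rho * Ep) ^+ 2)
      + 9 / 2 * c ^+ 2 * (E ^+ 2 * ((Tl * S - T * Sl) ^+ 2 + (Tp * S - T * Sp) ^+ 2)
        + 15 ^+ 2 * (El * (Tp * S - T * Sp) - Ep * (Tl * S - T * Sl)) ^+ 2)
      <= (100 * 100 - 13)
        * (c ^+ 2 * E ^+ 2 * (Tl * S - T * Sl - rho * (Tp * S - T * Sp)) ^+ 2);
    pf_wp : forall x, 10 <= x <= 30 ->
      (x * B + S * E) ^+ 2 <= 2 * rnum x c E Ep S Sp T Tp A Ap B Bp;
    pf_wl : forall x, 10 <= x <= 30 ->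
      `|rnum x c E El S Sl T Tl A Al B Bl|
        <= rho * rnum x c E Ep S Sp T Tp A Ap B Bp }.

(** On [10, 30] a quadratic is a combination of its Bernstein coefficients with nonnegative weights.
    The middle one is the polar form at 10 and 30: 20 is their mean and 300 their product. *)
Lemma bern_ge0 (q0 q1 q2 x : R) : 10 <= x <= 30 ->
  0 < q0 + (10 * q1 + 100 * q2) -> 0 < q0 + (20 * q1 + 300 * q2) ->
  0 < q0 + (30 * q1 + 900 * q2) -> 0 <= q0 + q1 * x + q2 * x ^+ 2.
Proof.
move=> /andP[x1 x2] h0 h1 h2.
have u0 : 0 <= x - 10 by lra.
have v0 : 0 <= 30 - x by lra.
have -> : q0 + q1 * x + q2 * x ^+ 2 =
  ((q0 + (10 * q1 + 100 * q2)) * (30 - x) ^+ 2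
   + 2 * (q0 + (20 * q1 + 300 * q2)) * ((x - 10) * (30 - x))
   + (q0 + (30 * q1 + 900 * q2)) * (x - 10) ^+ 2) / (20 * 20) by field.
move: (q0 + _) (q0 + _) (q0 + _) h0 h1 h2 => b0 b1 b2 h0 h1 h2.
apply: divr_ge0; last by apply: mulr_ge0.
apply: addr_ge0; [apply: addr_ge0|]; apply: mulr_ge0.
- exact: ltW.
- exact: sqr_ge0.
- by apply: mulr_ge0 => //; exact: ltW.
- exact: mulr_ge0.
- exact: ltW.
- exact: sqr_ge0.
Qed.

(** Replaces a [let] by a variable with an equation, so that the intermediate values of
    [cell_checks] stay folded during the algebra. *)
Lemma let_elim A (P : A -> Prop) a : (forall y, y = a -> P y) -> P a.
Proof. exact. Qed.

Ltac unlet := lazymatch goal with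
  |- is_true (all ?p (let x := ?a in @?f x)) -> ?Q =>
    refine (@let_elim _ (fun x => is_true (all p (f x)) -> Q) a _);
    let v := fresh x in let e := fresh "e" x in intros v e; cbv beta
  end.

Lemma zr10 : zr 10 = 10 :> R. Proof. by rewrite !(zr_xI, zr_xO) zr1; ring. Qed.
Lemma zr100 : zr 100 = 100 :> R. Proof. by rewrite !(zr_xI, zr_xO) zr1; ring. Qed.
Lemma zr20 : zr 20 = 20 :> R. Proof. by rewrite !(zr_xI, zr_xO) zr1; ring. Qed.
Lemma zr300 : zr 300 = 300 :> R. Proof. by rewrite !(zr_xI, zr_xO) zr1; ring. Qed.
Lemma zr30 : zr 30 = 30 :> R. Proof. by rewrite !(zr_xI, zr_xO) zr1; ring. Qed.
Lemma zr900 : zr 900 = 900 :> R. Proof. by rewrite !(zr_xI, zr_xO) zr1; ring. Qed.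

Lemma bern_rtops (q0 q1 q2 x : R) : 10 <= x <= 30 ->
  all (fun y => 0 < y) (bern rtops q0 q1 q2) -> 0 <= q0 + q1 * x + q2 * x ^+ 2.
Proof.
move=> hx; rewrite /bern /= zr10 zr100 zr20 zr300 zr30 zr900.
by case/and4P => *; exact: bern_ge0.
Qed.

(** Only the scaling has to be undone. Slopes enter multiplied by 5 and [k = 320 * rho], so [u] and
    [d] carry the factor [320 = 5 * 64]. The last inequality is multiplied by [2 * 320^2]; its
    coefficient [36864] is [9 * 320^2 / 25], and [19974] is [2 * (10000 - 13)]. *)
Lemma cell_checks_facts (E El Ep S Sl Sp T Tl Tp P Pl Pp Q Ql Qp c : R) (k : Z) :
  all (fun y => 0 < y) (cell_checks rtops
    (Jet E (5 * El) Ep S (5 * Sl) Sp T (5 * Tl) Tp P (5 * Pl) Pp Q (5 * Ql) Qp) c k) ->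
  point_facts E El Ep S Sl Sp T Tl Tp
    (P * E - S ^+ 2) (Pl * E + P * El - 2 * (S * Sl)) (Pp * E + P * Ep - 2 * (S * Sp))
    (Q * E - S ^+ 2) (Ql * E + Q * El - 2 * (S * Sl)) (Qp * E + Q * Ep - 2 * (S * Sp))
    c (zr k / 320).
Proof.
cbv delta [cell_checks]; cbv beta match; do 32 unlet.
rewrite !all_cat => /and4P[h hwp hm hp]; move: h; rewrite [all _ _]/=.
set K : R := zr k.
have z1 : zr 1 = 1 :> R := zr1. have z2 : zr 2 = 2 :> R := zr2.
have z4 : zr 4 = 4 :> R by rewrite !(zr_xI, zr_xO) zr1; ring.
have z5 : zr 5 = 5 :> R by rewrite !(zr_xI, zr_xO) zr1; ring.
have z7 : zr 7 = 7 :> R by rewrite !(zr_xI, zr_xO) zr1; ring.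
have z12 : zr 12 = 12 :> R by rewrite !(zr_xI, zr_xO) zr1; ring.
have z25 : zr 25 = 25 :> R by rewrite !(zr_xI, zr_xO) zr1; ring.
have z64 : zr 64 = 64 :> R by rewrite !(zr_xI, zr_xO) zr1; ring.
have z225 : zr 225 = 15 * 15 :> R by rewrite !(zr_xI, zr_xO) zr1; ring.
have zf : zr 19974 = 2 * (100 * 100 - 13) :> R by rewrite !(zr_xI, zr_xO) zr1; ring.
have zg : zr 36864 = 192 * 192 :> R by rewrite !(zr_xI, zr_xO) zr1; ring.
have zk : zr (Z.add 102400 (Z.mul k k)) = 320 * 320 + K * K :> R.
  rewrite zrD zrM; congr (_ + _).
  by rewrite !(zr_xI, zr_xO) zr1; ring.
rewrite z1 z5 z7 z12.
case/and5P => hE hE7 hEp hS /and5P[hSp htp hB hi2 /and5P[hd hz1 hz2 hfin _]].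
have Xe : P * E - S ^+ 2 = X by rewrite eX eS2 expr2.
have Ye : Q * E - S ^+ 2 = Y by rewrite eY eS2 expr2.
have Xle : Xl = 5 * (Pl * E + P * El - 2 * (S * Sl)).
  by rewrite eXl eSSl /= z2; ring.
have Yle : Yl = 5 * (Ql * E + Q * El - 2 * (S * Sl)).
  by rewrite eYl eSSl /= z2; ring.
have Xpe : Pp * E + P * Ep - 2 * (S * Sp) = Xp by rewrite eXp eSSp /= z2; ring.
have Ype : Qp * E + Q * Ep - 2 * (S * Sp) = Yp by rewrite eYp eSSp /= z2; ring.
rewrite Xe Ye Xpe Ype; move: (Pl * E + _ - _) Xle => Xl' Xle.
move: (Ql * E + _ - _) Yle => Yl' Yle.
have tpe : Tp * S - T * Sp = tp by rewrite etp.
have tle : tl = 5 * (Tl * S - T * Sl) by rewrite etl /=; ring.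
have i2e : i2 = 5 * (El * tp - Ep * (Tl * S - T * Sl)) by rewrite ei2 tle /=; ring.
have de : d = 320 * (Tl * S - T * Sl - K / 320 * tp).
  by rewrite ed tle /= z64 -/K; field.
have ue : u = 320 * (El - K / 320 * Ep) by rewrite eu /= z64 -/K; field.
have wp0e : wp0 = c * E ^+ 2 * tp by rewrite ewp0 ecE2 eE2 /=; ring.
have wl0e : wl0 = 5 * (c * E ^+ 2 * (Tl * S - T * Sl)).
  by rewrite ewl0 ecE2 eE2 tle /=; ring.
have rp x : rnum x c E Ep S Sp T Tp X Xp Y Yp = x ^+ 2 * wp2 + x * wp1 + wp0.
  by rewrite /rnum tpe -wp0e ewp1 ewp2 eSE eTE /= z2; ring.
have rl x : 5 * rnum x c E El S Sl T Tl X Xl' Y Yl' = x ^+ 2 * wl2 + x * wl1 + wl0.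
  by rewrite /rnum wl0e ewl1 ewl2 eSE eTE /= z2 Xle Yle; ring.
have h320 : 0 < 320 :> R by rewrite ltr0n.
constructor.
- by rewrite subr_gt0 in hE.
- by rewrite subr_gt0 in hE7.
- exact: hEp.
- exact: hS.
- by rewrite tpe.
- exact: hB.
- by move: hi2; rewrite i2e tpe pmulr_rgt0.
- by move: hd; rewrite de tpe (pmulr_rgt0 _ h320).
- move: hz1 hz2; rewrite ez eSE2 eSE /= z4 -expr2 subr_gt0 => hz1 hz2.
  rewrite -[4]ger0_norm// -normrM ler_norml; apply/andP; split; last exact: ltW.
  by rewrite -subr_ge0 opprK addrC; exact: ltW.
- rewrite tpe; move: hfin; rewrite elhs /= z2 zk z25 z225 zf zg i2e de ue tle.
  rewrite eccE2 ecc eE2 eS4 eS2 /= => hfin.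
  have h0 : 0 < 2 * (320 * 320) :> R.
    by apply: mulr_gt0; [rewrite ltr0n|exact: mulr_gt0].
  rewrite -subr_ge0 -(pmulr_rge0 _ h0).
  by apply: ltW; move: hfin; congr (_ < _); field.
- move=> x hx; rewrite rp -subr_ge0; have := bern_rtops hx hwp.
  by rewrite eSE2 eSEY eY2 /= z2; congr (_ <= _); rewrite eSE /=; ring.
- move=> x hx; have := bern_rtops hx hm; have := bern_rtops hx hp.
  have rl' : rnum x c E El S Sl T Tl X Xl' Y Yl' = (x ^+ 2 * wl2 + x * wl1 + wl0) / 5.
    by rewrite -rl; field.
  rewrite rp rl' /= z64 -/K; move: (K) => kk h1 h2.
  rewrite ler_norml; apply/andP; split.
    rewrite -subr_ge0 -(pmulr_rge0 _ h320).
    by move: h1; congr (_ <= _); field.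
  rewrite -subr_ge0 -(pmulr_rge0 _ h320).
  by move: h2; congr (_ <= _); field.
Qed.

End PointFacts.

(** * Derivatives along curves *)

Section CurveCalculus.
Context {R : realType}.
Implicit Types (t : R) (f g : R -> R).

Lemma is_derive_add f g t df dg : is_derive t 1 f df -> is_derive t 1 g dg ->
  is_derive t 1 (fun s => f s + g s) (df + dg).
Proof. exact: is_deriveD. Qed.

Lemma is_derive_sub f g t df dg : is_derive t 1 f df -> is_derive t 1 g dg ->
  is_derive t 1 (fun s => f s - g s) (df - dg).
Proof. exact: is_deriveB. Qed.

Lemma is_derive_mul f g t df dg : is_derive t 1 f df -> is_derive t 1 g dg ->
  is_derive t 1 (fun s => f s * g s) (df * g t + f t * dg).
Proof.
move=> hf hg; have := @is_deriveM _ _ f g t 1 _ _ hf hg.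
by move/is_derive_eq; apply; rewrite /GRing.scale /= addrC mulrC.
Qed.

Lemma is_derive_cmul (a : R) f t df : is_derive t 1 f df ->
  is_derive t 1 (fun s => a * f s) (a * df).
Proof. exact: is_deriveZ. Qed.

Lemma is_derive_div f g t df dg : g t != 0 ->
  is_derive t 1 f df -> is_derive t 1 g dg ->
  is_derive t 1 (fun s => f s / g s) ((df * g t - f t * dg) / g t ^+ 2).
Proof.
move=> g0 hf hg; have hV := is_deriveV g0 hg.
have := is_derive_mul hf hV; move/is_derive_eq; apply.
by rewrite /GRing.scale /=; field.
Qed.

Definition lin2 (F G : R -> R) (l p : R) := F l + p * G l.
Definition quad2 (F G H : R -> R) (l p : R) := F l + p * (G l + p * H l).

Lemma is_derive_lin2 F G (l p : R -> R) t dl dp :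
  derivable F (l t) 1 -> derivable G (l t) 1 ->
  is_derive t 1 l dl -> is_derive t 1 p dp ->
  is_derive t 1 (fun s => lin2 F G (l s) (p s))
    (lin2 (derive1 F) (derive1 G) (l t) (p t) * dl + G (l t) * dp).
Proof.
move=> dF dG hl hp.
have hF := @is_derive1_comp _ F l t _ _ (derivableP dF) hl.
have hG := @is_derive1_comp _ G l t _ _ (derivableP dG) hl.
have := is_derive_add hF (is_derive_mul hp hG); move/is_derive_eq; apply.
by rewrite /lin2 !derive1E /=; ring.
Qed.

Lemma is_derive_quad2 F G H (l p : R -> R) t dl dp :
  derivable F (l t) 1 -> derivable G (l t) 1 -> derivable H (l t) 1 ->
  is_derive t 1 l dl -> is_derive t 1 p dp ->
  is_derive t 1 (fun s => quad2 F G H (l s) (p s))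
    (quad2 (derive1 F) (derive1 G) (derive1 H) (l t) (p t) * dl
     + (G (l t) + 2 * (p t * H (l t))) * dp).
Proof.
move=> dF dG dH hl hp.
have hF := @is_derive1_comp _ F l t _ _ (derivableP dF) hl.
have hG := is_derive_lin2 dG dH hl hp.
have := is_derive_add hF (is_derive_mul hp hG); move/is_derive_eq; apply.
by rewrite /lin2 /quad2 !derive1E /=; ring.
Qed.

Definition rratio (c x E S T P Q : R) : R :=
  (x * (P * E - S ^+ 2) + c * T * E) / (x * (Q * E - S ^+ 2) + S * E).

(** The variation of [x] is expressed by that of [ell = x E]: the partial derivative in [x] is
    [E (A S - c T B) / D^2], and [E dx] is [d ell - x dE]. What is left over is [rnum]. *)
Lemma is_derive_rratio (c : R) (x E S T P Q : R -> R) t dx dE dS dT dP dQ :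
  x t * (Q t * E t - S t ^+ 2) + S t * E t != 0 ->
  is_derive t 1 x dx -> is_derive t 1 E dE -> is_derive t 1 S dS ->
  is_derive t 1 T dT -> is_derive t 1 P dP -> is_derive t 1 Q dQ ->
  is_derive t 1 (fun s => rratio c (x s) (E s) (S s) (T s) (P s) (Q s))
   (let A := P t * E t - S t ^+ 2 in let B := Q t * E t - S t ^+ 2 in
    let D := x t * B + S t * E t in
    rnum (x t) c (E t) dE (S t) dS (T t) dT
      A (dP * E t + P t * dE - 2 * (S t * dS))
      B (dQ * E t + Q t * dE - 2 * (S t * dS)) / D ^+ 2
    + (A * S t - c * (T t * B)) / D ^+ 2 * (dx * E t + x t * dE)).
Proof.
move=> D0 hx hE hS hT hP hQ.
have hSS := is_derive_mul hS hS.
have hA := is_derive_sub (is_derive_mul hP hE) hSS.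
have hB := is_derive_sub (is_derive_mul hQ hE) hSS.
have hN := is_derive_add (is_derive_mul hx hA)
  (is_derive_mul (is_derive_cmul c hT) hE).
have hD := is_derive_add (is_derive_mul hx hB) (is_derive_mul hS hE).
have D1 : x t * (Q t * E t - S t * S t) + S t * E t != 0 by rewrite -expr2.
have := (fun nz => is_derive_div nz hN hD) D1; cbv zeta.
have -> : (fun s => rratio c (x s) (E s) (S s) (T s) (P s) (Q s)) =
  (fun s => (x s * (P s * E s - S s * S s) + c * T s * E s) /
            (x s * (Q s * E s - S s * S s) + S s * E s)).
  by apply/funext => s; rewrite /rratio !expr2.
move/is_derive_eq; apply; rewrite !expr2 in D0 *.
move: (x t) (E t) (S t) (T t) (P t) (Q t) D0 => x0 E0 S0 T0 P0 Q0 D0.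
by rewrite /rnum; field.
Qed.

Lemma is_derive_rratio_dir (c : R) (x E S T P Q : R -> R)
    (t dx dl dp El Ep Sl Sp Tl Tp Pl Pp Ql Qp : R) :
  let A := P t * E t - S t ^+ 2 in let B := Q t * E t - S t ^+ 2 in
  let D := x t * B + S t * E t in
  D != 0 -> is_derive t 1 x dx ->
  is_derive t 1 E (El * dl + Ep * dp) -> is_derive t 1 S (Sl * dl + Sp * dp) ->
  is_derive t 1 T (Tl * dl + Tp * dp) -> is_derive t 1 P (Pl * dl + Pp * dp) ->
  is_derive t 1 Q (Ql * dl + Qp * dp) ->
  is_derive t 1 (fun s => rratio c (x s) (E s) (S s) (T s) (P s) (Q s))
   (rnum (x t) c (E t) El (S t) Sl (T t) Tl
      A (Pl * E t + P t * El - 2 * (S t * Sl))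
      B (Ql * E t + Q t * El - 2 * (S t * Sl)) / D ^+ 2 * dl
    + rnum (x t) c (E t) Ep (S t) Sp (T t) Tp
      A (Pp * E t + P t * Ep - 2 * (S t * Sp))
      B (Qp * E t + Q t * Ep - 2 * (S t * Sp)) / D ^+ 2 * dp
    + (A * S t - c * (T t * B)) / D ^+ 2 *
      (x t * El * dl + 2 * E t * (dx / 2) + x t * Ep * dp)).
Proof.
move=> A B D D0 hx hE hS hT hP hQ.
have := (fun nz => is_derive_rratio c nz hx hE hS hT hP hQ) D0.
move/is_derive_eq; apply; cbv zeta; rewrite -/A -/B -/D; move: (D ^+ 2)^-1 => i.
rewrite /rnum; clear D0 D; clearbody A B; move: (x t) (E t) (S t) (T t) (P t) (Q t).
by move=> x0 E0 S0 T0 P0 Q0; field.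
Qed.

End CurveCalculus.

(** * The map on the box *)

Local Opaque cell_checks.

Section BoxFacts.
Context {R : realType}.
Implicit Types (lam psi x : R).

Lemma motif_derivable (k : nat) lam : (k < 12)%N -> 0 < lam < 6 ->
  derivable (nth (fun=> 0) (@motif_funs R) k) lam 1.
Proof. by move=> k12 hl; have [h _] := @motif_funs_close R k k12; exact: h. Qed.

Definition mE := lin2 (@E0f R) E1f.
Definition mS := lin2 (@S0f R) S1f.
Definition mT := lin2 (@T0f R) T1f.
Definition mP := quad2 (@P0f R) P1f P2f.
Definition mQ := quad2 (@Q0f R) Q1f Q2f.
Definition mEl := lin2 (derive1 (@E0f R)) (derive1 E1f).
Definition mSl := lin2 (derive1 (@S0f R)) (derive1 S1f).
Definition mTl := lin2 (derive1 (@T0f R)) (derive1 T1f).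
Definition mPl := quad2 (derive1 (@P0f R)) (derive1 P1f) (derive1 P2f).
Definition mQl := quad2 (derive1 (@Q0f R)) (derive1 Q1f) (derive1 Q2f).
Definition mPp lam psi : R := P1f lam + 2 * (psi * P2f lam).
Definition mQp lam psi : R := Q1f lam + 2 * (psi * Q2f lam).

Lemma jet_of_motifs lam psi :
  jet_of rtops (motif_values lam) (motif_slopes lam) psi =
  Jet (mE lam psi) (5 * mEl lam psi) (E1f lam) (mS lam psi) (5 * mSl lam psi)
    (S1f lam) (mT lam psi) (5 * mTl lam psi) (T1f lam)
    (mP lam psi) (5 * mPl lam psi) (mPp lam psi)
    (mQ lam psi) (5 * mQl lam psi) (mQp lam psi).
Proof.
have z2 : zr 2 = 2 :> R := zr2.
by rewrite /jet_of /motif_values /motif_slopes /mEl /mSl /mTl /mPl /mQl /mPp /mQp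
  /lin2 /quad2; congr Jet => //=; rewrite ?z2; ring.
Qed.

Definition mA lam psi := mP lam psi * mE lam psi - mS lam psi ^+ 2.
Definition mB lam psi := mQ lam psi * mE lam psi - mS lam psi ^+ 2.
Definition mAl lam psi :=
  mPl lam psi * mE lam psi + mP lam psi * mEl lam psi - 2 * (mS lam psi * mSl lam psi).
Definition mBl lam psi :=
  mQl lam psi * mE lam psi + mQ lam psi * mEl lam psi - 2 * (mS lam psi * mSl lam psi).
Definition mAp lam psi :=
  mPp lam psi * mE lam psi + mP lam psi * E1f lam - 2 * (mS lam psi * S1f lam).
Definition mBp lam psi :=
  mQp lam psi * mE lam psi + mQ lam psi * E1f lam - 2 * (mS lam psi * S1f lam).

Lemma box_facts lam psi : 1 <= lam <= 5 -> 0 <= psi <= 3 / 20 ->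
  exists rho, point_facts (mE lam psi) (mEl lam psi) (E1f lam)
    (mS lam psi) (mSl lam psi) (S1f lam) (mT lam psi) (mTl lam psi) (T1f lam)
    (mA lam psi) (mAl lam psi) (mAp lam psi) (mB lam psi) (mBl lam psi) (mBp lam psi)
    c2 rho.
Proof.
move=> hl hp; have hc : `|c2 - zr 5865 / zr 10000| <= 2 / zr 10000 :> R.
  have -> : zr 5865 = 58 * 100 + 65 :> R by rewrite !(zr_xI, zr_xO) zr1; ring.
  have -> : zr 10000 = 100 * 100 :> R by rewrite !(zr_xI, zr_xO) zr1; ring.
  exact: c2_bounds.
have [k] := motif_certificate hl hp hc; rewrite jet_of_motifs => h.
by exists (zr k / 320); exact: (cell_checks_facts h).
Qed.

End BoxFacts.

Section CurveBound.
Context {R : realType}.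
Implicit Types (lam psi x : R).

Definition ellR lam x psi : R := x * mE lam psi.
Definition cR lam psi : R := c2 * (mT lam psi / mS lam psi).
Definition rR lam x psi : R :=
  rratio c2 x (mE lam psi) (mS lam psi) (mT lam psi) (mP lam psi) (mQ lam psi).

Lemma c2_gt0 : 0 < c2 :> R.
Proof.
have := c2_bounds (R := R); rewrite ler_norml => /andP[h _].
by move: h; move: c2 => c; clear; lra.
Qed.

Lemma E0_derivable lam : 0 < lam < 6 -> derivable (@E0f R) lam 1.
Proof. exact: (@motif_derivable R 0 lam isT). Qed.
Lemma E1_derivable lam : 0 < lam < 6 -> derivable (@E1f R) lam 1.
Proof. exact: (@motif_derivable R 1 lam isT). Qed.
Lemma S0_derivable lam : 0 < lam < 6 -> derivable (@S0f R) lam 1.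
Proof. exact: (@motif_derivable R 2 lam isT). Qed.
Lemma S1_derivable lam : 0 < lam < 6 -> derivable (@S1f R) lam 1.
Proof. exact: (@motif_derivable R 3 lam isT). Qed.
Lemma T0_derivable lam : 0 < lam < 6 -> derivable (@T0f R) lam 1.
Proof. exact: (@motif_derivable R 4 lam isT). Qed.
Lemma T1_derivable lam : 0 < lam < 6 -> derivable (@T1f R) lam 1.
Proof. exact: (@motif_derivable R 5 lam isT). Qed.
Lemma P0_derivable lam : 0 < lam < 6 -> derivable (@P0f R) lam 1.
Proof. exact: (@motif_derivable R 6 lam isT). Qed.
Lemma P1_derivable lam : 0 < lam < 6 -> derivable (@P1f R) lam 1.
Proof. exact: (@motif_derivable R 7 lam isT). Qed.
Lemma P2_derivable lam : 0 < lam < 6 -> derivable (@P2f R) lam 1.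
Proof. exact: (@motif_derivable R 8 lam isT). Qed.
Lemma Q0_derivable lam : 0 < lam < 6 -> derivable (@Q0f R) lam 1.
Proof. exact: (@motif_derivable R 9 lam isT). Qed.
Lemma Q1_derivable lam : 0 < lam < 6 -> derivable (@Q1f R) lam 1.
Proof. exact: (@motif_derivable R 10 lam isT). Qed.
Lemma Q2_derivable lam : 0 < lam < 6 -> derivable (@Q2f R) lam 1.
Proof. exact: (@motif_derivable R 11 lam isT). Qed.

Section Curve.
Variables (l p : R -> R) (t dl dp : R).
Hypothesis lt : 0 < l t < 6.
Hypothesis hl : is_derive t 1 l dl.
Hypothesis hp : is_derive t 1 p dp.

Lemma is_derive_mE : is_derive t 1 (fun s => mE (l s) (p s))
  (mEl (l t) (p t) * dl + E1f (l t) * dp).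
Proof. exact: (is_derive_lin2 (E0_derivable lt) (E1_derivable lt)). Qed.
Lemma is_derive_mS : is_derive t 1 (fun s => mS (l s) (p s))
  (mSl (l t) (p t) * dl + S1f (l t) * dp).
Proof. exact: (is_derive_lin2 (S0_derivable lt) (S1_derivable lt)). Qed.
Lemma is_derive_mT : is_derive t 1 (fun s => mT (l s) (p s))
  (mTl (l t) (p t) * dl + T1f (l t) * dp).
Proof. exact: (is_derive_lin2 (T0_derivable lt) (T1_derivable lt)). Qed.
Lemma is_derive_mP : is_derive t 1 (fun s => mP (l s) (p s))
  (mPl (l t) (p t) * dl + mPp (l t) (p t) * dp).
Proof.
exact: (is_derive_quad2 (P0_derivable lt) (P1_derivable lt) (P2_derivable lt)).
Qed.
Lemma is_derive_mQ : is_derive t 1 (fun s => mQ (l s) (p s))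
  (mQl (l t) (p t) * dl + mQp (l t) (p t) * dp).
Proof.
exact: (is_derive_quad2 (Q0_derivable lt) (Q1_derivable lt) (Q2_derivable lt)).
Qed.

End Curve.

Lemma box_rdenom lam x psi : 1 <= lam <= 5 -> 10 <= x <= 30 -> 0 <= psi <= 3 / 20 ->
  0 < x * mB lam psi + mS lam psi * mE lam psi.
Proof.
move=> hlam hx hpsi; have [rho [hE _ _ hS _ hB _ _ _ _ _ _]] := box_facts hlam hpsi.
by rewrite addr_gt0// mulr_gt0//; lra.
Qed.

(** Stated for arbitrary differentiable curves because it serves twice: along lines it bounds the
    Jacobian, along fibres it excludes critical points. [dx / 2] is the velocity of [etat]. *)
Lemma curve_bound (l x p : R -> R) (t dl dx dp : R) :
  1 <= l t <= 5 -> 10 <= x t <= 30 -> 0 <= p t <= 3 / 20 ->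
  is_derive t 1 l dl -> is_derive t 1 x dx -> is_derive t 1 p dp ->
  exists y1 y2 y3,
  [/\ is_derive t 1 (fun s => ellR (l s) (x s) (p s)) y1,
      is_derive t 1 (fun s => cR (l s) (p s)) y2,
      is_derive t 1 (fun s => rR (l s) (x s) (p s)) y3 &
      dl ^+ 2 + (dx / 2) ^+ 2 + dp ^+ 2 <= 100 * 100 * (y1 ^+ 2 + y2 ^+ 2 + y3 ^+ 2)].
Proof.
move=> hlt hxt hpt hl hx hp.
have lt : 0 < l t < 6 by lra.
have D0 := box_rdenom hlt hxt hpt.
have [rho [fE _ fEp fS ftp fB fi2 fD fA ffin fwp fwl]] := box_facts hlt hpt.
have dE := is_derive_mE lt hl hp; have dS := is_derive_mS lt hl hp.
have dT := is_derive_mT lt hl hp; have dP := is_derive_mP lt hl hp.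
have dQ := is_derive_mQ lt hl hp.
have S1 : mS (l t) (p t) != 0 by rewrite gt_eqF.
have h1 := is_derive_mul hx dE.
have h2 := is_derive_cmul c2 ((fun nz => is_derive_div nz dT dS) S1).
have D1 : x t * (mQ (l t) (p t) * mE (l t) (p t) - mS (l t) (p t) ^+ 2)
  + mS (l t) (p t) * mE (l t) (p t) != 0 by rewrite gt_eqF.
have h3 := (fun nz => is_derive_rratio_dir c2 nz hx dE dS dT dP dQ) D1.
eexists; eexists; eexists; split; [exact: h1|exact: h2|exact: h3|].
have hx' : 0 <= x t <= 30 by lra.
(* The denominator of [r2] at [x] is at least its value [S E] at [x = 0], as [mB] is positive. *)
have fA' : 4 * `|mA (l t) (p t) * mS (l t) (p t) - c2 * (mT (l t) (p t) * mB (l t) (p t))|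
  <= (x t * mB (l t) (p t) + mS (l t) (p t) * mE (l t) (p t)) ^+ 2.
  apply: le_trans fA _.
  have e0 : 0 < mE (l t) (p t) by lra.
  have x0 : 0 < x t by lra.
  have se : 0 <= mS (l t) (p t) * mE (l t) (p t) by rewrite mulr_ge0 ?ltW.
  apply: lerXn2r; rewrite ?nnegrE//; first exact: ltW.
  by rewrite lerDr mulr_ge0 ?ltW.
apply: (jacobian_bound fE fS c2_gt0 hx' fEp ftp fi2 fD D0 (fwp _ hxt) (fwl _ hxt) fA' ffin).
- by move: (mE _ _) (mEl _ _) (E1f _) => e el ep; field.
- by move: (mS _ _) S1 (mSl _ _) (S1f _) (mT _ _) (mTl _ _) (T1f _) => *; field.
- rewrite /mA /mB /mAl /mBl /mAp /mBp; congr (_ + _ * _).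
  by move: (mE _ _) (mEl _ _) (E1f _) => e el ep; field.
Qed.

End CurveBound.

(** * Singular values and differentials *)

Section SingularValues.
Context {R : realType}.

(** [p] is positive far to the right. As the degree is odd, [- p(- x)] is monic too, so [p] is
    negative far to the left. *)
Lemma odd_monic_root (p : {poly R}) : p \is monic -> odd (size p).-1 -> exists x, root p x.
Proof.
move=> pm po; have [b hb] := monic_Cauchy_bound pm.
pose q := - (p \Po - 'X).
have sX : size (- 'X : {poly R}) = 2 by rewrite size_polyN size_polyX.
have qm : q \is monic.
  rewrite /q monicE lead_coefN lead_coef_comp ?sX// (monicP pm) mul1r.
  by rewrite lead_coefN lead_coefX -signr_odd po expr1 opprK.
have [c hc] := monic_Cauchy_bound qm.
pose m := Num.max `|b| `|c|.
have m0 : - m <= m by rewrite ge0_cp// le_max normr_ge0.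
have h1 : 0 < p.[m] by apply: hb; rewrite (le_trans (ler_norm _))// le_max lexx.
have h2 : 0 < q.[m].
  by apply: hc; rewrite (le_trans (ler_norm _))// le_max lexx orbT.
rewrite /q hornerN horner_comp hornerN hornerX oppr_gt0 in h2.
have [x _ rx] := poly_ivt m0 (introT andP (conj (ltW h2) (ltW h1))).
by exists x.
Qed.

Lemma eigenvalue_exists n (A : 'M[R]_n) : odd n -> exists a, eigenvalue A a.
Proof.
move=> on; have [|a ra] := odd_monic_root (char_poly_monic A).
  by rewrite size_char_poly.
by exists a; rewrite eigenvalue_root_char.
Qed.

(* [sigma_min] is an infimum of a nonempty set, as a real eigenvalue of the
   Gram matrix exists in odd dimension. *)
Lemma sigma_min_ge n (A : 'M[R]_n) (s : R) : odd n -> 0 <= s ->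
  (forall v : 'rV_n, s ^+ 2 * \sum_j v 0 j ^+ 2 <= \sum_j (v *m A^T) 0 j ^+ 2) ->
  s <= sigma_min A.
Proof.
move=> on s0 hA; have [a ha] := eigenvalue_exists (A^T *m A) on.
apply: lb_le_inf; first by exists (Num.sqrt a); exists a.
move=> _ [b /eigenvalueP[v vb v0] <-].
have sqsum (w : 'rV[R]_n) : \sum_j w 0 j ^+ 2 = (w *m w^T) 0 0.
  by rewrite mxE; apply: eq_bigr => j _; rewrite mxE expr2.
have := hA v; rewrite [X in _ <= X]sqsum trmx_mul trmxK mulmxA -(mulmxA v) vb.
have -> : (b *: v *m v^T) 0 0 = b * \sum_j v 0 j ^+ 2.
  by rewrite -scalemxAl mxE sqsum.
have vp : 0 < \sum_j v 0 j ^+ 2.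
  have [j vj] : exists j, v 0 j != 0.
    apply/existsP; rewrite -negb_forall; apply: contra v0 => /forallP h.
    by apply/eqP/rowP => j; rewrite mxE; apply/eqP; rewrite h.
  rewrite (bigD1 j)//=; apply: ltr_wpDr.
    by apply: sumr_ge0 => i _; exact: sqr_ge0.
  by rewrite lt_def sqr_ge0 sqrf_eq0 vj.
rewrite ler_pM2r// => sb; rewrite -(ler_pXn2r (n := 2)) ?nnegrE ?sqrtr_ge0//.
by rewrite sqr_sqrtr// (le_trans (sqr_ge0 s)).
Qed.

End SingularValues.

(** * Differentials in coordinates *)

Section Differentials.
Context {R : realType}.

(** [M3] is rewritten by [comps] only where [lambda] and [etat] are nonnegative; differentiability
    therefore has to pass between functions that agree near a point. *)
Lemma near_eq_differentiable (V W : normedModType R) (f g : V -> W) (a : V) :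
  (\forall x \near a, f x = g x) -> differentiable f a -> differentiable g a.
Proof.
move=> fg df; have /diff_locallyP[cdf hf] := df.
have ga : f a = g a by exact: nbhs_singleton fg.
have hg : g \o shift a = cst (g a) + 'd f a +o_ 0 id.
  apply/eqaddoP => e e0; have /eqaddoP/(_ e e0) := hf.
  move=> h0; have h : \forall h \near (0 : V), f (h + a) = g (h + a).
    move: fg; rewrite [X in X -> _](near_shift 0 a) => h.
    by apply: filterS h => z /=; rewrite subr0.
  by apply: filterS2 h h0 => x; rewrite !fctE /= ga => ->.
apply/diff_locallyP; rewrite (diff_unique cdf hg); split; [exact: cdf|exact: hg].
Qed.

Lemma differentiable_row (V : normedModType R) n (f : 'I_n -> V -> R) (a : V) :
  (forall j, differentiable (f j) a) ->
  differentiable (fun x => \row_j f j x : 'rV[R]_n) a.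
Proof.
move=> df; have -> : (fun x => \row_j f j x : 'rV[R]_n) =
    \sum_(j < n) (fun x => f j x *: (delta_mx 0 j : 'rV[R]_n)).
  apply/funext => x; rewrite [LHS]row_sum_delta fct_sumE.
  by apply: eq_bigr => j _; rewrite mxE.
by apply: differentiable_sum => j; exact: differentiableZl.
Qed.

Lemma derive_coord (V : normedModType R) n (F : V -> 'rV[R]_n) (a v : V) j :
  differentiable F a -> ('D_v F a) 0 j = 'D_v (fun x => F x 0 j) a.
Proof.
move=> dF.
have @f : {linear 'rV[R]_n -> R}.
  by exists (fun N : 'rV[R]_n => N 0 j); do 2![eexists]; do ?[constructor];
     rewrite ?mxE// => ? *; rewrite ?mxE//; move=> ?; rewrite !mxE.
have fc : continuous f by exact: coord_continuous.
have df : differentiable f (F a) by exact: linear_differentiable.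
rewrite (deriveE v dF) [RHS](_ : _ = 'D_v (f \o F) a)// deriveE; last first.
  exact: differentiable_comp.
have e := diff_lin (F a) fc.
by rewrite (diff_comp dF df) /= e.
Qed.

Lemma derive_line (V : normedModType R) (f : V -> R) (a v : V) (d : R) :
  is_derive (0 : R) 1 (fun s : R => f (s *: v + a)) d -> 'D_v f a = d.
Proof.
move=> [_ <-]; rewrite /derive; set g1 := fun h => h^-1 *: _; set g2 := fun h => h^-1 *: _.
suff -> : g1 = g2 by [].
by rewrite funeqE /g1 /g2 => h /=; rewrite addr0 scale0r add0r [_%:A]mulr1.
Qed.

End Differentials.

Section Differentiability.
Context {R : realType} {V : normedModType R}.
Implicit Types (f g : V -> R) (a : V).

Lemma diff_add f g a : differentiable f a -> differentiable g a ->
  differentiable (fun x => f x + g x) a.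
Proof. exact: differentiableD. Qed.
Lemma diff_sub f g a : differentiable f a -> differentiable g a ->
  differentiable (fun x => f x - g x) a.
Proof. exact: differentiableB. Qed.
Lemma diff_mul f g a : differentiable f a -> differentiable g a ->
  differentiable (fun x => f x * g x) a.
Proof. exact: differentiableM. Qed.
Lemma diff_cmul (k : R) f a : differentiable f a ->
  differentiable (fun x => k * f x) a.
Proof. exact: differentiableZ. Qed.
Lemma diff_div f g a : g a != 0 -> differentiable f a -> differentiable g a ->
  differentiable (fun x => f x / g x) a.
Proof.
by move=> g0 df dg; apply: diff_mul => //; exact: differentiableV.
Qed.
Lemma diff_fun (F : R -> R) f a : derivable F (f a) 1 -> differentiable f a ->
  differentiable (fun x => F (f x)) a.
Proof.
by move=> dF df; apply: (differentiable_comp df); exact/derivable1_diffP.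
Qed.

Lemma diff_lin2 (F G : R -> R) f g a : derivable F (f a) 1 -> derivable G (f a) 1 ->
  differentiable f a -> differentiable g a ->
  differentiable (fun x => lin2 F G (f x) (g x)) a.
Proof.
by move=> dF dG df dg; apply: diff_add; [|apply: diff_mul => //]; exact: diff_fun.
Qed.

Lemma diff_quad2 (F G H : R -> R) f g a : derivable F (f a) 1 ->
  derivable G (f a) 1 -> derivable H (f a) 1 ->
  differentiable f a -> differentiable g a ->
  differentiable (fun x => quad2 F G H (f x) (g x)) a.
Proof.
move=> dF dG dH df dg; apply: diff_add; first exact: diff_fun.
by apply: diff_mul => //; apply: diff_add; [|apply: diff_mul => //]; exact: diff_fun.
Qed.

End Differentiability.

Section Gradient.
Context {R : realType}.
Implicit Types (x v : 'rV[R]_3).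

Definition comps x : 3.-tuple R := [tuple
  ellR (x 0 0) (2 * x 0 1) (x 0 ord_max);
  cR (x 0 0) (x 0 ord_max);
  rR (x 0 0) (2 * x 0 1) (x 0 ord_max)].

(** [eta_of] inverts [pi * eta ^+ 2 = 2 * etat] for [etat >= 0], and the motif integrals are split
    for [lambda >= 0]. *)
Lemma M3E x : 0 <= x 0 0 -> 0 <= x 0 1 -> M3 x = \row_j tnth (comps x) j.
Proof.
move=> l0 h0; rewrite /M3; apply/rowP => j; rewrite !mxE.
have pg := @pi_gt0 R.
have eE : pi * eta_of (x 0 1) ^+ 2 = 2 * x 0 1.
  rewrite /eta_of sqr_sqrtr; last by rewrite divr_ge0 ?mulr_ge0// ltW.
  by rewrite mulrC divfK// gt_eqF.
have EE : motifE (x 0 0) (x 0 ord_max) = mE (x 0 0) (x 0 ord_max).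
  exact: motifE_split.
have SE : motifS (x 0 0) (x 0 ord_max) = mS (x 0 0) (x 0 ord_max).
  exact: motifS_split.
have TE : motifT (x 0 0) (x 0 ord_max) = mT (x 0 0) (x 0 ord_max).
  exact: motifT_split.
have PE : motifP (x 0 0) (x 0 ord_max) = mP (x 0 0) (x 0 ord_max).
  by rewrite (motifP_split _ l0) /mP /quad2 mulrDr addrA mulrA -expr2.
have QE : motifQ (x 0 0) (x 0 ord_max) = mQ (x 0 0) (x 0 ord_max).
  by rewrite (motifQ_split _ l0) /mQ /quad2 mulrDr addrA mulrA -expr2.
by rewrite /ell2 /C2 /r2 eE EE SE TE PE QE.
Qed.

Definition in_box x := [/\ 1 <= x 0 0 <= 5, 10 <= 2 * x 0 1 <= 30 &
  0 <= x 0 ord_max <= 3 / 20].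

Lemma B2_box x : B2 x -> in_box x.
Proof.
rewrite /B2 /= !in_itv /= => -[h1 /andP[h2 h3] h4]; split => //.
by apply/andP; split; lra.
Qed.

(** The closed box lies in the open set where [lambda] and [etat] are positive, and [psi] is not
    restricted there; so derivatives at boundary points, [psi = 0] included, are two-sided. *)
Lemma M3_near x : B2 x -> \forall y \near x, \row_j tnth (comps y) j = M3 y.
Proof.
move=> /B2_box[h1 h2 h3].
have l0 : 0 < x 0 0 by lra.
have e0 : 0 < x 0 1 by lra.
have n1 := @cvgr_gt _ _ _ _ _ _ (@coord_continuous R 1 3 0 0 x) _ l0.
have n2 := @cvgr_gt _ _ _ _ _ _ (@coord_continuous R 1 3 0 1 x) _ e0.
near=> y; rewrite M3E//; apply: ltW; first by near: y; exact: n1.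
by near: y; exact: n2.
Unshelve. all: by end_near. Qed.

Lemma comps_differentiable x j : B2 x -> differentiable (fun y => tnth (comps y) j) x.
Proof.
move=> /B2_box[h1 h2 h3]; have h6 : 0 < x 0 0 < 6 by lra.
have dl : differentiable (fun y : 'rV[R]_3 => y 0 0) x by exact: differentiable_coord.
have dp : differentiable (fun y : 'rV[R]_3 => y 0 ord_max) x by exact: differentiable_coord.
have dx : differentiable (fun y : 'rV[R]_3 => 2 * y 0 1) x.
  by apply: diff_cmul; exact: differentiable_coord.
have dE := diff_lin2 (E0_derivable h6) (E1_derivable h6) dl dp.
have dS := diff_lin2 (S0_derivable h6) (S1_derivable h6) dl dp.
have dT := diff_lin2 (T0_derivable h6) (T1_derivable h6) dl dp.
have dP := diff_quad2 (P0_derivable h6) (P1_derivable h6) (P2_derivable h6) dl dp.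
have dQ := diff_quad2 (Q0_derivable h6) (Q1_derivable h6) (Q2_derivable h6) dl dp.
have [rho [_ _ _ fS _ _ _ _ _ _ _ _]] := box_facts h1 h3.
have S0 : mS (x 0 0) (x 0 ord_max) != 0 by rewrite gt_eqF.
have D0 : 2 * x 0 1 * mB (x 0 0) (x 0 ord_max)
  + mS (x 0 0) (x 0 ord_max) * mE (x 0 0) (x 0 ord_max) != 0.
  by rewrite gt_eqF// box_rdenom.
have dSS : differentiable (fun y : 'rV[R]_3 => mS (y 0 0) (y 0 ord_max) ^+ 2) x.
  by under eq_fun do rewrite expr2; exact: diff_mul.
case: j => -[|[|[|//]]] j3; rewrite /comps.
- exact: (diff_mul dx dE).
- exact: (diff_cmul _ ((fun nz => diff_div nz dT dS) S0)).
- have dN := diff_add (diff_mul dx (diff_sub (diff_mul dP dE) dSS))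
    (diff_mul (diff_cmul c2 dT) dE).
  have dD := diff_add (diff_mul dx (diff_sub (diff_mul dQ dE) dSS)) (diff_mul dS dE).
  exact: ((fun nz => diff_div nz dN dD) D0).
Qed.

Lemma M3_differentiable x : B2 x -> differentiable (@M3 R) x.
Proof.
move=> hx; apply: near_eq_differentiable (M3_near hx) _.
by apply: differentiable_row => j; exact: comps_differentiable.
Qed.

Lemma is_derive_line (x v : 'rV[R]_3) j :
  is_derive (0 : R) 1 (fun s : R => (s *: v + x) 0 j) (v 0 j).
Proof.
have -> : (fun s : R => (s *: v + x) 0 j) = (fun s => s * v 0 j + x 0 j).
  by apply/funext => s; rewrite !mxE.
have h := is_derive_add (is_derive_mul (is_derive_id (0 : R) 1) (is_derive_cst (v 0 j) _ _))
  (is_derive_cst (x 0 j) (0 : R) 1).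
by move/is_derive_eq: h; apply; rewrite mul1r mulr0 !addr0.
Qed.

(** [curve_bound] along the line [s *: v + x]. Only its point at [s = 0] must lie in the box. *)
Lemma M3_expansion x v : B2 x ->
  \sum_j v 0 j ^+ 2 <= 100 * 100 * \sum_j ('D_v (@M3 R) x) 0 j ^+ 2.
Proof.
move=> hx; have [h1 h2 h3] := B2_box hx.
have dG : differentiable (fun y => \row_j tnth (comps y) j : 'rV[R]_3) x.
  by apply: differentiable_row => j; exact: comps_differentiable.
have e : 'D_v (@M3 R) x = 'D_v (fun y => \row_j tnth (comps y) j : 'rV[R]_3) x.
  by symmetry; exact: near_eq_derive (M3_near hx).
have e0 j : (0 *: v + x) 0 j = x 0 j by rewrite scale0r add0r.
have hl := is_derive_line x v 0; have hp := is_derive_line x v ord_max.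
have hX := is_derive_cmul 2 (is_derive_line x v 1).
have [||| y1 [y2 [y3 [d1 d2 d3 bnd]]]] := curve_bound _ _ _ hl hX hp.
- by rewrite e0.
- by rewrite e0.
- by rewrite e0.
have comp j : ('D_v (@M3 R) x) 0 j = tnth [tuple y1; y2; y3] j.
  rewrite e derive_coord//.
  have -> : (fun y => (\row_j tnth (comps y) j : 'rV[R]_3) 0 j) =
    (fun y => tnth (comps y) j) by apply/funext => y; rewrite mxE.
  by apply: derive_line; case: j => -[|[|[|//]]] j3.
rewrite !big_ord_recl !big_ord0 !comp !addr0 !addrA.
have -> : v 0 (lift ord0 (lift ord0 ord0)) = v 0 ord_max by congr (v _ _); exact/val_inj.
have -> : v 0 (lift ord0 ord0) = v 0 1 by congr (v _ _); exact/val_inj.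
have be : 2 * v 0 1 / 2 = v 0 1 by field.
rewrite be in bnd.
exact: bnd.
Qed.

Lemma M3_sigma_min x : B2 x -> 1 / 100 <= sigma_min (DM3 x).
Proof.
move=> hx; apply: sigma_min_ge => // v.
rewrite /DM3 trmxK -deriveEjacobian; last exact: M3_differentiable.
have := M3_expansion v hx.
move: (\sum_j _) (\sum_j _) => a b; clear => h.
by rewrite expr2; lra.
Qed.

End Gradient.

(** * Injectivity *)

Section Injectivity.
Context {R : realType}.
Implicit Types (lam psi : R).

(** [tauP] and [tauL] are the numerators, over [S^2], of the partial derivatives of [T / S] in [psi]
    and in [lambda]. *)
Definition tauP lam psi : R := T1f lam * mS lam psi - mT lam psi * S1f lam.
Definition tauL lam psi : R := mTl lam psi * mS lam psi - mT lam psi * mSl lam psi.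

Lemma box_signs lam psi : 1 <= lam <= 5 -> 0 <= psi <= 3 / 20 ->
  [/\ 0 < mE lam psi, 0 < mS lam psi, 0 < tauP lam psi, 0 < tauL lam psi &
      0 < mEl lam psi * tauP lam psi - E1f lam * tauL lam psi].
Proof.
move=> hl hp; have h10 : 10 <= (10 : R) <= 30 by rewrite lexx; clear; lra.
have D0 := box_rdenom hl h10 hp.
have [rho [fE _ _ fS ftp _ fi2 fD _ _ fwp fwl]] := box_facts hl hp.
have wp0 := fwp _ h10; have wl0 := fwl _ h10.
have rho0 : 0 <= rho.
  have D2 : 0 < (10 * mB lam psi + mS lam psi * mE lam psi) ^+ 2 by rewrite exprn_gt0.
  have w0 := lt_le_trans D2 wp0; rewrite pmulr_rgt0// in w0.
  by have := le_trans (normr_ge0 _) wl0; rewrite pmulr_lge0.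
rewrite /tauP /tauL; split => //; first by lra.
have : 0 <= rho * (T1f lam * mS lam psi - mT lam psi * S1f lam).
  by rewrite mulr_ge0// ltW.
by move: fD; move: (rho * _) (mTl _ _ * _ - _) => a b; clear; lra.
Qed.

Lemma itv_box (a b lam : R) : 1 <= a -> b <= 5 -> a <= lam <= b -> 1 <= lam <= 5.
Proof. by move=> h1 h5 /andP[h2 h3]; rewrite (le_trans h1)// (le_trans h3). Qed.

Lemma box_open (lam : R) : 1 <= lam <= 5 -> 0 < lam < 6.
Proof.
by move=> /andP[h1 h5]; rewrite (lt_le_trans ltr01)// (le_lt_trans h5)// ltr_nat.
Qed.

Definition q lam psi : R := mT lam psi / mS lam psi.

(** [T] and [S] are affine in [psi], so the cross difference is exactly [(psi' - psi) * tauP] and no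
    mean value theorem is needed. *)
Lemma q_psi lam psi psi' : 1 <= lam <= 5 -> 0 <= psi <= 3 / 20 ->
  0 <= psi' <= 3 / 20 -> psi < psi' -> q lam psi < q lam psi'.
Proof.
move=> hl hp hp' lt; have [_ S0 tp0 _ _] := box_signs hl hp.
have [_ S0' _ _ _] := box_signs hl hp'.
rewrite /q ltr_pdivrMr// mulrAC ltr_pdivlMr// -subr_gt0.
have -> : mT lam psi' * mS lam psi - mT lam psi * mS lam psi' =
  (psi' - psi) * tauP lam psi by rewrite /tauP /mT /mS /lin2; ring.
by rewrite mulr_gt0// subr_gt0.
Qed.

Lemma q_lam lam lam' psi : 1 <= lam -> lam' <= 5 -> 0 <= psi <= 3 / 20 ->
  lam < lam' -> q lam psi < q lam' psi.
Proof.
move=> h1 h5 hp lt.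
have dq s : s \in `[lam, lam'] ->
    is_derive s 1 (q^~ psi) (tauL s psi / mS s psi ^+ 2).
  rewrite in_itv/= => /(itv_box h1 h5) hs; have hs6 := box_open hs.
  have [_ S0 _ _ _] := box_signs hs hp.
  have di := is_derive_id s (1 : R); have dc := is_derive_cst psi s (1 : R).
  have S1 : mS s psi != 0 by rewrite gt_eqF.
  have := (fun nz => is_derive_div nz (is_derive_mT hs6 di dc) (is_derive_mS hs6 di dc)) S1.
  move/is_derive_eq; apply; rewrite /tauL.
  move: (mTl s psi) (T1f s) (mS s psi) (mT s psi) (mSl s psi) (S1f s) => a b d e f g.
  by congr (_ / _); ring.
have cq : {within `[lam, lam'], continuous (q^~ psi)}.
  by apply: derivable_within_continuous => s /dq [].
have [c] := MVT lt (fun s hs => dq s (subset_itv_oo_cc hs)) cq.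
move=> hc e; rewrite -subr_gt0 e mulr_gt0// ?subr_gt0//.
have hc' : 1 <= c <= 5.
  by apply: (itv_box h1 h5); have := subset_itv_oo_cc hc; rewrite in_itv.
have [_ S0 _ t0 _] := box_signs hc' hp.
by rewrite divr_gt0// exprn_gt0.
Qed.

Lemma no_unit_square (a b : R) : 0 <= a -> 0 <= b -> 1 + a + b <= 0 -> False.
Proof. by move=> a0 b0; rewrite leNgt ltr_wpDr// ltr_wpDr. Qed.

Lemma is_derive_unique (f : R -> R) (t a b : R) :
  is_derive t 1 f a -> is_derive t 1 f b -> a = b.
Proof. by move=> [_ <-] [_ <-]. Qed.

Section Fibre.
Variables (l1 l2 p1 p2 x1 x2 ka ell : R).
Hypotheses (h1 : 1 <= l1) (h2 : l2 <= 5) (l12 : l1 < l2).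
Hypotheses (hp1 : 0 <= p1 <= 3 / 20) (hp2 : 0 <= p2 <= 3 / 20).
Hypotheses (hx1 : 10 <= x1 <= 30) (hx2 : 10 <= x2 <= 30).
Hypotheses (k1 : q l1 p1 = ka) (k2 : q l2 p2 = ka).
Hypotheses (e1 : ellR l1 x1 p1 = ell) (e2 : ellR l2 x2 p2 = ell).

(* The fibre of [C2] through the two points, as a graph over [lam]. *)
Definition phi lam : R := (ka * S0f lam - T0f lam) / (T1f lam - ka * S1f lam).

Lemma fibre_psi_lt : p2 < p1.
Proof.
rewrite ltNge; apply/negP => p12.
have lt : q l1 p1 < q l2 p1 by exact: q_lam.
have hl2 : 1 <= l2 <= 5 by rewrite h2 (le_trans h1)// ltW.
move: p12; rewrite le_eqVlt => /predU1P[p12|p12].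
  by move: lt; rewrite k1 p12 k2 ltxx.
by have := lt_trans lt (q_psi hl2 hp1 hp2 p12); rewrite k1 k2 ltxx.
Qed.

(** By monotonicity of [q] in [lam], [q lam p2 <= ka <= q lam p1]. Cleared of denominators, with
    [phi lam = N / M], this reads [p2 * M <= N <= p1 * M], so [M >= 0]. If [M] vanished, so would
    [N], then [T = ka S] identically in [psi] and [tauP] would be zero. *)
Lemma fibre_slope lam : l1 <= lam <= l2 ->
  0 < T1f lam - ka * S1f lam /\ p2 <= phi lam <= p1.
Proof.
move=> /[dup] /(itv_box h1 h2) hl /andP[hl1 hl2].
have [_ S1 _ _ _] := box_signs hl hp1; have [_ S2 _ _ _] := box_signs hl hp2.
have p21 := fibre_psi_lt.
have q1 : ka <= q lam p1.
  move: hl1; rewrite le_eqVlt => /predU1P[<-|lt]; first by rewrite k1.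
  rewrite -k1; apply: ltW; apply: q_lam h1 _ hp1 lt; by case/andP: hl.
have q2 : q lam p2 <= ka.
  move: hl2; rewrite le_eqVlt => /predU1P[->|lt]; first by rewrite k2.
  rewrite -k2; apply: ltW; apply: q_lam _ h2 hp2 lt; by case/andP: hl.
rewrite /q ler_pdivlMr// in q1; rewrite /q ler_pdivrMr// in q2.
rewrite /mS /mT /lin2 in q1 q2.
set M := T1f lam - ka * S1f lam; set N := ka * S0f lam - T0f lam.
have u1 : N <= p1 * M.
  rewrite -subr_ge0 /N /M; rewrite -subr_ge0 in q1; apply: le_trans q1 _.
  by rewrite le_eqVlt; apply/orP; left; apply/eqP; ring.
have u2 : p2 * M <= N.
  rewrite -subr_ge0 /N /M; rewrite -subr_ge0 in q2; apply: le_trans q2 _.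
  by rewrite le_eqVlt; apply/orP; left; apply/eqP; ring.
have M0 : 0 <= M.
  have : 0 <= (p1 - p2) * M by rewrite mulrBl subr_ge0 (le_trans u2).
  by rewrite pmulr_rge0// subr_gt0.
have Mn : M != 0.
  apply/eqP => Mz; rewrite Mz mulr0 in u1; rewrite Mz mulr0 in u2.
  have T1e : T1f lam = ka * S1f lam by apply/eqP; rewrite -subr_eq0 -/M Mz.
  have T0e : T0f lam = ka * S0f lam.
    by apply/esym/eqP; rewrite -subr_eq0 -/N eq_le u1 u2.
  have [_ _ + _ _] := box_signs hl hp1; rewrite /tauP /mS /mT /lin2 T1e T0e.
  suff -> : ka * S1f lam * (S0f lam + p1 * S1f lam) -
    (ka * S0f lam + p1 * (ka * S1f lam)) * S1f lam = 0 by rewrite ltxx.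
  by ring.
have Mp : 0 < M by rewrite lt_def Mn.
by split => //; rewrite /phi -/M -/N ler_pdivlMr// ler_pdivrMr// u1 u2.
Qed.

Lemma fibre_box lam : l1 <= lam <= l2 -> 1 <= lam <= 5 /\ 0 <= phi lam <= 3 / 20.
Proof.
move=> hl; have [_ /andP[u1 u2]] := fibre_slope hl; split; first exact: (itv_box h1 h2).
have /andP[v1 _] := hp2; have /andP[_ v2] := hp1.
by rewrite (le_trans v1)// (le_trans u2).
Qed.

Lemma fibre_phi lam psi : l1 <= lam <= l2 -> 0 < mS lam psi -> q lam psi = ka ->
  phi lam = psi.
Proof.
move=> hl S0 qk; have [M0 _] := fibre_slope hl.
have : mT lam psi = ka * mS lam psi by rewrite -qk /q divfK// gt_eqF.
rewrite /mT /mS /lin2 /phi => e; apply: (mulIf (lt0r_neq0 M0)).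
rewrite divfK ?gt_eqF//.
have -> : psi * (T1f lam - ka * S1f lam) =
  (T0f lam + psi * T1f lam) - T0f lam - psi * (ka * S1f lam) by ring.
by rewrite e; ring.
Qed.

Lemma fibre_T lam : l1 <= lam <= l2 -> mT lam (phi lam) = ka * mS lam (phi lam).
Proof.
move=> hl; have [M0 _] := fibre_slope hl; apply/eqP; rewrite -subr_eq0.
have -> : mT lam (phi lam) - ka * mS lam (phi lam) =
  phi lam * (T1f lam - ka * S1f lam) - (ka * S0f lam - T0f lam).
  by rewrite /mT /mS /lin2; ring.
by rewrite /phi divfK ?subrr// gt_eqF.
Qed.

(** The implicit function rule for [q = ka], obtained from the explicit quotient [phi] with
    [T = ka S] on the fibre. *)
Lemma phi_derive lam : l1 <= lam <= l2 -> exists2 dphi, is_derive lam 1 phi dphi &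
  tauL lam (phi lam) + tauP lam (phi lam) * dphi = 0.
Proof.
move=> hl; have [hb _] := fibre_box hl; have h6 := box_open hb.
have [M0 _] := fibre_slope hl; have Mn := lt0r_neq0 M0.
have dN := is_derive_sub (is_derive_cmul ka (derivableP (S0_derivable h6)))
  (derivableP (T0_derivable h6)).
have dM := is_derive_sub (derivableP (T1_derivable h6))
  (is_derive_cmul ka (derivableP (S1_derivable h6))).
have Mn' : T1f lam - ka * S1f lam != 0 by exact: Mn.
have d := (fun nz => is_derive_div nz dN dM) Mn'.
eexists; first exact: d.
have pE : phi lam * (T1f lam - ka * S1f lam) = ka * S0f lam - T0f lam.
  by rewrite /phi divfK.
rewrite /tauL /tauP (fibre_T hl) /mTl /mSl /lin2 !derive1E -pE.
move: (mS lam (phi lam)) => S; move: (phi lam) => f.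
move: (T1f lam) (S1f lam) Mn' => T1 S1 Mn'.
move: ('D_1 T0f lam) ('D_1 T1f lam) ('D_1 S0f lam) ('D_1 S1f lam) => t0 t1 s0 s1.
by field.
Qed.

Definition eC lam : R := mE lam (phi lam).

(** Along the fibre the slope of [E], multiplied by [tauP], is the minor [El * tauP - Ep * tauL],
    which the certificate makes positive. *)
Lemma eC_derive lam : l1 <= lam <= l2 ->
  exists dphi de, [/\ is_derive lam 1 phi dphi, is_derive lam 1 eC de, 0 < de &
    tauL lam (phi lam) + tauP lam (phi lam) * dphi = 0].
Proof.
move=> hl; have [hb hp] := fibre_box hl; have h6 := box_open hb.
have [dphi d t0] := phi_derive hl.
have dE := is_derive_mE h6 (is_derive_id lam (1 : R)) d.
exists dphi; eexists; split; [exact: d|exact: dE| |exact: t0].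
have [_ _ tp _ i2] := box_signs hb hp.
rewrite mulr1 -(pmulr_lgt0 _ tp); move: i2.
have -> : (mEl lam (phi lam) + E1f lam * dphi) * tauP lam (phi lam) =
  mEl lam (phi lam) * tauP lam (phi lam) - E1f lam * tauL lam (phi lam)
  + E1f lam * (tauL lam (phi lam) + tauP lam (phi lam) * dphi) by ring.
by rewrite t0 mulr0 addr0.
Qed.

Lemma eC_le a b : l1 <= a -> a <= b -> b <= l2 -> eC a <= eC b.
Proof.
move=> la ab bl.
have hd s : s \in `[a, b] -> is_derive s 1 eC ('D_1 eC s) /\ 0 <= 'D_1 eC s.
  rewrite in_itv/= => /andP[s1 s2]; have hs : l1 <= s <= l2.
    by rewrite (le_trans la)// (le_trans s2).
  have [dphi [de [_ d d0 _]]] := eC_derive hs.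
  split; first by apply: derivableP; have [] := d.
  by have [_ ->] := d; exact: ltW.
have cE : {within `[a, b], continuous eC}.
  by apply: derivable_within_continuous => s /hd[[]].
have [c hc] := MVT_segment ab (fun s hs => (hd s (subset_itv_oo_cc hs)).1) cE.
move=> e; rewrite -subr_ge0 e mulr_ge0 ?subr_ge0//.
exact: (hd c hc).2.
Qed.

Definition xC lam : R := ell / eC lam.

Lemma phi_ends : phi l1 = p1 /\ phi l2 = p2.
Proof.
have hb1 : 1 <= l1 <= 5 by rewrite h1 (le_trans (ltW l12)).
have hb2 : 1 <= l2 <= 5 by rewrite h2 (le_trans h1)// ltW.
have [_ S1 _ _ _] := box_signs hb1 hp1; have [_ S2 _ _ _] := box_signs hb2 hp2.
by split; apply: fibre_phi => //; rewrite lexx ltW.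
Qed.

Lemma eC_gt0 lam : l1 <= lam <= l2 -> 0 < eC lam.
Proof.
by move=> hl; have [hb hp] := fibre_box hl; have [] := box_signs hb hp.
Qed.

Lemma xC_ends : xC l1 = x1 /\ xC l2 = x2.
Proof.
have [f1 f2] := phi_ends.
have g1 : 0 < eC l1 by apply: eC_gt0; rewrite lexx ltW.
have g2 : 0 < eC l2 by apply: eC_gt0; rewrite lexx andbT ltW.
have E1 : mE l1 p1 = eC l1 := congr1 (mE l1) (esym f1).
have E2 : mE l2 p2 = eC l2 := congr1 (mE l2) (esym f2).
rewrite /xC; split.
  by rewrite -e1 /ellR E1; exact: (mulfK (lt0r_neq0 g1)).
by rewrite -e2 /ellR E2; exact: (mulfK (lt0r_neq0 g2)).
Qed.

(** [eC] increases and [ell] is nonnegative, so [xC] runs down from [x1] to [x2], and both ends lie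
    in [10, 30]. *)
Lemma xC_box lam : l1 <= lam <= l2 -> 10 <= xC lam <= 30.
Proof.
move=> /[dup] hl /andP[s1 s2]; have [f1 f2] := xC_ends.
have g1 : 0 < eC l1 by apply: eC_gt0; rewrite lexx ltW.
have g2 : 0 < eC l2 by apply: eC_gt0; rewrite lexx andbT ltW.
have g := eC_gt0 hl.
have ell0 : 0 <= ell.
  have -> : ell = xC l1 * eC l1 by symmetry; exact: (divfK (lt0r_neq0 g1)).
  rewrite f1; apply: mulr_ge0 (ltW g1).
  by case/andP: hx1 => h _; apply: le_trans h.
have u1 : xC lam <= xC l1.
  apply: (ler_wpM2l ell0); rewrite (lef_pV2 g g1).
  exact: (eC_le (lexx _) s1 s2).
have u2 : xC l2 <= xC lam.
  apply: (ler_wpM2l ell0); rewrite (lef_pV2 g2 g).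
  exact: (eC_le s1 s2 (lexx _)).
rewrite f1 in u1; rewrite f2 in u2.
have /andP[v1 _] := hx2; have /andP[_ v2] := hx1.
by rewrite (le_trans v1)// (le_trans u1).
Qed.

Definition rC lam : R := rR lam (xC lam) (phi lam).

Lemma rC_derive lam : l1 <= lam <= l2 -> exists2 d, is_derive lam 1 rC d & d != 0.
Proof.
move=> hl; have [hb hp] := fibre_box hl; have hx := xC_box hl.
have [dphi [de [dp dE _ t0]]] := eC_derive hl.
have g := eC_gt0 hl; have gn : eC lam != 0 by rewrite gt_eqF.
have dx := (fun nz => is_derive_div nz (is_derive_cst ell lam (1 : R)) dE) gn.
have [y1 [y2 [y3 [d1 d2 d3 bnd]]]] := curve_bound hb hx hp (is_derive_id lam (1 : R)) dx dp.
exists y3; first exact: d3.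
have h6 := box_open hb.
have y10 : y1 = 0.
  have d1' := is_derive_mul dx dE.
  by rewrite (is_derive_unique d1 d1'); field.
have y20 : y2 = 0.
  have [_ S0 _ _ _] := box_signs hb hp.
  have Sn : mS lam (phi lam) != 0 by rewrite gt_eqF.
  have d2' := is_derive_cmul c2 ((fun nz => is_derive_div nz
    (is_derive_mT h6 (is_derive_id lam (1 : R)) dp)
    (is_derive_mS h6 (is_derive_id lam (1 : R)) dp)) Sn).
  rewrite (is_derive_unique d2 d2').
  have -> : (mTl lam (phi lam) * 1 + T1f lam * dphi) * mS lam (phi lam) -
    mT lam (phi lam) * (mSl lam (phi lam) * 1 + S1f lam * dphi) =
    tauL lam (phi lam) + tauP lam (phi lam) * dphi by rewrite /tauL /tauP; ring.
  by rewrite t0 mul0r mulr0.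
(* [lam] moves with velocity 1, so three vanishing derivatives would force 1 plus two squares to be
   at most 0. *)
apply/eqP => y30; move: bnd; rewrite y10 y20 y30 expr0n /= !addr0 mulr0 expr1n => h.
exact: (no_unit_square (sqr_ge0 _) (sqr_ge0 _) h).
Qed.

Lemma fibre_r : rR l1 x1 p1 <> rR l2 x2 p2.
Proof.
have [f1 f2] := phi_ends; have [g1 g2] := xC_ends.
rewrite -f1 -f2 -g1 -g2 -/(rC l1) -/(rC l2) => e.
have hd s : s \in `[l1, l2] -> is_derive s 1 rC ('D_1 rC s) /\ 'D_1 rC s != 0.
  rewrite in_itv/= => hs; have [d dr d0] := rC_derive hs.
  split; first by apply: derivableP; have [] := dr.
  by have [_ ->] := dr.
have cr : {within `[l1, l2], continuous rC}.
  by apply: derivable_within_continuous => s /hd[[]].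
have [c hc] := MVT_segment (ltW l12) (fun s hs => (hd s (subset_itv_oo_cc hs)).1) cr.
rewrite e subrr => /esym/eqP; rewrite mulf_eq0 subr_eq0 (gt_eqF l12) orbF.
by rewrite (negPf (hd c hc).2).
Qed.

End Fibre.

Lemma row_inj n (f g : 'I_n -> R) : \row_j f j = \row_j g j :> 'rV[R]_n -> f =1 g.
Proof.
by move=> h j; have := congr1 (fun u : 'rV[R]_n => u 0 j) h; rewrite !mxE.
Qed.

Lemma row3_eq (x y : 'rV[R]_3) : x 0 0 = y 0 0 -> x 0 1 = y 0 1 ->
  x 0 ord_max = y 0 ord_max -> x = y.
Proof.
move=> h0 h1 h2; apply/rowP => j; case: j => -[|[|[|//]]] j3.
- have -> : Ordinal j3 = 0 by exact/val_inj.
  exact: h0.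
- have -> : Ordinal j3 = 1 by exact/val_inj.
  exact: h1.
- have -> : Ordinal j3 = ord_max by exact/val_inj.
  exact: h2.
Qed.

(** Two different values of [lambda] are excluded by [fibre_r], used for either order of the points.
    For equal [lambda], strict monotonicity of [q] in [psi] identifies [psi], and then [E > 0]
    identifies [etat]. *)
Lemma M3_inj : set_inj (@B2 R) (@M3 R).
Proof.
have key (x y : 'rV[R]_3) : in_box x -> in_box y -> comps x = comps y ->
    x 0 0 < y 0 0 -> False.
  move=> [hx1 hx2 hx3] [hy1 hy2 hy3] e lt.
  have ee := congr1 (fun u : 3.-tuple R => tnth u 0) e.
  have ec := congr1 (fun u : 3.-tuple R => tnth u 1) e.
  have er := congr1 (fun u : 3.-tuple R => tnth u ord_max) e.
  rewrite /comps /= in ee ec er.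
  have qe : q (y 0 0) (y 0 ord_max) = q (x 0 0) (x 0 ord_max).
    by apply: (mulfI (lt0r_neq0 c2_gt0)); exact: esym ec.
  have l1 : 1 <= x 0 0 by case/andP: hx1.
  have l2 : y 0 0 <= 5 by case/andP: hy1.
  by have := fibre_r l1 l2 lt hx3 hy3 hx2 hy2 (erefl _) qe (erefl _) (esym ee); apply.
move=> x y /set_mem hx /set_mem hy e.
have bx := B2_box hx; have by_ := B2_box hy.
have ce : comps x = comps y.
  move: e; rewrite !M3E.
  - move=> e; apply: eq_from_tnth => j.
    exact: (row_inj e j).
  - by case: by_ => /andP[h _] _ _; exact: le_trans h.
  - by case: by_ => _ /andP[h _] _; move: h; clear; lra.
  - by case: bx => /andP[h _] _ _; exact: le_trans h.
  - by case: bx => _ /andP[h _] _; move: h; clear; lra.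
have l : x 0 0 = y 0 0.
  case: (ltgtP (x 0 0) (y 0 0)) => [lt|lt|e0]; last exact: e0.
    by case: (key _ _ bx by_ ce lt).
  by case: (key _ _ by_ bx (esym ce) lt).
have [hx1 hx2 hx3] := bx; have [hy1 hy2 hy3] := by_.
have ee := congr1 (fun u : 3.-tuple R => tnth u 0) ce.
have ec := congr1 (fun u : 3.-tuple R => tnth u 1) ce.
rewrite /comps /= in ee ec.
have qe : q (x 0 0) (x 0 ord_max) = q (x 0 0) (y 0 ord_max).
  by apply: (mulfI (lt0r_neq0 c2_gt0)); rewrite {2}l; exact: ec.
have p : x 0 ord_max = y 0 ord_max.
  case: (ltgtP (x 0 ord_max) (y 0 ord_max)) => [lt|lt|e0]; last exact: e0.
    by have := q_psi hx1 hx3 hy3 lt; rewrite qe ltxx.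
  by have := q_psi hx1 hy3 hx3 lt; rewrite qe ltxx.
have [E0 _ _ _ _] := box_signs hx1 hx3.
have h : x 0 1 = y 0 1.
  have two : (2 : R) != 0 by rewrite pnatr_eq0.
  apply: (mulfI two); apply: (mulIf (lt0r_neq0 E0)).
  by rewrite /ellR -l -p in ee; exact: ee.
exact: (row3_eq l h p).
Qed.

End Injectivity.

(** * The range of the mean degree *)

Section MeanDegree.
Context {R : realType}.
Implicit Types (x : 'rV[R]_3).

Definition mean_degrees : set R := [set M3 x 0 0 | x in @B2 R].

Lemma mean_degreeE x : B2 x ->
  M3 x 0 0 = 2 * x 0 1 * mE (x 0 0) (x 0 ord_max).
Proof.
move=> /B2_box[/andP[h1 _] /andP[h2 _] _]; rewrite M3E ?mxE//.
  exact: le_trans h1.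
by move: h2; move: (x 0 1) => y; clear; lra.
Qed.

(** [E] lies between 1/5 and 7/12, and [2 * etat] between 10 and 30. The upper bound [30 * 7 / 12]
    is exactly [35 / 2]; below, [10 / 5 = 2] is more than the [3 / 2] required for rounding to 2. *)
Lemma mean_degree_bounds x : B2 x -> 3 / 2 <= M3 x 0 0 <= 35 / 2.
Proof.
move=> hx; rewrite mean_degreeE//; have [h1 /andP[h2 h3] h4] := B2_box hx.
have [rho [fE fE7 _ _ _ _ _ _ _ _ _ _]] := box_facts h1 h4.
move: (mE _ _) (2 * _) h2 h3 fE fE7 => e y; clear => h2 h3 fE fE7.
have e0 : 0 <= e by lra.
have u1 : 10 * e <= y * e by rewrite ler_wpM2r.
have u2 : y * e <= 30 * e by rewrite ler_wpM2r.
by apply/andP; split; lra.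
Qed.

Definition point3 (a b c : R) : 'rV[R]_3 := \row_j [:: a; b; c]`_j.

Lemma mean_degree_corner_le : exists2 y, mean_degrees y & y <= 5 / 2.
Proof.
have hx : B2 (point3 1 5 0).
  by rewrite /B2 /= !mxE /= !in_itv /=; split; apply/andP; split; lra.
exists (M3 (point3 1 5 0) 0 0); first by exists (point3 1 5 0).
rewrite (mean_degreeE hx) !mxE /= /mE /lin2 mul0r addr0.
by have := @E0f_1 R; move: (E0f 1) => e; clear; lra.
Qed.

Lemma mean_degree_corner_ge : exists2 y, mean_degrees y & 33 / 2 <= y.
Proof.
have hx : B2 (point3 5 15 (3 / 20)).
  by rewrite /B2 /= !mxE /= !in_itv /=; split; apply/andP; split; lra.
exists (M3 (point3 5 15 (3 / 20)) 0 0); first by exists (point3 5 15 (3 / 20)).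
rewrite (mean_degreeE hx) !mxE /= /mE /lin2.
by have := @E_corner R; move: (E0f 5) (E1f 5) => e f; clear; lra.
Qed.

Lemma inf_mean_degree : `|inf mean_degrees - 2| <= 1 / 2.
Proof.
have [y hy y52] := mean_degree_corner_le.
have lb : lbound mean_degrees (3 / 2).
  by move=> _ [x hx <-]; case/andP: (mean_degree_bounds hx).
have h1 : 3 / 2 <= inf mean_degrees by apply: lb_le_inf => //; exists y.
have h2 : inf mean_degrees <= y by apply: ge_inf => //; exists (3 / 2).
move: (inf _) h1 h2 y52 => i; clear => h1 h2 h3.
by rewrite ler_norml; apply/andP; split; lra.
Qed.

Lemma sup_mean_degree : `|sup mean_degrees - 17| <= 1 / 2.
Proof.
have [y hy y52] := mean_degree_corner_ge.
have ub : ubound mean_degrees (35 / 2).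
  by move=> _ [x hx <-]; case/andP: (mean_degree_bounds hx).
have h1 : sup mean_degrees <= 35 / 2 by apply: ge_sup => //; exists y.
have h2 : y <= sup mean_degrees by apply: ub_le_sup => //; exists (35 / 2).
move: (sup _) h1 h2 y52 => i; clear => h1 h2 h3.
by rewrite ler_norml; apply/andP; split; lra.
Qed.

End MeanDegree.

Theorem theoremS5p6 (R : realType) :
  [/\ (* the box in terms of eta *)
      [/\ forall eta : R, 0 <= eta ->
            (pi * eta ^+ 2 / 2 \in `[5, 15]) =
            (eta \in `[Num.sqrt (10 / pi), Num.sqrt (30 / pi)]),
          `|Num.sqrt (10 / pi) - 1784 / 1000| <= 1 / 2000 :> R
        & `|Num.sqrt (30 / pi) - 3090 / 1000| <= 1 / 2000 :> R],
      (* extreme mean degrees, rounded to the nearest integer *)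
      `|inf [set M3 x 0 0 | x in @B2 R] - 2| <= 1 / 2 /\
      `|sup [set M3 x 0 0 | x in @B2 R] - 17| <= 1 / 2,
      set_inj (@B2 R) (@M3 R)
    & forall x : 'rV[R]_3, B2 x ->
        differentiable (@M3 R) x /\ 1 / 100 <= sigma_min (DM3 x)].
Proof.
split.
- split; [exact: eta_interval|exact: eta_lower|exact: eta_upper].
- split; [exact: inf_mean_degree|exact: sup_mean_degree].
- exact: M3_inj.
- by move=> x hx; split; [exact: M3_differentiable|exact: M3_sigma_min].
Qed.
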